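(* Let $a$ be a positive self-adjoint injective operator affiliated with a von Neumann algebra $\mathcal{M}$ acting on a Hilbert space $H$ (neither $a$ nor $a^{-1}$ is assumed bounded). Let $(\underline{\mathfrak{L}_{0,\infty}},\overline{\tau_{0,\infty}})$, $(\overline{\mathfrak{L}_{0,\infty}},\underline{\tau_{0,\infty}})$, $\underline{\lim}\,L_\infty(a^\alpha)$ and $\overline{\lim}\,L_\infty(a^\alpha)$ be the spaces defined in the context. If $\underline{\mathfrak{L}_{0,\infty}}=\overline{\mathfrak{L}_{0,\infty}}$ and $\underline{\tau_{0,\infty}}=\overline{\tau_{0,\infty}}$, then the upper and lower limits coincide and $$\mathfrak{L}_\infty(a):=\overline{\lim}\,L_\infty(a^\alpha)=\underline{\lim}\,L_\infty(a^\alpha)$$ is an (LF)-space.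
   Context: An (LF)-space is a locally convex inductive limit of an increasing sequence of Fréchet spaces with continuous inclusions (a Fréchet space is an (LF)-space, with constant sequence). Decomposition of $a$. Let $P$ be the spectral measure of $a$, $p_0=P([0,1])$, $p_\infty=\mathbf{1}-p_0$, $a_0=ap_0$, $a_\infty=ap_\infty$. Then $a_0|_{p_0H}$ is injective and bounded and $a_\infty|_{p_\infty H}$ is injective with bounded inverse. $\mathcal{M}_{p}$ denotes the reduced von Neumann algebra $p\mathcal{M}p|_{pH}$. Diagonal entries. For a von Neumann algebra $\mathcal{N}$ and a positive self-adjoint injective operator $b$ affiliated with $\mathcal{N}$, $L_\infty(b)$ is the space of sesquilinear forms $\widehat{b^{1/2}xb^{1/2}}(f,g)=\langle xb^{1/2}f,b^{1/2}g\rangle$ ($f,g\in D(b^{1/2})$), $x\in\mathcal{N}$, with norm $\|\widehat{b^{1/2}xb^{1/2}}\|_b=\|x\|$. Forms attached to different powers of $b$ are compared by restricting them to the common core $\bigcap_{\alpha>0}D(b^{\alpha})$. The space $L_\infty(a_0^\alpha)$ is understood as $L_\infty((a_0|_{p_0H})^\alpha)$ over $\mathcal{M}_{p_0}$, and $L_\infty(a_\infty^\alpha)$ as $L_\infty((a_\infty|_{p_\infty H})^\alpha)$ over $\mathcal{M}_{p_\infty}$. Set $\mathfrak{L}_\infty(a_0)=\bigcap_{\alpha>1}L_\infty(a_0^\alpha)$ with the topology $\tau_\infty(a_0)$ defined by the norms $\|\cdot\|_{a_0^\alpha}$, $\alpha>1$; and $\mathfrak{L}_\infty(a_\infty)=\bigcup_{\alpha>1}L_\infty(a_\infty^\alpha)$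 with $\tau_\infty(a_\infty)$ the strongest locally convex topology making all inclusions $L_\infty(a_\infty^\alpha)\to\mathfrak{L}_\infty(a_\infty)$ continuous. Off-diagonal entries. For $\alpha,\beta>0$ let $\mathcal{S}_{0,\infty}^{\alpha,\beta}$ be the space of forms $\widehat{a_0^\alpha xa_\infty^\beta}(f,g)=\langle xa_\infty^\beta f,a_0^\alpha g\rangle$ ($f\in D(a_\infty^\beta)$, $g\in H$), $x\in\mathcal{M}$; the form determines and depends only on $p_0xp_\infty$, and its norm is $\|p_0xp_\infty\|$. Forms with different $\beta$ are compared by restricting them to $\left(\bigcap_{\beta>0}D(a_\infty^\beta)\right)\times H$. For $\alpha_1<\alpha_2$, $\beta_1<\beta_2$ one has continuous inclusions $\mathcal{S}_{0,\infty}^{\alpha_1,\beta_1}\subset\mathcal{S}_{0,\infty}^{\alpha_1,\beta_2}$ and $\mathcal{S}_{0,\infty}^{\alpha_2,\beta_1}\subset\mathcal{S}_{0,\infty}^{\alpha_1,\beta_1}$. Put: - $\mathfrak{S}_0^\alpha=\bigcup_{\beta>0}\mathcal{S}_{0,\infty}^{\alpha,\beta}$ with $\tau_0^\alpha$ the strongest locally convex topology making all inclusions $\mathcal{S}_{0,\infty}^{\alpha,\beta}\to\mathfrak{S}_0^\alpha$ continuous; - $\mathfrak{S}_\infty^\beta=\bigcap_{\alpha>0}\mathcal{S}_{0,\infty}^{\alpha,\beta}$ with $\tau_\infty^\beta$ the weakest topology making all inclusions $\mathfrak{S}_\infty^\beta\to\mathcal{S}_{0,\infty}^{\alpha,\beta}$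 continuous; - $\underline{\mathfrak{L}_{0,\infty}}=\bigcup_{\beta>0}\mathfrak{S}_\infty^\beta$ with $\overline{\tau_{0,\infty}}$ the strongest locally convex topology making all inclusions $(\mathfrak{S}_\infty^\beta,\tau_\infty^\beta)\to\underline{\mathfrak{L}_{0,\infty}}$ continuous; - $\overline{\mathfrak{L}_{0,\infty}}=\bigcap_{\alpha>0}\mathfrak{S}_0^\alpha$ with $\underline{\tau_{0,\infty}}$ the weakest topology making all inclusions $\overline{\mathfrak{L}_{0,\infty}}\to(\mathfrak{S}_0^\alpha,\tau_0^\alpha)$ continuous. The spaces $(\underline{\mathfrak{L}_{\infty,0}},\overline{\tau_{\infty,0}})$ and $(\overline{\mathfrak{L}_{\infty,0}},\underline{\tau_{\infty,0}})$ are the images of $(\underline{\mathfrak{L}_{0,\infty}},\overline{\tau_{0,\infty}})$ and $(\overline{\mathfrak{L}_{0,\infty}},\underline{\tau_{0,\infty}})$ under the conjugate-linear bijection $u\mapsto u^*$, $u^*(f,g)=\overline{u(g,f)}$ (that is, they are built in the same way from the forms $\langle xa_0^\alpha f,a_\infty^\beta g\rangle$). Limits. $\underline{\lim}\,L_\infty(a^\alpha)$ and $\overline{\lim}\,L_\infty(a^\alpha)$ are the spaces of $2\times2$ matrices of sesquilinear forms (with respect to $H=p_0H\oplus p_\infty H$) $$\begin{pmatrix}(\mathfrak{L}_\infty(a_0),\tau_\infty(a_0))&(\underline{\mathfrak{L}_{0,\infty}},\overline{\tau_{0,\infty}})\\(\underline{\mathfrak{L}_{\infty,0}},\overline{\tau_{\infty,0}})&(\mathfrak{L}_\infty(a_\infty),\tau_\infty(a_\infty))\end{pmatrix},\qquad\begin{pmatrix}(\mathfrak{L}_\infty(a_0),\tau_\infty(a_0))&(\overline{\mathfrak{L}_{0,\infty}},\underline{\tau_{0,\infty}})\\(\overline{\mathfrak{L}_{\infty,0}},\underline{\tau_{\infty,0}})&(\mathfrak{L}_\infty(a_\infty),\tau_\infty(a_\infty))\end{pmatrix}$$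 respectively, with the product topology of the four entries. *)

(* Defs.v *)
From HB Require Import structures.
From mathcomp Require Import all_boot all_order all_algebra sesquilinear complex.
From mathcomp Require Import all_classical all_reals all_analysis.
Set Implicit Arguments.
Unset Strict Implicit.
Unset Printing Implicit Defensive.
Import Order.TTheory GRing.Theory Num.Theory.
Import numFieldNormedType.Exports.
Local Open Scope classical_set_scope.
Local Open Scope complex_scope.
Local Open Scope ring_scope.

(* Many different topologized subspaces of one vector space V have to be
   compared, so a space is a subset of V together with its family of open
   sets; equality of two spaces is equality of the sets and of the topologies. *)
Record lspace (V : Type) := LSpace { pts : set V; opens : set (set V) }.

Definition topology_on (V : Type) (E : set V) (T : set (set V)) : Prop :=
  [/\ forall U, T U -> U `<=` E,
      T E,
      forall G, G `<=` T -> T (\bigcup_(U in G) U) &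
      forall U W, T U -> T W -> T (U `&` W)].

Definition continuous_inclusion (V : Type) (X Y : lspace V) : Prop :=
  pts X `<=` pts Y /\ forall W, opens Y W -> opens X (pts X `&` W).

Definition image_space (V W : Type) (j : V -> W) (X : lspace V) : lspace W :=
  LSpace (j @` pts X) [set j @` U | U in opens X].

Definition prod_space (V W : Type) (X : lspace V) (Y : lspace W)
    : lspace (V * W) :=
  LSpace (pts X `*` pts Y)
    (smallest (topology_on (pts X `*` pts Y))
       [set U | exists A B, [/\ opens X A, opens Y B & U = A `*` B]]).

Definition projective_space (V I : Type) (D : set I) (X : I -> lspace V)
    : lspace V :=
  let E := \bigcap_(i in D) pts (X i) in
  LSpace E
    (smallest (topology_on E)
       [set U | exists i W, [/\ D i, opens (X i) W & U = E `&` W]]).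

Section LocallyConvex.
Context {R : realType} {V : lmodType R[i]}.
Implicit Types (E : set V) (p : V -> R).

Definition linear_subspace E : Prop :=
  E 0 /\ forall (k : R[i]) u v, E u -> E v -> E (k *: u + v).

Definition seminorm_on E p : Prop :=
  [/\ forall u, E u -> 0 <= p u,
      forall (k : R[i]) u, E u -> p (k *: u) = complex.Re `|k| * p u &
      forall u v, E u -> E v -> p (u + v) <= p u + p v].

Definition seminorm_topology E (S : set (V -> R)) : set (set V) :=
  [set U | U `<=` E /\ forall u, U u ->
     exists (F : set (V -> R)) (e : R), [/\ finite_set F, F `<=` S, 0 < e &
       forall v, E v -> (forall p, F p -> p (v - u) < e) -> U v]].

Definition lc_topology E (T : set (set V)) : Prop :=
  linear_subspace E /\
  exists2 S : set (V -> R), (forall p, S p -> seminorm_on E p) &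
    T = seminorm_topology E S.

Definition normed_space E p : lspace V :=
  LSpace E (seminorm_topology E [set p]).

(* The strongest locally convex topology making the inclusions continuous is
   the supremum of all locally convex topologies that do so. *)
Definition inductive_space (I : Type) (D : set I) (X : I -> lspace V)
    : lspace V :=
  let E := \bigcup_(i in D) pts (X i) in
  LSpace E
    (smallest (topology_on E)
       [set U | exists T, [/\ lc_topology E T,
          forall i, D i -> continuous_inclusion (X i) (LSpace E T) & T U]]).

Definition frechet (X : lspace V) : Prop :=
  linear_subspace (pts X) /\
  exists p : nat -> V -> R,
    [/\ forall k, seminorm_on (pts X) (p k),
        forall u, pts X u -> (forall k, p k u = 0) -> u = 0,
        opens X = seminorm_topology (pts X) (range p) &
        forall u : nat -> V, (forall n, pts X (u n)) ->
          (forall k (e : R), 0 < e -> exists N : nat, forall m n : nat,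
             (N <= m)%N -> (N <= n)%N -> p k (u m - u n) < e) ->
          exists2 l, pts X l & forall k, p k (u n - l) @[n --> \oo] --> (0 : R)].

Definition LF_space (X : lspace V) : Prop :=
  exists Y : nat -> lspace V,
    [/\ forall n, frechet (Y n),
        forall n, continuous_inclusion (Y n) (Y n.+1) &
        X = inductive_space setT Y].

End LocallyConvex.

Structure hilbertType (R : realType) := HilbertType {
  hsort :> completeNormedModType R[i];
  hdot : {dot hsort for Num.conj};
  hdotE : forall f : hsort, `|f| ^+ 2 = hdot f f }.

Notation "<| f , g |>" := (hdot _ f g)
  (at level 0, f at level 99, g at level 99, format "<| f ,  g |>").

(* A possibly unbounded operator; the values off [dom] are meaningless. *)
Record operator (T : Type) := Operator { dom : set T; opval :> T -> T }.

HB.instance Definition _ (T : Type) := gen_eqMixin (operator T).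
HB.instance Definition _ (T : Type) := gen_choiceMixin (operator T).
HB.instance Definition _ (T : Type) :=
  isPointed.Build (operator T) (Operator set0 id).

Section Operators.
Context {R : realType} {H : hilbertType R}.
Implicit Types (x y p : H -> H) (M : set (H -> H)) (a b c : operator H).

Definition hnorm (f : H) : R := complex.Re `|f|.

Definition bounded_op x : Prop := linear x /\ continuous x.

Definition opnorm x : R := sup [set hnorm (x f) | f in [set f | hnorm f <= 1]].

Definition adjoint_of x y : Prop := forall f g : H, <|x f, g|> = <|f, y g|>.

Definition commutant M : set (H -> H) :=
  [set y | bounded_op y /\ forall x, M x -> y \o x = x \o y].

Definition von_neumann M : Prop :=
  [/\ forall x, M x -> bounded_op x,
      forall x, M x -> exists2 y, M y & adjoint_of x y &
      commutant (commutant M) = M].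

Definition unitary_op x : Prop :=
  [/\ bounded_op x, range x = setT & forall f g, <|x f, x g|> = <|f, g|>].

Definition linear_operator a : Prop :=
  dom a 0 /\ forall (k : R[i]) f g, dom a f -> dom a g ->
    dom a (k *: f + g) /\ a (k *: f + g) = k *: a f + a g.

Definition selfadjoint a : Prop :=
  [/\ linear_operator a, dense (dom a) &
      forall f h, (forall g, dom a g -> <|a g, f|> = <|g, h|>) <->
                  (dom a f /\ a f = h)].

Definition positive_operator a : Prop := forall f, dom a f -> 0 <= <|a f, f|>.

Definition injective_operator a : Prop :=
  forall f, dom a f -> a f = 0 -> f = 0.

Definition affiliated M a : Prop :=
  forall u, commutant M u -> unitary_op u ->
    forall f, dom a f -> dom a (u f) /\ a (u f) = u (a f).

(* In what follows p is an orthogonal projection, and everything takes place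
   in the Hilbert space pH; p = id gives H itself. An operator on pH is an
   operator on H with domain and values in pH; a bounded everywhere defined
   operator y on pH is extended by 0, i.e., y = p y p. *)

Definition projection p : Prop :=
  [/\ linear p, p \o p = p & adjoint_of p p].

Definition projection_valued_measure p (Q : set R -> H -> H) : Prop :=
  [/\ forall A, measurable A -> projection (Q A),
      Q setT = p &
      forall F : nat -> set R, (forall n, measurable (F n)) ->
        trivIset setT F -> forall f : H,
        \sum_(k < n) Q (F k) f @[n --> \oo] --> Q (\bigcup_n F n) f].

Definition diag_measure (Q : set R -> H -> H) (f : H) (A : set R) : \bar R :=
  (complex.Re <|Q A f, f|>)%:E.

(* b is the integral of the real function phi against Q. Being linear with
   values in pH and a domain dense in pH, it is determined by its quadratic
   form, by polarization. *)
Definition spectral_integral p (Q : set R -> H -> H) (phi : R -> R) b : Prop :=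
  [/\ linear_operator b,
      forall f, dom b f <->
        p f = f /\ (\int[diag_measure Q f]_t ((phi t) ^+ 2)%:E < +oo)%E,
      forall f, dom b f -> p (b f) = b f &
      forall f, dom b f ->
        <|b f, f|> = (fine (\int[diag_measure Q f]_t (phi t)%:E))%:C].

Definition spectral_measure p b (Q : set R -> H -> H) : Prop :=
  projection_valued_measure p Q /\ spectral_integral p Q id b.

(* The power b^alpha, alpha > 0, of a positive self-adjoint operator b on pH. *)
Definition opow p b (alpha : R) : operator H :=
  get [set c | exists2 Q, spectral_measure p b Q &
                          spectral_integral p Q (fun t => t `^ alpha) c].

(* The intersection of the domains of all b^alpha, alpha > 0. *)
Definition core p b : set H :=
  [set f | forall alpha : R, 0 < alpha -> dom (opow p b alpha) f].

(* b o p, with its natural domain. *)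
Definition op_comp b p : operator H :=
  Operator [set f | dom b (p f)] (b \o p).

(* The restriction of b to an operator on pH. *)
Definition op_restr b p : operator H :=
  Operator (dom b `&` [set f | p f = f]) b.

(* The reduced algebra pMp, acting on pH. *)
Definition reduced M p : set (H -> H) := [set p \o x \o p | x in M].

Section Linf.
(* Forms are restricted to D; N acts on pH. *)
Variables (p : H -> H) (N : set (H -> H)) (D : set H).

Definition Linf_form c x : D -> D -> R[i]^o :=
  fun f g => <|x (opow p c 2^-1 (\val f)), opow p c 2^-1 (\val g)|>.

Definition Linf c : set (D -> D -> R[i]^o) := [set Linf_form c x | x in N].

(* x is determined by the form, so this is the infimum of a singleton. *)
Definition Linf_norm c (u : D -> D -> R[i]^o) : R :=
  inf [set opnorm x | x in [set x | N x /\ Linf_form c x = u]].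

End Linf.

Definition form_adjoint (D D' : Type) (u : D -> D' -> R[i]^o)
    : D' -> D -> R[i]^o :=
  fun f g => Num.conj (u g f : R[i]).

End Operators.

Section Limits.
Context {R : realType} {H : hilbertType R}.
(* P is the spectral measure of a. *)
Variables (M : set (H -> H)) (a : operator H) (P : set R -> H -> H).

Definition p_zero : H -> H := P `[0, 1].
Definition p_infty : H -> H := fun f => f - p_zero f.

Definition a_zero : operator H := op_comp a p_zero.
Definition a_infty : operator H := op_comp a p_infty.

Definition b_zero : operator H := op_restr a_zero p_zero.
Definition b_infty : operator H := op_restr a_infty p_infty.

Notation core_zero := (core p_zero b_zero).
Notation core_infty := (core p_infty b_infty).

Definition Linf_zero (alpha : R) : set (core_zero -> core_zero -> R[i]^o) :=
  @Linf R H p_zero (reduced M p_zero) core_zero (opow p_zero b_zero alpha).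

Definition Linf_zero_norm (alpha : R) : (core_zero -> core_zero -> R[i]^o) -> R :=
  @Linf_norm R H p_zero (reduced M p_zero) core_zero (opow p_zero b_zero alpha).

Definition Linf_infty (alpha : R) : set (core_infty -> core_infty -> R[i]^o) :=
  @Linf R H p_infty (reduced M p_infty) core_infty (opow p_infty b_infty alpha).

Definition Linf_infty_norm (alpha : R)
    : (core_infty -> core_infty -> R[i]^o) -> R :=
  @Linf_norm R H p_infty (reduced M p_infty) core_infty
    (opow p_infty b_infty alpha).

Definition frakL_zero : lspace (core_zero -> core_zero -> R[i]^o) :=
  let E := \bigcap_(alpha in [set alpha : R | 1 < alpha]) Linf_zero alpha in
  LSpace E (seminorm_topology E
    [set Linf_zero_norm alpha | alpha in [set alpha : R | 1 < alpha]]).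

Definition frakL_infty : lspace (core_infty -> core_infty -> R[i]^o) :=
  inductive_space [set alpha : R | 1 < alpha]
    (fun alpha => normed_space (Linf_infty alpha) (@Linf_infty_norm alpha)).

(* The off-diagonal entries use the powers of a_zero and a_infty as operators
   on H, not on p_zero H and p_infty H. *)
Notation Dinfty := (core id a_infty).

Definition off_form (alpha beta : R) (x : H -> H) : Dinfty -> H -> R[i]^o :=
  fun f g => <|x (opow id a_infty beta (\val f)), opow id a_zero alpha g|>.

Definition off_set (alpha beta : R) : set (Dinfty -> H -> R[i]^o) :=
  [set off_form alpha beta x | x in M].

(* The form determines p_zero x p_infty: infimum of a singleton. *)
Definition off_norm (alpha beta : R) (u : Dinfty -> H -> R[i]^o) : R :=
  inf [set opnorm (p_zero \o x \o p_infty)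
       | x in [set x | M x /\ off_form alpha beta x = u]].

Definition off_space (alpha beta : R) : lspace (Dinfty -> H -> R[i]^o) :=
  normed_space (off_set alpha beta) (@off_norm alpha beta).

Definition frakS_zero (alpha : R) : lspace (Dinfty -> H -> R[i]^o) :=
  inductive_space [set beta : R | 0 < beta] (fun beta => off_space alpha beta).

Definition frakS_infty (beta : R) : lspace (Dinfty -> H -> R[i]^o) :=
  projective_space [set alpha : R | 0 < alpha]
    (fun alpha => off_space alpha beta).

Definition lower_off : lspace (Dinfty -> H -> R[i]^o) :=
  inductive_space [set beta : R | 0 < beta] frakS_infty.

Definition upper_off : lspace (Dinfty -> H -> R[i]^o) :=
  projective_space [set alpha : R | 0 < alpha] frakS_zero.

(* Matrices are stored by rows, as pairs of pairs. *)
Definition matrix_space (off : lspace (Dinfty -> H -> R[i]^o)) :=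
  prod_space
    (prod_space frakL_zero off)
    (prod_space (image_space (@form_adjoint R _ _) off) frakL_infty).

Definition lower_limit := matrix_space lower_off.
Definition upper_limit := matrix_space upper_off.

End Limits.

(* Main.v *)
(* Write p0 = P[0,1] and p1 = 1 - p0. On the common core, the powers of a0
   and of a1 with different exponents differ by bounded contractions of M
   (t^x cut off to [0,1] for x >= 0, resp. to the complement of [0,1] for
   x <= 0). So along each entry the spaces of forms are Banach spaces
   (quotients of the closed subspaces pMp or M of B(H) by closed kernels), and
   they are nested, with norms comparable with constant 1. Countable
   decreasing intersections of them are Frechet spaces, and real indices may
   be replaced by a cofinal sequence. Hence the lower limit is built from L0
   and from two inductive sequences of Frechet spaces; since an inductive
   limit is determined by its continuous seminorms, and a seminorm on a product
   is continuous iff its two partial seminorms are, finite products commute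
   with inductive limits of sequences, and the lower limit is an (LF)-space.

   The operator theoretic input is the uniqueness of the spectral measure of a
   positive operator b: the range of Q]-oo,l] consists of the f with
   |b^n f| = O(m^n) for all m > l. It shows that P commutes with every
   unitary of the commutant of M, so that P takes its values in M, and that
   the powers defined by means of [get] are the expected integrals against P.
   The existence of unbounded powers is never needed. *)
From HB Require Import structures.
Require Import Defs.
From mathcomp Require Import all_boot all_order all_algebra sesquilinear complex.
From mathcomp Require Import all_classical all_reals all_analysis.
From mathcomp Require Import measurable_realfun.
From mathcomp Require Import ring lra.
Import Order.TTheory GRing.Theory Num.Theory.
Import numFieldNormedType.Exports.
Set Implicit Arguments.
Unset Strict Implicit.
Unset Printing Implicit Defensive.
Local Open Scope classical_set_scope.
Local Open Scope ring_scope.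

(** * Locally convex spaces *)

(** The main obstacle is that [spectral_integral] pins an operator down only by its domain and its
    quadratic form. Commutation with spectral projections, norm bounds and products of functions
    must all be extracted from diagonal values; polarization with k = 1 and k = i does this. A
    bounded function psi with values in [0,1] is realized as the sum of 2^-(k+1) times the spectral
    projection of its k-th binary digit. The series converges geometrically in norm, so
    self-adjointness, commutation and the bound 1 pass to the limit T. For psi = t^(beta - alpha),
    cut off, T carries one power to the other, and the form of x becomes that of T x T, T x or x T
    for the other exponent: hence the constant 1. Affiliation tests unitaries only. A self-adjoint y
    in the commutant is recovered from its Cayley transform, and a general y from y + y' and i(y -
    y'), with y' its adjoint. The norms of forms are treated as quotient norms over all representing
    x; definiteness then follows from boundedness of the evaluations of a form, with no need to
    select x. *)

Section SeminormedSpaces.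
Context {R : realType} {V : lmodType R[i]}.
Implicit Types (E U W : set V) (p q : V -> R) (S : set (V -> R)) (X Y : lspace V).

Lemma linear_subspaceD E u v : linear_subspace E -> E u -> E v -> E (u + v).
Proof. by move=> [_ h] Eu Ev; rewrite -[u]scale1r; exact: h. Qed.

Lemma linear_subspaceB E u v : linear_subspace E -> E u -> E v -> E (u - v).
Proof. by move=> [_ h] Eu Ev; rewrite addrC -scaleN1r; exact: h. Qed.

Lemma linear_subspaceZ E k u : linear_subspace E -> E u -> E (k *: u).
Proof. by move=> [E0 h] Eu; rewrite -[_ *: _]addr0; exact: h. Qed.

Lemma seminorm0 E p : linear_subspace E -> seminorm_on E p -> p 0 = 0.
Proof.
by move=> [E0 _] [_ pZ _]; rewrite -(scale0r (0 : V)) pZ// normr0 mul0r.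
Qed.

Lemma seminormBC E p u v : linear_subspace E -> seminorm_on E p ->
  E u -> E v -> p (u - v) = p (v - u).
Proof.
move=> lE [_ pZ _] Eu Ev; rewrite (_ : u - v = -1 *: (v - u)).
  by rewrite pZ ?normrN ?normr1 ?mul1r//; exact: linear_subspaceB.
by rewrite scaleN1r opprB.
Qed.

Lemma seminorm_triangle E p u v w : linear_subspace E -> seminorm_on E p ->
  E u -> E v -> E w -> p (u - w) <= p (u - v) + p (v - w).
Proof.
move=> lE [_ _ pD] Eu Ev Ew.
rewrite (_ : u - w = (u - v) + (v - w)); last by rewrite addrA subrK.
by apply: pD; apply: linear_subspaceB.
Qed.

Lemma seminorm_ltD E p u v : linear_subspace E -> seminorm_on E p ->
  E u -> E v -> p v <= p u + p (v - u).
Proof.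
move=> lE [_ _ pD] Eu Ev; rewrite -{1}(subrKC u v).
by apply: pD => //; exact: linear_subspaceB.
Qed.

Lemma sub_seminorm_on E W p : E `<=` W -> seminorm_on W p -> seminorm_on E p.
Proof.
move=> EW [p0 pZ pD]; split=> [u /EW|k u /EW|u v /EW + /EW] //; last exact: pD.
- exact: p0.
- exact: pZ.
Qed.

Lemma sub_seminorm_topology E S S' :
  S `<=` S' -> seminorm_topology E S `<=` seminorm_topology E S'.
Proof.
move=> SS' U [UE hU]; split=> // u /hU [F [e [? FS ? ?]]].
by exists F, e; split=> //; exact: subset_trans SS'.
Qed.

Lemma topology_seminorm E S : topology_on E (seminorm_topology E S).
Proof.
split.
- by move=> U [].
- split=> // u Eu; exists set0, 1; split=> //; exact: ltr01.
- move=> G GT; split=> [u [U /GT [UE _]]|u [U GU Uu]]; first exact: UE.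
  have [_ /(_ _ Uu) [F [e [? ? ? h]]]] := GT _ GU.
  by exists F, e; split=> // v Ev hv; exists U => //; exact: h.
- move=> U W [UE hU] [WE hW]; split=> [u [/UE]//|u [/hU + /hW]].
  move=> [F [e [fF FS e0 h]]] [F' [e' [fF' FS' e0' h']]].
  exists (F `|` F'), (Num.min e e'); split=> //.
  + by rewrite finite_setU.
  + by rewrite subUset.
  + by rewrite lt_min e0.
  + move=> v Ev hv; split; [apply: h => // p Fp|apply: h' => // p Fp].
      by have := hv p (or_introl Fp); rewrite lt_min => /andP[].
    by have := hv p (or_intror Fp); rewrite lt_min => /andP[].
Qed.

Definition seminorm_ball E p u (e : R) : set V := E `&` [set v | p (v - u) < e].

Lemma seminorm_ball_open E S p u e : linear_subspace E -> seminorm_on E p ->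
  S p -> E u -> seminorm_topology E S (seminorm_ball E p u e).
Proof.
move=> lE sp Sp Eu; split=> [v []//|v [Ev /= pv]].
exists [set p], (e - p (v - u)); split=> //.
- by move=> _ ->.
- by rewrite subr_gt0.
- move=> w Ew /(_ p erefl) h; split=> //=.
  have := seminorm_triangle lE sp Ew Ev Eu; lra.
Qed.

(** Every comparison with a [smallest] topology below goes through this: to bound the seminorm
    topology from above it is enough to put the balls into [T]. *)
Lemma seminorm_topology_min E S (T : set (set V)) :
  linear_subspace E -> (forall p, S p -> seminorm_on E p) -> topology_on E T ->
  (forall p u e, S p -> E u -> 0 < e -> T (seminorm_ball E p u e)) ->
  seminorm_topology E S `<=` T.
Proof.
move=> lE sS [TE TT TU TI] hT U [UE hU].
(* Unions are free in [T], so each point of [U] only needs a member of [T] around it inside [U]: a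
   finite intersection of balls centred at that point, handled by induction on the list of
   seminorms. *)
have -> : U = \bigcup_(W in [set W | T W /\ W `<=` U]) W.
  rewrite eqEsubset; split=> [u Uu|u [W [_ WU]] /WU//].
  have [F [e [/finite_seqP[s ->{F}] FS e0 h]]] := hU _ Uu.
  have Eu := UE _ Uu.
  exists (E `&` [set v | forall p, p \in s -> p (v - u) < e]); last first.
    split=> //= p ps; rewrite subrr (seminorm0 lE)//.
    exact/sS/FS.
  split; last by move=> v [Ev hv]; exact: h.
  elim: s FS {h} => [|p s IH] FS.
    by rewrite (_ : _ `&` _ = E)//; apply/seteqP; split=> [v []//|v Ev]; split.
  rewrite (_ : _ `&` _ = seminorm_ball E p u e `&`
    (E `&` [set v | forall p, p \in s -> p (v - u) < e])).
    apply: TI; first by apply: hT => //; apply: FS; rewrite /= inE eqxx.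
    by apply: IH => q qs; apply: FS; rewrite /= inE qs orbT.
  apply/seteqP; split=> v /=.
    move=> [Ev h]; split; first by split=> //=; apply: h; rewrite inE eqxx.
    by split=> // q qs; apply: h; rewrite inE qs orbT.
  move=> [[_ /= h1] [Ev h2]]; split=> // q; rewrite inE => /orP[/eqP -> //|].
  exact: h2.
by apply: TU => W [].
Qed.

Definition lc_space X := lc_topology (pts X) (opens X).

(** Only balls about 0 are required to be open; in a locally convex space the triangle inequality
    supplies the other centres. *)
Definition continuous_seminorm X p : Prop :=
  seminorm_on (pts X) p /\ forall e, 0 < e -> opens X (pts X `&` [set v | p v < e]).

Lemma continuous_seminormE X S p : linear_subspace (pts X) ->
  (forall p, S p -> seminorm_on (pts X) p) ->
  opens X = seminorm_topology (pts X) S ->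
  continuous_seminorm X p <-> (seminorm_on (pts X) p /\ forall e, 0 < e ->
    exists (F : set (V -> R)) (d : R), [/\ finite_set F, F `<=` S, 0 < d &
       forall v, pts X v -> (forall q, F q -> q v < d) -> p v < e]).
Proof.
move=> lE sS oX; split=> -[sp hp]; split=> // e e0.
  have := hp _ e0; rewrite oX => -[_ /(_ 0)] /=.
  have := seminorm0 lE sp => -> -[|F [d [? ? ? h]]]; first by split=> //; exact: lE.1.
  exists F, d; split=> // v Ev hv.
  by have [|] := h v Ev _ => // q Fq; rewrite subr0; exact: hv.
rewrite oX; split=> [v []//|u [Eu /= pu]].
have e0' : 0 < e - p u by rewrite subr_gt0.
have [F [d [fF FS d0 h]]] := hp _ e0'; exists F, d; split=> // v Ev hv.
split=> //=; have := h _ (linear_subspaceB lE Ev Eu) hv.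
by have := seminorm_ltD lE sp Eu Ev; lra.
Qed.

Lemma seminorm_continuous X S p : linear_subspace (pts X) ->
  (forall p, S p -> seminorm_on (pts X) p) ->
  opens X = seminorm_topology (pts X) S -> S p -> continuous_seminorm X p.
Proof.
move=> lE sS oX Sp; apply/(continuous_seminormE _ lE sS oX).
split=> [|e e0]; first exact: sS.
exists [set p], e; split=> //; first by move=> _ ->.
by move=> v Ev; apply.
Qed.

(** The generating family of a locally convex topology is not unique, but the family of all
    continuous seminorms is canonical. Hence spaces with the same points can be compared seminorm by
    seminorm, as in [lc_space_ext]. *)
Lemma lc_opensE X : lc_space X ->
  opens X = seminorm_topology (pts X) (continuous_seminorm X).
Proof.
move=> [lE [S sS oX]]; apply/seteqP; split; last first.
  apply: seminorm_topology_min => //; first by move=> p [].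
    by rewrite oX; exact: topology_seminorm.
  move=> p u e /(continuous_seminormE _ lE sS oX) [sp hp] Eu e0.
  rewrite oX; split=> [v []//|v [Ev /= pv]].
  have e0' : 0 < e - p (v - u) by rewrite subr_gt0.
  have [F [d [fF FS d0 h]]] := hp _ e0'; exists F, d; split=> // w Ew hw.
  split=> //=; have := h _ (linear_subspaceB lE Ew Ev) hw.
  by have := seminorm_triangle lE sp Ew Ev Eu; lra.
rewrite {1}oX; apply: sub_seminorm_topology => p Sp.
exact: (seminorm_continuous lE sS oX).
Qed.

Lemma lc_space_ext X Y : lc_space X -> lc_space Y -> pts X = pts Y ->
  (forall p, continuous_seminorm X p <-> continuous_seminorm Y p) -> X = Y.
Proof.
move=> lX lY XY cXY.
have oXY : opens X = opens Y.
  rewrite (lc_opensE lX) (lc_opensE lY) XY; congr seminorm_topology.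
  by apply/seteqP; split=> p /cXY.
by case: X Y XY oXY {lX lY cXY} => [EX oX] [EY oY] /= -> ->.
Qed.

Lemma continuous_inclusion_seminorm X Y p : continuous_inclusion X Y ->
  continuous_seminorm Y p -> continuous_seminorm X p.
Proof.
move=> [XY h] [sp hp]; split=> [|e /hp/h]; first exact: sub_seminorm_on sp.
by rewrite setIA (setIidl XY).
Qed.

Lemma seminorm_continuous_inclusion X E S : lc_space X -> pts X `<=` E ->
  (forall p, S p -> continuous_seminorm X p) ->
  continuous_inclusion X (LSpace E (seminorm_topology E S)).
Proof.
move=> lX XE h; split=> //= W [WE hW]; rewrite lc_opensE//.
split=> [v []//|v [Xv /hW [F [e [fF FS e0 hv]]]]].
exists F, e; split=> //; first exact: (subset_trans FS).
by move=> w Xw hw; split=> //; apply: hv => //; exact: XE.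
Qed.

Lemma lc_continuous_inclusion X Y : lc_space X -> lc_space Y ->
  pts X `<=` pts Y ->
  (forall p, continuous_seminorm Y p -> continuous_seminorm X p) ->
  continuous_inclusion X Y.
Proof.
move=> lX lY XY h.
have := seminorm_continuous_inclusion lX XY h.
by rewrite -lc_opensE//; case: Y {lY XY h}.
Qed.

Section Inductive.
Context {I : Type} (D : set I) (X : I -> lspace V).
Hypothesis lX : forall i, D i -> lc_space (X i).
Let E := \bigcup_(i in D) pts (X i).
Hypothesis lE : linear_subspace E.

Let S p := seminorm_on E p /\ forall i, D i -> continuous_seminorm (X i) p.

(** Each admissible locally convex topology is generated by seminorms in [S], hence is coarser than
    the topology of [S]; the latter is itself admissible, so it is one of the generators and the
    supremum is attained. *)
Lemma inductive_opensE :
  opens (inductive_space D X) = seminorm_topology E S.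
Proof.
have XE i : D i -> pts (X i) `<=` E by move=> Di u Xu; exists i.
apply/seteqP; split.
  apply: smallest_sub; first exact: topology_seminorm.
  move=> U [T [[_ [ST sST ->{T}]] hT TU]]; apply: sub_seminorm_topology TU.
  move=> p STp; split=> [|i Di]; first exact: sST.
  apply: (continuous_inclusion_seminorm (hT _ Di)).
  by apply: seminorm_continuous STp.
move=> U SU; apply: sub_gen_smallest; exists (seminorm_topology E S); split=> //.
  by split=> //; exists S => // p [].
by move=> i Di; apply: seminorm_continuous_inclusion;
  [exact: lX|exact: XE|move=> p [_]; exact].
Qed.

Lemma lc_inductive : lc_space (inductive_space D X).
Proof. by split=> //; exists S; [move=> p []|exact: inductive_opensE]. Qed.

Lemma continuous_seminorm_inductive p :
  continuous_seminorm (inductive_space D X) p <-> S p.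
Proof.
split=> [cp|]; last first.
  by apply: seminorm_continuous => //; [move=> q []|exact: inductive_opensE].
have := inductive_opensE; split=> [|i Di]; first by case: cp.
apply: continuous_inclusion_seminorm cp.
rewrite [inductive_space D X](_ : _ = LSpace E (seminorm_topology E S)).
  apply: seminorm_continuous_inclusion; [exact: lX|by move=> u Xu; exists i|].
  by move=> q [_]; exact.
by rewrite -inductive_opensE.
Qed.

End Inductive.

Lemma projective_opensE {I : Type} (D : set I) (E : I -> set V)
    (S : I -> set (V -> R)) :
  (forall i, D i -> linear_subspace (E i)) ->
  (forall i p, D i -> S i p -> seminorm_on (E i) p) ->
  opens (projective_space D (fun i => LSpace (E i) (seminorm_topology (E i) (S i))))
  = seminorm_topology (\bigcap_(i in D) E i) (\bigcup_(i in D) S i).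
Proof.
move=> lE sS; set F := \bigcap_(i in D) E i.
have lF : linear_subspace F.
  split=> [i Di|k u v Fu Fv i Di]; first exact: (lE i Di).1.
  by apply: (lE i Di).2; [exact: Fu|exact: Fv].
apply/seteqP; split.
  apply: smallest_sub; first exact: topology_seminorm.
  move=> _ [i [W [Di [WE hW] ->]]]; split=> [u []//|u [Fu /hW]].
  move=> [G [e [fG GS e0 h]]]; exists G, e; split=> //.
    by move=> q /GS Sq; exists i.
  by move=> v Fv hv; split=> //; apply: h => //; exact: Fv.
have sF p : (\bigcup_(i in D) S i) p -> seminorm_on F p.
  move=> [i Di Sp]; apply: sub_seminorm_on (sS i p Di Sp).
  by move=> u; exact.
rewrite /projective_space/=; move=> U SU T [tT gT]; apply: seminorm_topology_min SU => //.
move=> p u e [i Di Sp] Fu e0; apply: gT.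
exists i, (seminorm_ball (E i) p u e); split=> //=.
  apply: seminorm_ball_open => //; [exact: lE|exact: (sS i)|exact: Fu].
rewrite /seminorm_ball setIA; congr (_ `&` _); apply/seteqP; split=> [v Fv|v []//].
by split=> //; exact: Fv.
Qed.

Lemma frechet_lc X : frechet X -> lc_space X.
Proof.
move=> [lX [p [sp _ oX _]]]; split=> //; exists (range p) => //.
by move=> _ [k _ <-]; exact: sp.
Qed.

Definition complete_seminorm E p : Prop :=
  forall u : nat -> V, (forall n, E (u n)) ->
    (forall e : R, 0 < e -> exists N : nat, forall m n : nat,
       (N <= m)%N -> (N <= n)%N -> p (u m - u n) < e) ->
    exists2 l, E l & forall e : R, 0 < e -> exists N : nat, forall n,
      (N <= n)%N -> p (u n - l) < e.

Lemma cvg0P (x : nat -> R) : (forall n, 0 <= x n) ->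
  (x n @[n --> \oo] --> (0 : R)) <->
  (forall e, 0 < e -> exists N : nat, forall n, (N <= n)%N -> x n < e).
Proof.
move=> x0; split.
  move=> /cvgrPdist_lt h e e0; have [N _ hN] := h e e0.
  by exists N => n /hN; rewrite sub0r normrN ger0_norm.
move=> h; apply/cvgrPdist_lt => e /h [N hN]; exists N => // n /= /hN.
by rewrite sub0r normrN ger0_norm.
Qed.

(** A sequence that is Cauchy for every [p k] has a limit in each [E k]; the norms decrease along
    the inclusions and are definite, so these limits are one vector, which therefore lies in the
    intersection. *)
Lemma frechet_bigcap (E : nat -> set V) (p : nat -> V -> R) :
  (forall k, linear_subspace (E k)) ->
  (forall k, seminorm_on (E k) (p k)) ->
  (forall k u, E k u -> p k u = 0 -> u = 0) ->
  (forall k, complete_seminorm (E k) (p k)) ->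
  (forall k, E k.+1 `<=` E k) ->
  (forall k u, E k.+1 u -> p k u <= p k.+1 u) ->
  frechet (LSpace (\bigcap_k E k) (seminorm_topology (\bigcap_k E k) (range p))).
Proof.
move=> lE sp p0 cp dE dp; split=> /=.
  split=> [k _|a u v Eu Ev k _]; first exact: (lE k).1.
  by apply: (lE k).2; [exact: Eu|exact: Ev].
exists p; split=> //=.
- by move=> k; apply: sub_seminorm_on (sp k) => u; exact.
- by move=> u Eu h; apply: (p0 0%N); [exact: Eu|exact: h].
move=> u Eu cu.
have /choice[l hl] k : exists l, E k l /\ forall e : R, 0 < e ->
    exists N : nat, forall n, (N <= n)%N -> p k (u n - l) < e.
  have [n|l El hl] := cp k u _ (cu k); first exact: Eu.
  by exists l.
have ul k n : E k (u n - l k).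
  by apply: linear_subspaceB => //; [exact: Eu|exact: (hl k).1].
(* Both limits are limits for [p k], since [p k] is at most [p k.+1] on [E k.+1], and [p k]
   separates points. *)
have lS k : l k.+1 = l k.
  apply/eqP; rewrite -subr_eq0; apply/eqP.
  have El := dE _ _ (hl k.+1).1.
  have Eb : E k (l k.+1 - l k) by apply: linear_subspaceB => //; exact: (hl k).1.
  apply: (p0 k) => //; apply/eqP; rewrite eq_le (_ : 0 <= _) ?andbT; last first.
    by have [h _ _] := sp k; exact: h.
  apply/ler_addgt0Pr => e e0; rewrite add0r; have e2 : 0 < e / 2 by lra.
  have [N hN] := (hl k).2 _ e2; have [N' hN'] := (hl k.+1).2 _ e2.
  pose n := maxn N N'.
  have := hN n (leq_maxl _ _); have := hN' n (leq_maxr _ _).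
  have := dp k _ (ul k.+1 n).
  have Eun : E k (u n) by exact: Eu.
  rewrite (seminormBC (lE k) (sp k) Eun El).
  have := seminorm_triangle (lE k) (sp k) El Eun (hl k).1; lra.
have l0 k : l k = l 0%N by elim: k => // k IH; rewrite lS.
exists (l 0%N).
  by move=> k _; rewrite -(l0 k); exact: (hl k).1.
move=> k; rewrite -(l0 k); apply/cvg0P; last exact: (hl k).2.
by move=> n; have [h _ _] := sp k; apply: h.
Qed.

End SeminormedSpaces.

(** * Products of two locally convex spaces *)

Section Products.
Context {R : realType} {V W : lmodType R[i]}.
Implicit Types (X : lspace V) (Y : lspace W).

Lemma linear_subspace_prod (E : set V) (F : set W) :
  linear_subspace E -> linear_subspace F -> linear_subspace (E `*` F).
Proof.
move=> [E0 EP] [F0 FP]; split=> // k u v [/= Eu Fu] [Ev Fv].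
by split; [exact: EP|exact: FP].
Qed.

Lemma seminorm_fst (E : set V) (F : set W) (p : V -> R) :
  seminorm_on E p -> seminorm_on (E `*` F) (p \o fst).
Proof.
by move=> [p0 pZ pD]; split=> [u []/p0|k u []|u v [Eu _] [Ev _]] // *;
  [exact: pZ|exact: pD].
Qed.

Lemma seminorm_snd (E : set V) (F : set W) (q : W -> R) :
  seminorm_on F q -> seminorm_on (E `*` F) (q \o snd).
Proof.
by move=> [p0 pZ pD]; split=> [u [_ /p0]|k u [_ Fu]|u v [_ Eu] [_ Ev]] // *;
  [exact: pZ|exact: pD].
Qed.

Lemma prod_opensE X Y (S : set (V -> R)) (S' : set (W -> R)) :
  linear_subspace (pts X) -> linear_subspace (pts Y) ->
  (forall p, S p -> seminorm_on (pts X) p) ->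
  (forall p, S' p -> seminorm_on (pts Y) p) ->
  opens X = seminorm_topology (pts X) S ->
  opens Y = seminorm_topology (pts Y) S' ->
  opens (prod_space X Y) = seminorm_topology (pts X `*` pts Y)
    ([set p \o fst | p in S] `|` [set q \o snd | q in S']).
Proof.
move=> lX lY sS sS' oX oY; rewrite /prod_space/=; apply/seteqP; split.
  apply: smallest_sub; first exact: topology_seminorm.
  move=> _ [A [B [+ + ->]]]; rewrite oX oY => -[AE hA] [BF hB].
  split=> [[u v] [/= /AE ? /BF]//|[u v] [/= /hA + /hB]].
  move=> [F [e [fF FS e0 h]]] [F' [e' [fF' FS' e0' h']]].
  exists ([set p \o fst | p in F] `|` [set q \o snd | q in F']), (Num.min e e').
  split=> //.
  - by rewrite finite_setU; split; exact: finite_image.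
  - move=> _ [[p Fp <-]|[q Fq <-]]; first by left; exists p => //; exact: FS.
    by right; exists q => //; exact: FS'.
  - by rewrite lt_min e0.
  - move=> [a b] [/= Ea Fb] hv; split=> /=.
      apply: h => // p Fp; suff: (p \o fst) ((a, b) - (u, v)) < Num.min e e'.
        by rewrite lt_min => /andP[].
      by apply: hv; left; exists p.
    apply: h' => // p Fp; suff: (p \o snd) ((a, b) - (u, v)) < Num.min e e'.
      by rewrite lt_min => /andP[].
    by apply: hv; right; exists p.
move=> U SU T [tT gT]; apply: seminorm_topology_min SU => //.
- exact: linear_subspace_prod.
- move=> _ [[p /sS ? <-]|[p /sS' ? <-]]; first exact: seminorm_fst.
  exact: seminorm_snd.
- have tX : opens X (pts X) by rewrite oX; have [] := topology_seminorm (pts X) S.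
  have tY : opens Y (pts Y) by rewrite oY; have [] := topology_seminorm (pts Y) S'.
  move=> _ [u v] e [[p Sp <-]|[q Sq <-]] [/= Eu Fv] e0; apply: gT.
    exists (seminorm_ball (pts X) p u e), (pts Y); split=> //.
      by rewrite oX; apply: seminorm_ball_open => //; exact: sS.
    by apply/seteqP; split=> -[a b] /= => [[[]]|[[]]].
  exists (pts X), (seminorm_ball (pts Y) q v e); split=> //.
    by rewrite oY; apply: seminorm_ball_open => //; exact: sS'.
  by apply/seteqP; split=> -[a b] /= => [[[]]|[? []]].
Qed.

Lemma lc_prod X Y : lc_space X -> lc_space Y -> lc_space (prod_space X Y).
Proof.
move=> [lX [S sS oX]] [lY [S' sS' oY]]; split.
  exact: linear_subspace_prod.
exists ([set p \o fst | p in S] `|` [set q \o snd | q in S']).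
  by move=> _ [[p /sS ? <-]|[p /sS' ? <-]]; [exact: seminorm_fst|exact: seminorm_snd].
exact: prod_opensE.
Qed.

Lemma continuous_seminorm_prod X Y (p : V * W -> R) :
  lc_space X -> lc_space Y ->
  continuous_seminorm (prod_space X Y) p <->
  [/\ seminorm_on (pts X `*` pts Y) p,
      continuous_seminorm X (fun u => p (u, 0)) &
      continuous_seminorm Y (fun v => p (0, v))].
Proof.
move=> cX cY; have [lX _] := cX; have [lY _] := cY.
pose S := continuous_seminorm X; pose S' := continuous_seminorm Y.
have sS p' : S p' -> seminorm_on (pts X) p' by case.
have sS' p' : S' p' -> seminorm_on (pts Y) p' by case.
have oX : opens X = seminorm_topology (pts X) S by exact: lc_opensE.
have oY : opens Y = seminorm_topology (pts Y) S' by exact: lc_opensE.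
have oXY := prod_opensE lX lY sS sS' oX oY.
have lXY := linear_subspace_prod lX lY.
have sXY q : ([set p \o fst | p in S] `|` [set q \o snd | q in S']) q ->
    seminorm_on (pts X `*` pts Y) q.
  by move=> [[? /sS ? <-]|[? /sS' ? <-]]; [exact: seminorm_fst|exact: seminorm_snd].
rewrite (continuous_seminormE (X := prod_space X Y) _ lXY sXY oXY).
split=> [[sp hp]|[sp [sp1 hp1] [sp2 hp2]]].
  have [p0 pZ pD] := sp.
  have pairZl k (u : V) : (k *: u, 0) = k *: (u, 0) :> V * W.
    by congr pair; rewrite /= scaler0.
  have pairZr k (u : W) : (0, k *: u) = k *: (0, u) :> V * W.
    by congr pair; rewrite /= scaler0.
  have pairDl (u v : V) : (u + v, 0) = (u, 0) + (v, 0) :> V * W.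
    by congr pair; rewrite /= addr0.
  have pairDr (u v : W) : (0, u + v) = (0, u) + (0, v) :> V * W.
    by congr pair; rewrite /= addr0.
  have X0 := lX.1; have Y0 := lY.1.
  split=> //.
    apply/(continuous_seminormE _ lX sS oX); split.
      split=> [u Xu|k u Xu|u v Xu Xv]; first exact: p0.
        by rewrite pairZl pZ.
      by rewrite pairDl; exact: pD.
    move=> e /hp [F [d [fF FS d0 h]]].
    (* Members of [F] of the form [q \o snd] vanish at (u, 0), so only those factoring through [fst]
       constrain [u]. *)
    exists [set q | S q /\ F (q \o fst)], d; split=> //; last first.
    - move=> u Xu hu; apply: h => // q Fq.
      have [[p' Sp' qE]|[p' /sS' Sp' <-]] := FS _ Fq.
        by rewrite -qE /=; apply: hu; rewrite /= qE.
      by rewrite /= (seminorm0 lY).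
    - by move=> q [].
    apply: (@sub_finite_set _ _ ((fun q (u : V) => q (u, 0 : W)) @` F)).
      by move=> q [Sq Fq]; exists (q \o fst).
    exact: finite_image.
  apply/(continuous_seminormE _ lY sS' oY); split.
    split=> [u Xu|k u Xu|u v Xu Xv]; first exact: p0.
      by rewrite pairZr pZ.
    by rewrite pairDr; exact: pD.
  move=> e /hp [F [d [fF FS d0 h]]].
  exists [set q | S' q /\ F (q \o snd)], d; split=> //; last first.
  - move=> u Xu hu; apply: h => // q Fq.
    have [[p' /sS Sp' <-]|[p' Sp' qE]] := FS _ Fq; last first.
      by rewrite -qE /=; apply: hu; rewrite /= qE.
    by rewrite /= (seminorm0 lX).
  - by move=> q [].
  apply: (@sub_finite_set _ _ ((fun q (u : W) => q (0 : V, u)) @` F)).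
    by move=> q [Sq Fq]; exists (q \o snd).
  exact: finite_image.
split=> // e e0; have [p0 pZ pD] := sp.
(* From p (u, v) <= p (u, 0) + p (0, v), with e / 2 for each summand. *)
exists [set (fun u => p (u, 0)) \o fst; (fun v => p (0, v)) \o snd], (e / 2).
split=> //.
- move=> _ [->|->]; first by left; exists (fun u => p (u, 0)).
  by right; exists (fun u => p (0, u)).
- by rewrite divr_gt0.
move=> [u v] [/= Xu Yv] h.
have := h _ (or_introl erefl); have := h _ (or_intror erefl) => /= h2 h1.
have -> : (u, v) = (u, 0) + (0, v) by congr pair; rewrite /= ?addr0 ?add0r.
have := pD (u, 0) (0, v) (conj Xu lY.1) (conj lX.1 Yv); lra.
Qed.

Lemma frechet_prod X Y : frechet X -> frechet Y -> frechet (prod_space X Y).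
Proof.
move=> [lX [p [sp p0 oX cX]]] [lY [q [sq q0 oY cY]]]; split.
  exact: linear_subspace_prod.
(* The two sequences of seminorms are interleaved, so that each index tests a single factor. *)
pose r (n : nat) := if odd n then q n./2 \o snd else p n./2 \o fst.
have rp k : r k.*2 = p k \o fst by rewrite /r odd_double doubleK.
have rq k : r k.*2.+1 = q k \o snd by rewrite /r /= odd_double /= uphalf_double.
exists r; split.
- by move=> k; rewrite /r; case: ifP => _; [exact: seminorm_snd|exact: seminorm_fst].
- move=> [u v] [/= Xu Yv] h; congr pair.
    by apply: p0 => // k; have := h k.*2; rewrite rp.
  by apply: q0 => // k; have := h k.*2.+1; rewrite rq.
- rewrite (@prod_opensE _ _ (range p) (range q))//.
  + congr seminorm_topology; apply/seteqP; split.
      move=> _ [[_ [k _ <-] <-]|[_ [k _ <-] <-]]; first by exists k.*2; rewrite ?rp.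
      by exists k.*2.+1; rewrite ?rq.
    move=> _ [k _ <-]; rewrite /r; case: ifP => _.
      by right; exists (q k./2) => //; exists k./2.
    by left; exists (p k./2) => //; exists k./2.
  + by move=> _ [k _ <-].
  + by move=> _ [k _ <-].
move=> u uXY cu.
have [n|k e /(cu k.*2)|l Xl hl] := cX (fst \o u).
- by have [] := uXY n.
- by rewrite rp.
have [n|k e /(cu k.*2.+1)|l' Yl hl'] := cY (snd \o u).
- by have [] := uXY n.
- by rewrite rq.
exists (l, l') => // k; rewrite /r; case: ifP => _; [exact: hl'|exact: hl].
Qed.

End Products.

(** * Images under conjugate-linear injections *)

Section ConjugateImage.
Context {R : realType} {V W : lmodType R[i]} (j : V -> W) (g : W -> V).
Hypothesis jP : forall k u v, j (k *: u + v) = Num.conj k *: j u + j v.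
Hypothesis gj : cancel j g.
Implicit Types X : lspace V.

Let jD u v : j (u + v) = j u + j v.
Proof. by rewrite -[u in LHS]scale1r jP rmorph1 scale1r. Qed.

Let j0 : j 0 = 0.
Proof. by apply: (addrI (j 0)); rewrite -jD !addr0. Qed.

Let jZ k u : j (k *: u) = Num.conj k *: j u.
Proof. by rewrite -[k *: u]addr0 jP j0 addr0. Qed.

Let jZ' k u : k *: j u = j (Num.conj k *: u).
Proof. by rewrite jZ conjCK. Qed.

Lemma linear_subspace_image (E : set V) :
  linear_subspace E -> linear_subspace (j @` E).
Proof.
move=> [E0 EP]; split; first by exists 0.
move=> k _ _ [u Eu <-] [v Ev <-]; exists (Num.conj k *: u + v); first exact: EP.
by rewrite jP conjCK.
Qed.

Lemma seminorm_image (E : set V) (p : V -> R) :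
  seminorm_on E p -> seminorm_on (j @` E) (p \o g).
Proof.
move=> [p0 pZ pD]; split=> [_ [u Eu <-]|k _ [u Eu <-]|_ _ [u Eu <-] [v Ev <-]] /=.
- by rewrite gj; exact: p0.
- by rewrite jZ' !gj pZ// norm_conjC.
- by rewrite -jD !gj; exact: pD.
Qed.

Lemma seminorm_preimage (E : set V) (p : W -> R) :
  seminorm_on (j @` E) p -> seminorm_on E (p \o j).
Proof.
move=> [p0 pZ pD]; split=> [u Eu|k u Eu|u v Eu Ev] /=.
- by apply: p0; exists u.
- by rewrite jZ pZ ?norm_conjC//; exists u.
- by rewrite jD; apply: pD; [exists u|exists v].
Qed.

(** Since [g] undoes [j], the seminorm [p \o g] measures a difference of images exactly as [p]
    measures the difference upstairs, and basic neighbourhoods correspond. *)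
Lemma image_opensE X (S : set (V -> R)) :
  opens X = seminorm_topology (pts X) S ->
  opens (image_space j X) =
    seminorm_topology (j @` pts X) [set p \o g | p in S].
Proof.
move=> oX; rewrite /image_space /= oX; apply/seteqP; split.
  move=> _ [U [UE hU] <-]; split; first exact: image_subset.
  move=> _ [u Uu <-]; have [F [e [fF FS e0 h]]] := hU _ Uu.
  exists [set p \o g | p in F], e; split=> //.
  - exact: finite_image.
  - exact: image_subset.
  move=> _ [v Ev <-] hv; exists v => //; apply: h => // p Fp.
  have jB : j (v - u) = j v - j u by rewrite jD -scaleN1r jZ rmorphN1 scaleN1r.
  by have := hv (p \o g); rewrite /= -jB gj; apply; exists p.
move=> U [UE hU]; exists (pts X `&` j @^-1` U).
  split=> [u []//|u [Xu /hU [F [e [fF FS e0 h]]]]].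
  exists [set p | S p /\ F (p \o g)], e; split=> //.
  - apply: (@sub_finite_set _ _ ((fun q => q \o j) @` F)); last exact: finite_image.
    by move=> p [_ Fp]; exists (p \o g) => //; apply/funext => v /=; rewrite gj.
  - by move=> p [].
  move=> v Xv hv; split=> //; apply: h; first by exists v.
  have jB : j (v - u) = j v - j u by rewrite jD -scaleN1r jZ rmorphN1 scaleN1r.
  move=> q Fq; have [p Sp qE] := FS _ Fq; rewrite -qE /= -jB gj.
  by apply: hv; split=> //; rewrite qE.
apply/seteqP; split=> [_ [u [_ Uu] <-]//|w Uw].
by have [u Xu uw] := UE _ Uw; exists u => //; split=> //=; rewrite uw.
Qed.

Lemma lc_image X : lc_space X -> lc_space (image_space j X).
Proof.
move=> [lX [S sS oX]]; split; first exact: linear_subspace_image.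
exists [set p \o g | p in S]; last exact: image_opensE.
by move=> _ [p /sS Sp <-]; exact: seminorm_image.
Qed.

Lemma continuous_seminorm_image X (p : W -> R) :
  continuous_seminorm (image_space j X) p <->
  seminorm_on (j @` pts X) p /\ continuous_seminorm X (p \o j).
Proof.
have jK : injective j by exact: can_inj gj.
have ball e : j @` (pts X `&` [set v | (p \o j) v < e]) =
    j @` pts X `&` [set w | p w < e].
  apply/seteqP; split=> [_ [u [Xu /= h] <-]|_ [[u Xu <-] h]].
    by split=> //; exists u.
  by exists u.
split=> [[sp hp]|[sp [_ hp]]].
  split=> //; split=> [|e /hp]; first exact: seminorm_preimage.
  rewrite /= -ball => -[U oU /seteqP[h1 h2]].
  rewrite (_ : _ `&` _ = U)//; apply/seteqP; split=> u hu.
    by have [|v Uv /jK <-] := h2 (j u); first by exists u.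
  by have [|v Uv /jK <-] := h1 (j u); first by exists u.
by split=> // e /hp oU; exists (pts X `&` [set v | (p \o j) v < e]).
Qed.

Lemma frechet_image X : frechet X -> frechet (image_space j X).
Proof.
move=> [lX [p [sp p0 oX cX]]]; split; first exact: linear_subspace_image.
exists (fun k => p k \o g); split.
- by move=> k; exact: seminorm_image.
- by move=> _ [u Xu <-] h; rewrite (p0 u)// => k; have := h k; rewrite /= gj.
- rewrite (image_opensE oX); congr seminorm_topology; apply/seteqP; split.
    by move=> _ [_ [k _ <-] <-]; exists k.
  by move=> _ [k _ <-]; exists (p k) => //; exists k.
move=> u uX cu; have /choice[v hv] n : exists v, pts X v /\ j v = u n.
  by have [v] := uX n; exists v.
have jB a b : j (a - b) = j a - j b by rewrite jD -scaleN1r jZ rmorphN1 scaleN1r.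
have uB m n : g (u m - u n) = v m - v n.
  by have [_ <-] := hv m; have [_ <-] := hv n; rewrite -jB gj.
have [n|k e /(cu k)[N hN]|l Xl hl] := cX v; first by have [] := hv n.
  by exists N => m n /hN /[apply]; rewrite /= uB.
exists (j l); first by exists l.
move=> k; rewrite (_ : (fun n => _) = fun n => p k (v n - l)); first exact: hl.
by apply/funext => n /=; have [_ <-] := hv n; rewrite -jB gj.
Qed.

End ConjugateImage.

(** * Inductive limits of increasing sequences *)

Section InductiveSequences.
Context {R : realType}.

Definition increasing_lc (V : lmodType R[i]) (X : nat -> lspace V) : Prop :=
  (forall n, lc_space (X n)) /\ forall n, continuous_inclusion (X n) (X n.+1).

Lemma increasing_pts (V : lmodType R[i]) (X : nat -> lspace V) m n :
  increasing_lc X -> (m <= n)%N -> pts (X m) `<=` pts (X n).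
Proof.
move=> [_ iX] /subnK <-; elim: (n - m)%N => [//|k IH] u /IH.
exact: (iX (k + m)%N).1.
Qed.

Lemma linear_subspace_bigcup (V : lmodType R[i]) (X : nat -> lspace V) :
  increasing_lc X -> linear_subspace (\bigcup_(n in setT) pts (X n)).
Proof.
move=> iX; split; first by exists 0%N => //; exact: (iX.1 0%N).1.1.
move=> k u v [m _ Xu] [n _ Xv]; exists (maxn m n) => //.
apply: (iX.1 _).1.2; first exact: (increasing_pts iX (leq_maxl m n)).
exact: (increasing_pts iX (leq_maxr m n)).
Qed.

Lemma increasing_prod (V W : lmodType R[i]) (X : nat -> lspace V)
    (Y : nat -> lspace W) : increasing_lc X -> increasing_lc Y ->
  increasing_lc (fun n => prod_space (X n) (Y n)).
Proof.
move=> [lX iX] [lY iY]; have lXY n : lc_space (prod_space (X n) (Y n)) by exact: lc_prod.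
have sXY n : pts (prod_space (X n) (Y n)) `<=` pts (prod_space (X n.+1) (Y n.+1)).
  by move=> [u v] [/= Xu Yv]; split=> /=; [exact: (iX n).1|exact: (iY n).1].
split=> // n; apply: lc_continuous_inclusion => // p.
rewrite !continuous_seminorm_prod// => -[sp cp cp']; split.
- exact: sub_seminorm_on (sXY n) sp.
- exact: continuous_inclusion_seminorm cp.
- exact: continuous_inclusion_seminorm cp'.
Qed.

Lemma increasing_image (V W : lmodType R[i]) (j : V -> W) (g : W -> V)
    (X : nat -> lspace V) :
  (forall k u v, j (k *: u + v) = Num.conj k *: j u + j v) -> cancel j g ->
  increasing_lc X -> increasing_lc (fun n => image_space j (X n)).
Proof.
move=> jP gj [lX iX]; have lj n := lc_image jP gj (lX n).
have sj n : pts (image_space j (X n)) `<=` pts (image_space j (X n.+1)).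
  by apply: image_subset; exact: (iX n).1.
split=> // n; apply: lc_continuous_inclusion => // p.
rewrite !(continuous_seminorm_image jP gj) => -[sp cp]; split.
  exact: sub_seminorm_on (sj n) sp.
exact: continuous_inclusion_seminorm cp.
Qed.

Lemma inductive_prod (V W : lmodType R[i]) (X : nat -> lspace V)
    (Y : nat -> lspace W) : increasing_lc X -> increasing_lc Y ->
  prod_space (inductive_space setT X) (inductive_space setT Y) =
  inductive_space setT (fun n => prod_space (X n) (Y n)).
Proof.
move=> iX iY; have iXY := increasing_prod iX iY.
have lX := linear_subspace_bigcup iX; have lY := linear_subspace_bigcup iY.
have lXY := linear_subspace_bigcup iXY.
have cX : lc_space (inductive_space setT X).
  by apply: lc_inductive => // n _; exact: iX.1.
have cY : lc_space (inductive_space setT Y).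
  by apply: lc_inductive => // n _; exact: iY.1.
have pE : pts (prod_space (inductive_space setT X) (inductive_space setT Y)) =
    pts (inductive_space setT (fun n => prod_space (X n) (Y n))).
  apply/seteqP; split=> -[u v] /=.
    (* The two coordinates come with independent indices; a common one exists because both sequences
       increase. *)
    move=> [[m _ /= Xu] [n _ /= Yv]]; exists (maxn m n) => //; split=> /=.
      exact: (increasing_pts iX (leq_maxl m n)).
    exact: (increasing_pts iY (leq_maxr m n)).
  by move=> [n _ [/= Xu Yv]]; split; exists n.
apply: lc_space_ext => //.
- exact: lc_prod.
- by apply: lc_inductive => // n _; exact: iXY.1.
move=> p; rewrite continuous_seminorm_prod//.
have iXE q := propext (@continuous_seminorm_inductive _ _ _ setT X
  (fun n _ => iX.1 n) lX q).
have iYE q := propext (@continuous_seminorm_inductive _ _ _ setT Y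
  (fun n _ => iY.1 n) lY q).
rewrite iXE iYE (continuous_seminorm_inductive (X := fun n => prod_space (X n) (Y n)))//.
- split=> [[sp [s1 c1] [s2 c2]]|[sp cp]].
    split; first by rewrite -[X in seminorm_on X]pE.
    move=> n _; rewrite continuous_seminorm_prod; [|exact: iX.1|exact: iY.1].
    split; [|exact: c1|exact: c2]; apply: sub_seminorm_on sp.
    by move=> [u v] [/= ? ?]; split; exists n.
  have := sp; rewrite -[X in seminorm_on X]pE => sp'.
  have c n : continuous_seminorm (X n) (fun u => p (u, 0)) /\
      continuous_seminorm (Y n) (fun u => p (0, u)).
    have := cp n I; rewrite continuous_seminorm_prod; last 2 first.
      exact: iX.1.
      exact: iY.1.
    by case.
  have [p0 pZ pD] := sp'.
  have X0 := lX.1; have Y0 := lY.1.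
  split=> //.
    split=> [|n _]; last exact: (c n).1.
    split=> [u Xu|k u Xu|u v Xu Xv]; first exact: p0.
      by rewrite -pZ//; congr p; congr pair; rewrite /= scaler0.
    have := pD (u, 0) (v, 0) (conj Xu Y0) (conj Xv Y0).
    by congr (p _ <= _); congr pair; rewrite /= addr0.
  split=> [|n _]; last exact: (c n).2.
  split=> [u Xu|k u Xu|u v Xu Xv]; first exact: p0.
    by rewrite -pZ//; congr p; congr pair; rewrite /= scaler0.
  have := pD (0, u) (0, v) (conj X0 Xu) (conj X0 Xv).
  by congr (p _ <= _); congr pair; rewrite /= addr0.
- by move=> n _; exact: iXY.1.
Qed.

Lemma inductive_image (V W : lmodType R[i]) (j : V -> W) (g : W -> V)
    (X : nat -> lspace V) :
  (forall k u v, j (k *: u + v) = Num.conj k *: j u + j v) -> cancel j g ->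
  increasing_lc X ->
  image_space j (inductive_space setT X) =
  inductive_space setT (fun n => image_space j (X n)).
Proof.
move=> jP gj iX; have iJ := increasing_image jP gj iX.
have lX := linear_subspace_bigcup iX; have lJ := linear_subspace_bigcup iJ.
have cX : lc_space (inductive_space setT X).
  by apply: lc_inductive => // n _; exact: iX.1.
have pE : j @` (\bigcup_(n in setT) pts (X n)) =
    \bigcup_(n in setT) (j @` pts (X n)) by rewrite image_bigcup.
apply: lc_space_ext.
- by apply: (lc_image jP gj cX).
- by apply: lc_inductive => // n _; exact: iJ.1.
- exact: pE.
move=> p; rewrite (continuous_seminorm_image jP gj).
rewrite !continuous_seminorm_inductive => //; last 2 first.
- by move=> n _; exact: iJ.1.
- by move=> n _; exact: iX.1.
rewrite /= pE; split=> [[sp [_ cp]]|[sp cp]]; split=> //.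
  move=> n _; rewrite (continuous_seminorm_image jP gj); split; last exact: cp.
  by apply: sub_seminorm_on sp => w jw; exists n.
split=> [|n _]; first by apply: (seminorm_preimage jP); rewrite pE.
by have := cp n I; rewrite (continuous_seminorm_image jP gj) => -[].
Qed.

Lemma inductive_cst (V : lmodType R[i]) (X : lspace V) : lc_space X ->
  inductive_space setT (fun _ : nat => X) = X.
Proof.
move=> lX; have bX : \bigcup_(n in @setT nat) pts X = pts X.
  by apply/seteqP; split=> [u []|u Xu] //; exists 0%N.
have l : linear_subspace (\bigcup_(n in @setT nat) pts X).
  by rewrite bX; exact: lX.1.
apply: lc_space_ext => //; first exact: lc_inductive.
move=> p; rewrite continuous_seminorm_inductive//; rewrite bX.
by split=> [[_ /(_ 0%N I)]//|cp]; split=> //; case: cp.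
Qed.

(** Cofinality makes the unions equal, and a seminorm continuous on the cofinal steps restricts to a
    continuous one on every step, so both limits have the same continuous seminorms. *)
Lemma inductive_reindex (V : lmodType R[i]) (I : Type) (D : set I)
    (X : I -> lspace V) (r : nat -> I) :
  (forall i, D i -> lc_space (X i)) -> (forall n, D (r n)) ->
  (forall n, continuous_inclusion (X (r n)) (X (r n.+1))) ->
  (forall i, D i -> exists n, continuous_inclusion (X i) (X (r n))) ->
  inductive_space D X = inductive_space setT (X \o r).
Proof.
move=> lX Dr iX cof.
have iXr : increasing_lc (X \o r) by split=> // n; exact: lX.
have l := linear_subspace_bigcup iXr.
have bX : \bigcup_(i in D) pts (X i) = \bigcup_(n in setT) pts ((X \o r) n).
  apply/seteqP; split=> [u [i /cof [n [h _]] /h Xu]|u [n _ Xu]].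
    by exists n.
  by exists (r n).
have l' : linear_subspace (\bigcup_(i in D) pts (X i)) by rewrite bX.
apply: lc_space_ext => //.
- exact: lc_inductive.
- by apply: lc_inductive => // n _; exact: lX.
move=> p; rewrite !continuous_seminorm_inductive => //; last first.
  by move=> n _; exact: lX.
rewrite bX; split=> -[sp cp]; split=> //; first by move=> n _; exact: cp.
move=> i /[dup] Di /cof [n h].
exact: continuous_inclusion_seminorm h (cp n _).
Qed.

End InductiveSequences.

(** * Quotient norms *)

Section QuotientNorm.
Context {R : realType} {X V : lmodType R[i]}.
Variables (N : set X) (q : X -> R) (F : X -> V).
Hypothesis lN : linear_subspace N.
Hypothesis sq : seminorm_on N q.
Hypothesis FP : forall (k : R[i]) x y, F (k *: x + y) = k *: F x + F y.

(** Both [Linf_norm] and [off_norm] unfold to this, with [F] sending x to its form and [q] equal to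
    [opnorm], respectively to the norm of the corner of x. *)
Definition quotient_norm (u : V) : R := inf [set q x | x in [set x | N x /\ F x = u]].

Let E := F @` N.

Let F0 : F 0 = 0.
Proof. by have := FP 1 0 0; rewrite !scale1r addr0 -{1}[F 0]addr0 => /addrI. Qed.
Let FZ k x : F (k *: x) = k *: F x.
Proof. by rewrite -[k *: x]addr0 FP F0 addr0. Qed.
Let FD x y : F (x + y) = F x + F y.
Proof. by rewrite -[x in LHS]scale1r FP scale1r. Qed.
Let FB x y : F (x - y) = F x - F y.
Proof. by rewrite FD -scaleN1r FZ scaleN1r. Qed.

Lemma quotient_norm_ge0 u : 0 <= quotient_norm u.
Proof.
rewrite /quotient_norm; set A := (X in inf X).
have [A0|/set0P/negP/negPn/eqP ->] := pselect (A !=set0); last by rewrite inf0.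
by apply: lb_le_inf => // _ [x [Nx _] <-]; have [h _ _] := sq; exact: h.
Qed.

Lemma quotient_norm_le x : N x -> quotient_norm (F x) <= q x.
Proof.
move=> Nx; apply: ge_inf; last by exists x.
by exists 0 => _ [y [Ny _] <-]; have [h _ _] := sq; exact: h.
Qed.

Lemma quotient_norm_lt u (e : R) : E u -> quotient_norm u < e ->
  exists x, [/\ N x, F x = u & q x < e].
Proof.
move=> [x Nx xu] /inf_lt; case; first by exists (q x), x.
by move=> _ [y [Ny yu] <-] ye; exists y.
Qed.

Lemma linear_subspace_quotient : linear_subspace E.
Proof.
split; first by exists 0 => //; exact: lN.1.
move=> k _ _ [x Nx <-] [y Ny <-]; exists (k *: x + y) => //; exact: lN.2.
Qed.

Lemma seminorm_quotient : seminorm_on E quotient_norm.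
Proof.
have [q0 qZ qD] := sq.
have qZ_le k u : E u -> quotient_norm (k *: u) <= complex.Re `|k| * quotient_norm u.
  move=> Eu; apply/ler_addgt0Pr => e e0.
  have k0 : 0 <= complex.Re `|k|.
    by rewrite -ler0c RRe_real ?normr_real//; exact: normr_ge0.
  have k1 : 0 < complex.Re `|k| + 1 by lra.
  (* With |k| + 1 in the denominator the error |k| e / (|k| + 1) stays below e, also for k = 0. *)
  have [|x [Nx <- xe]] := @quotient_norm_lt u
    (quotient_norm u + e / (complex.Re `|k| + 1)) Eu.
    by rewrite ltrDl divr_gt0.
  have := quotient_norm_le (linear_subspaceZ k lN Nx); rewrite FZ qZ//.
  move=> /le_trans; apply.
  have : complex.Re `|k| * q x <=
      complex.Re `|k| * (quotient_norm (F x) + e / (complex.Re `|k| + 1)).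
    by apply: ler_wpM2l => //; rewrite ltW// {2}xe.
  move=> /le_trans; apply; rewrite mulrDr lerD2l mulrCA ger_pMr//.
  by rewrite ler_pdivrMr//; lra.
split=> [u Eu|k u Eu|u v Eu Ev]; first exact: quotient_norm_ge0.
- apply/eqP; rewrite eq_le qZ_le// andTb.
  have [->|k0] := eqVneq k 0.
    by rewrite normr0 mul0r quotient_norm_ge0.
  (* The reverse inequality is the first one for k^-1 and the vector k u. *)
  have := qZ_le k^-1 (k *: u) (linear_subspaceZ _ linear_subspace_quotient Eu).
  rewrite scalerA mulVf// scale1r normfV => h.
  have kE : `|k| = (complex.Re `|k|)%:C%C by rewrite RRe_real ?normr_real.
  have kp : 0 < complex.Re `|k| by rewrite -ltcR -kE normr_gt0.
  have : complex.Re `|k|^-1 = (complex.Re `|k|)^-1.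
    by rewrite {1}kE -fmorphV.
  move=> kV; move: h; rewrite kV => h.
  by rewrite mulrC -ler_pdivlMr// mulrC.
- apply/ler_addgt0Pr => e e0; have e2 : 0 < e / 2 by lra.
  have [|x [Nx <- xe]] := @quotient_norm_lt u (quotient_norm u + e / 2) Eu.
    by rewrite ltrDl.
  have [|y [Ny <- ye]] := @quotient_norm_lt v (quotient_norm v + e / 2) Ev.
    by rewrite ltrDl.
  rewrite -FD; apply: (le_trans (quotient_norm_le (linear_subspaceD lN Nx Ny))).
  apply: (le_trans (qD _ _ Nx Ny)); lra.
Qed.

Hypothesis cN : forall x : nat -> X, (forall n, N (x n)) ->
  (forall n, q (x n.+1 - x n) <= 2 ^- n) ->
  exists2 l, N l & forall e : R, 0 < e -> exists K : nat, forall n,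
    (K <= n)%N -> q (x n - l) < e.

(** Along a rapidly Cauchy subsequence the consecutive differences lift to elements of [N] with [q]
    below 2^-k. Their partial sums fall under [cN], and the image of the limit is a limit of the
    subsequence, hence of the whole Cauchy sequence. *)
Lemma complete_quotient : complete_seminorm E quotient_norm.
Proof.
move=> u Eu cu.
have lE := linear_subspace_quotient; have sE := seminorm_quotient.
have /choice[r hr] k : exists r : nat, forall m n, (r <= m)%N -> (r <= n)%N ->
    quotient_norm (u m - u n) < 2 ^- k.
  by have [|r hr] := cu (2 ^- k); [rewrite invr_gt0 exprn_gt0|exists r].
(* Chosen to dominate k and [r k] and to be nondecreasing, although [r] comes from [choice] without
   any monotonicity. *)
pose s k := (k + \sum_(i < k.+1) r i)%N.
have rs k : (r k <= s k)%N by rewrite /s big_ord_recr /= addnA leq_addl.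
have ss k : (s k <= s k.+1)%N.
  by rewrite /s leq_add// [leqRHS]big_ord_recr /= leq_addr.
have /choice[d hd] k : exists d, [/\ N d, F d = u (s k.+1) - u (s k) & q d < 2 ^- k].
  apply: quotient_norm_lt; first exact: linear_subspaceB.
  by apply: hr; rewrite ?rs// (leq_trans (rs k)).
have [x0 Nx0 Fx0] := Eu (s 0%N).
pose x k := x0 + \sum_(i < k) d i.
have xS k : x k.+1 = x k + d k by rewrite /x big_ord_recr /= addrA.
have Fx k : F (x k) = u (s k).
  elim: k => [|k IH]; first by rewrite /x big_ord0 addr0.
  by rewrite xS FD IH; have [_ -> _] := hd k; rewrite addrC subrK.
have Nx k : N (x k).
  elim: k => [|k IH]; first by rewrite /x big_ord0 addr0.
  by rewrite xS; apply: linear_subspaceD => //; have [] := hd k.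
have [|l Nl hl] := cN Nx.
  by move=> n; rewrite xS addrC addKr; have [_ _ /ltW] := hd n.
have El : E (F l) by exists l.
exists (F l) => // e e0; have e2 : 0 < e / 2 by lra.
have [K hK] := hl _ e2; have [M hM] := cu _ e2.
exists M => n Mn.
pose k := maxn K M.
have Mk : (M <= s k)%N.
  by rewrite /s (leq_trans (leq_maxr K M))// leq_addr.
have := seminorm_triangle lE sE (Eu n) (Eu (s k)) El.
have := hM _ _ Mn Mk; have := hK k (leq_maxl _ _).
have := quotient_norm_le (linear_subspaceB lN (Nx k) Nl).
rewrite FB Fx; lra.
Qed.

End QuotientNorm.

(** * Hilbert spaces and bounded operators *)

Section HilbertBasics.
Context {R : realType} {H : hilbertType R}.
Implicit Types (f g h : H) (k : R[i]).

Definition cabs k : R := complex.Re `|k|.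

Lemma cabsE k : `|k| = (cabs k)%:C%C.
Proof. by rewrite RRe_real ?normr_real. Qed.

Lemma cabs_ge0 k : 0 <= cabs k.
Proof. by rewrite -ler0c -cabsE. Qed.

Lemma cabsM k k' : cabs (k * k') = cabs k * cabs k'.
Proof. by apply: complexI; rewrite -cabsE normrM !cabsE -rmorphM. Qed.

Lemma cabs_real (r : R) : cabs r%:C%C = `|r|.
Proof. by rewrite /cabs normc_def /= expr0n /= addr0 sqrtr_sqr. Qed.

Lemma cabs_conj k : cabs (Num.conj k) = cabs k.
Proof. by rewrite /cabs norm_conjC. Qed.

Lemma cabs_eq0 k : cabs k = 0 -> k = 0.
Proof. by move=> k0; apply/eqP; rewrite -normr_eq0 cabsE k0. Qed.

Lemma cabs1 : cabs 1 = 1. Proof. by rewrite /cabs normr1. Qed.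
Lemma cabs0 : cabs 0 = 0. Proof. by rewrite /cabs normr0. Qed.

Lemma cabs_sqr k : ((cabs k) ^+ 2)%:C%C = k * Num.conj k.
Proof. by rewrite rmorphXn /= -cabsE normCK. Qed.

Lemma Re_le_cabs k : complex.Re k <= cabs k.
Proof. by apply: le_trans (ler_norm _) _; rewrite -lecR -cabsE normc_ge_Re. Qed.

Lemma hnormE f : `|f| = (hnorm f)%:C%C.
Proof. by rewrite RRe_real ?normr_real. Qed.

Lemma hnorm_ge0 f : 0 <= hnorm f.
Proof. by rewrite -ler0c -hnormE. Qed.

Lemma hnorm0 : hnorm (0 : H) = 0.
Proof. by rewrite /hnorm normr0. Qed.

Lemma hnorm_eq0 f : hnorm f = 0 -> f = 0.
Proof. by move=> f0; apply/eqP; rewrite -normr_eq0 hnormE f0. Qed.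

Lemma hnormZ k f : hnorm (k *: f) = cabs k * hnorm f.
Proof. by apply: complexI; rewrite -hnormE normrZ hnormE cabsE -rmorphM. Qed.

Lemma hnorm_leD f g : hnorm (f + g) <= hnorm f + hnorm g.
Proof. by rewrite -lecR rmorphD /= -!hnormE ler_normD. Qed.

Lemma hnorm_opp f : hnorm (- f) = hnorm f.
Proof. by rewrite /hnorm normrN. Qed.

Lemma hnormBC f g : hnorm (f - g) = hnorm (g - f).
Proof. by rewrite -hnorm_opp opprB. Qed.

Lemma hnorm_triangle f g h : hnorm (f - h) <= hnorm (f - g) + hnorm (g - h).
Proof. by apply: le_trans (hnorm_leD _ _); rewrite addrA subrK. Qed.

Lemma dotDl f g h : <|f + g, h|> = <|f, h|> + <|g, h|>.
Proof. exact: linearDl. Qed.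
Lemma dotDr f g h : <|h, f + g|> = <|h, f|> + <|h, g|>.
Proof. exact: linearDr. Qed.
Lemma dotBl f g h : <|f - g, h|> = <|f, h|> - <|g, h|>.
Proof. exact: linearBl. Qed.
Lemma dotBr f g h : <|h, f - g|> = <|h, f|> - <|h, g|>.
Proof. exact: linearBr. Qed.
Lemma dotZl k f h : <|k *: f, h|> = k * <|f, h|>.
Proof. exact: linearZl_LR. Qed.
Lemma dotZr k f h : <|h, k *: f|> = Num.conj k * <|h, f|>.
Proof. exact: linearZr_LR. Qed.
Lemma dot0l h : <|0, h|> = 0.
Proof. exact: linear0l. Qed.
Lemma dot0r h : <|h, 0|> = 0.
Proof. exact: linear0r. Qed.
Lemma dotC f g : <|f, g|> = Num.conj <|g, f|>.
Proof. by rewrite hermC expr0 mul1r. Qed.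

Lemma dotff f : <|f, f|> = (hnorm f ^+ 2)%:C%C.
Proof. by rewrite -hdotE hnormE rmorphXn. Qed.

Lemma hnorm_sqr f : hnorm f ^+ 2 = complex.Re <|f, f|>.
Proof. by rewrite dotff. Qed.

Lemma dotff_eq0 f : <|f, f|> = 0 -> f = 0.
Proof.
rewrite dotff => /complexI/eqP; rewrite sqrf_eq0 => /eqP; exact: hnorm_eq0.
Qed.

Lemma cReD k k' : complex.Re (k + k') = complex.Re k + complex.Re k'.
Proof. by case: k; case: k'. Qed.
Lemma cReN k : complex.Re (- k) = - complex.Re k.
Proof. by case: k. Qed.
Lemma cReC k : complex.Re (Num.conj k) = complex.Re k.
Proof. by case: k. Qed.
Lemma cReM (r : R) k : complex.Re (r%:C%C * k) = r * complex.Re k.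
Proof. by case: k => a b /=; rewrite mul0r subr0. Qed.

Lemma hnorm_sqrD f g : hnorm (f + g) ^+ 2 =
  hnorm f ^+ 2 + hnorm g ^+ 2 + 2 * complex.Re <|f, g|>.
Proof.
rewrite !hnorm_sqr dotDl !dotDr !cReD [<|g, f|>]dotC cReC; ring.
Qed.

Lemma hnorm_sqrB f g : hnorm (f - g) ^+ 2 =
  hnorm f ^+ 2 + hnorm g ^+ 2 - 2 * complex.Re <|f, g|>.
Proof.
rewrite !hnorm_sqr dotBl !dotBr !(cReD, cReN) [<|g, f|>]dotC cReC; ring.
Qed.

(** Expand the square of the norm of |g| f - |f| g and divide by 2 |f| |g|. *)
Lemma Cauchy_Schwarz_Re f g : complex.Re <|f, g|> <= hnorm f * hnorm g.
Proof.
have [->|g0] := eqVneq g 0; first by rewrite dot0r hnorm0 mulr0.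
have gp : 0 < hnorm g.
  rewrite lt_neqAle hnorm_ge0 andbT eq_sym; apply: contra_neq g0; exact: hnorm_eq0.
have := hnorm_sqrB ((hnorm g)%:C%C *: f) ((hnorm f)%:C%C *: g).
rewrite !hnormZ !cabs_real !ger0_norm ?hnorm_ge0// dotZl dotZr.
rewrite [Num.conj _]conjc_real !cReM => h.
have := sqr_ge0 (hnorm ((hnorm g)%:C%C *: f - (hnorm f)%:C%C *: g)); rewrite h.
have [->|f0] := eqVneq f 0; first by rewrite dot0l hnorm0 mul0r.
have fp : 0 < hnorm f.
  rewrite lt_neqAle hnorm_ge0 andbT eq_sym; apply: contra_neq f0; exact: hnorm_eq0.
set x := hnorm f in fp *; set y := hnorm g in gp *; set z := complex.Re _.
move=> {}h; have xy : 0 < 2 * (x * y) by rewrite !mulr_gt0.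
rewrite -subr_ge0 -(pmulr_rge0 _ xy); move: h; congr (0 <= _); ring.
Qed.

Lemma Cauchy_Schwarz f g : cabs <|f, g|> <= hnorm f * hnorm g.
Proof.
have [c0|c0] := eqVneq (cabs <|f, g|>) 0.
  by rewrite c0 mulr_ge0 ?hnorm_ge0.
have cp : 0 < cabs <|f, g|> by rewrite lt_neqAle eq_sym c0 cabs_ge0.
(* This multiple of [f] turns the inner product into the nonnegative real |<f, g>|^2. *)
have := Cauchy_Schwarz_Re (Num.conj <|f, g|> *: f) g.
rewrite dotZl mulrC -cabs_sqr /= hnormZ cabs_conj -mulrA.
by rewrite expr2 ler_pM2l.
Qed.

(** The norm of [H] takes values in [R[i]], and so do the radii of its balls; this version of
    convergence has real radii. *)
Definition hcvg (u : nat -> H) l :=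
  forall e : R, 0 < e -> exists N : nat, forall n, (N <= n)%N -> hnorm (u n - l) < e.

Lemma hcvgP (u : nat -> H) l : (u n @[n --> \oo] --> l) <-> hcvg u l.
Proof.
split.
  move=> /cvgrPdist_lt h e e0.
  have [|N _ hN] := h e%:C%C; first by rewrite ltcR.
  by exists N => n /hN /=; rewrite distrC hnormE ltcR.
move=> h; apply/cvgrPdist_lt => e e0.
have eE : e = (complex.Re e)%:C%C by rewrite RRe_real// ger0_real// ltW.
have [|N hN] := h (complex.Re e); first by move: e0; rewrite {1}eE ltcR.
by exists N => // n /= /hN; rewrite eE distrC hnormE ltcR.
Qed.

Lemma hcvg_unique (u : nat -> H) l l' : hcvg u l -> hcvg u l' -> l = l'.
Proof.
move=> h h'; apply/eqP; rewrite -subr_eq0; apply/eqP/hnorm_eq0/eqP.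
rewrite eq_le hnorm_ge0 andbT; apply/ler_addgt0Pr => e e0; rewrite add0r.
have e2 : 0 < e / 2 by lra.
have [N hN] := h _ e2; have [N' hN'] := h' _ e2.
have := hN _ (leq_maxl N N'); have := hN' _ (leq_maxr N N').
have := hnorm_triangle l (u (maxn N N')) l'; rewrite (hnormBC l (u _)); lra.
Qed.

Lemma hcvg_linear (y : H -> H) (C : R) (u : nat -> H) l : linear y ->
  (forall f, hnorm (y f) <= C * hnorm f) -> hcvg u l -> hcvg (y \o u) (y l).
Proof.
move=> ly yC h e e0; have C1 : 0 < `|C| + 1 by have := normr_ge0 C; lra.
have [N hN] := h (e / (`|C| + 1)) (divr_gt0 e0 C1).
exists N => n /hN; rewrite ltr_pdivlMr// => un.
have -> : (y \o u) n - y l = y (u n - l).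
  by rewrite /= addrC -scaleN1r -ly scaleN1r addrC.
apply: le_lt_trans (yC _) _; apply: le_lt_trans un; rewrite mulrC.
apply: ler_wpM2l; first exact: hnorm_ge0.
by have := ler_norm C; lra.
Qed.

Lemma hcvg_dotl (u : nat -> H) l g (e : R) : hcvg u l -> 0 < e ->
  exists N : nat, forall n, (N <= n)%N -> cabs (<|u n, g|> - <|l, g|>) < e.
Proof.
move=> h e0; have g1 : 0 < hnorm g + 1 by have := hnorm_ge0 g; lra.
have [N hN] := h (e / (hnorm g + 1)) (divr_gt0 e0 g1).
exists N => n /hN; rewrite ltr_pdivlMr// -dotBl => un.
apply: le_lt_trans (Cauchy_Schwarz _ _) _; apply: le_lt_trans un.
by apply: ler_wpM2l; [exact: hnorm_ge0|lra].
Qed.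

Lemma hcomplete (u : nat -> H) :
  (forall e : R, 0 < e -> exists N : nat, forall m n, (N <= m)%N -> (N <= n)%N ->
     hnorm (u m - u n) < e) -> exists l, hcvg u l.
Proof.
move=> h; suff: cvgn u by move=> /hcvgP ?; exists (limn u).
apply: cauchy_cvg; apply/cauchy_ballP => e e0.
have eE : e = (complex.Re e)%:C%C by rewrite RRe_real// ger0_real// ltW.
have [|N hN] := h (complex.Re e); first by move: e0; rewrite {1}eE ltcR.
exists (u @` [set n | (N <= n)%N], u @` [set n | (N <= n)%N]) => /=.
  by split; exists N => // n /= Nn; exists n.
move=> [_ _] [/= [m Nm <-] [n Nn <-]]; rewrite -ball_normE /= eE hnormE ltcR.
exact: hN.
Qed.

Lemma geometric_small (C e : R) : 0 < e ->
  exists N : nat, forall n, (N <= n)%N -> C * 2 ^- n < e.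
Proof.
move=> e0; have : C * 2 ^- n @[n --> \oo] --> (0 : R).
  rewrite -[X in _ --> X](mulr0 C); apply: cvgMr.
  under eq_fun do rewrite -exprVn.
  by apply: cvg_expr; rewrite ger0_norm//; lra.
move=> /cvgrPdist_lt /(_ _ e0) [N _ hN]; exists N => n /hN.
by rewrite sub0r normrN; apply: le_lt_trans; exact: ler_norm.
Qed.

(** Geometric series: the explicit tail bound 2 C 2^-n is what later gives operator limits uniformly
    on bounded sets. *)
Lemma hcomplete_fast (u : nat -> H) (C : R) :
  (forall n, hnorm (u n.+1 - u n) <= C * 2 ^- n) ->
  exists2 l, hcvg u l & forall n, hnorm (u n - l) <= 2 * C * 2 ^- n.
Proof.
move=> h.
have C0 : 0 <= C by have := h 0%N; rewrite expr0 invr1 mulr1; apply: le_trans; exact: hnorm_ge0.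
have step n (k : nat) : hnorm (u (n + k)%N - u n) <= 2 * C * (2 ^- n - 2 ^- (n + k)).
  elim: k => [|k IH]; first by rewrite addn0 !subrr hnorm0 mulr0.
  rewrite addnS; apply: le_trans (hnorm_triangle _ (u (n + k)%N) _) _.
  have := h (n + k)%N; have -> : 2 ^- (n + k).+1 = 2 ^- (n + k) / 2 :> R.
    by rewrite exprS invfM mulrC.
  by move: IH; set x := 2 ^- (n + k); set y := 2 ^- n; lra.
have half n m : (n <= m)%N -> hnorm (u m - u n) <= 2 * C * 2 ^- n.
  move=> /subnKC <-; apply: le_trans (step _ _) _.
  apply: ler_wpM2l; first lra.
  by have : 0 <= 2 ^- (n + (m - n)) :> R by []; lra.
have [e e0|l hl] := hcomplete (u := u).
  have [|N /(_ N (leqnn N)) hN] := @geometric_small (2 * C) (e / 2); first lra.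
  exists N => m n Nm Nn; apply: le_lt_trans (hnorm_triangle _ (u N) _) _.
  rewrite (hnormBC (u N)); have := half _ _ Nm; have := half _ _ Nn; lra.
exists l => // n; apply/ler_addgt0Pr => e e0.
have [N hN] := hl _ e0.
have := hN _ (leq_maxr n N); have := half _ _ (leq_maxl n N).
have := hnorm_triangle (u n) (u (maxn n N)) l.
by rewrite (hnormBC (u n) (u (maxn n N))); lra.
Qed.

End HilbertBasics.

(** * Bounded operators, Riesz representation and adjoints *)

Section BoundedOperators.
Context {R : realType} {H : hilbertType R}.
Implicit Types (f g h : H) (x y : H -> H) (k : R[i]) (C : R).

Lemma linD x f g : linear x -> x (f + g) = x f + x g.
Proof. by move=> lx; rewrite -[f in LHS]scale1r lx scale1r. Qed.

Lemma lin0 x : linear x -> x 0 = 0.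
Proof. by move=> lx; apply: (addrI (x 0)); rewrite -linD// !addr0. Qed.

Lemma linZ x k f : linear x -> x (k *: f) = k *: x f.
Proof. by move=> lx; rewrite -[k *: f]addr0 lx lin0// addr0. Qed.

Lemma linN x f : linear x -> x (- f) = - x f.
Proof. by move=> lx; rewrite -scaleN1r linZ// scaleN1r. Qed.

Lemma linB x f g : linear x -> x (f - g) = x f - x g.
Proof. by move=> lx; rewrite linD// linN. Qed.

Lemma bounded_opP x : bounded_op x <->
  linear x /\ exists2 C, 0 <= C & forall f, hnorm (x f) <= C * hnorm f.
Proof.
split=> [[lx cx]|[lx [C C0 xC]]]; split=> //.
  have /cvgrPdist_lt /(_ 1 ltr01) := cx 0.
  rewrite near_simpl => /nbhs_ballP[d /= d0 hd].
  have dE : d = (complex.Re d)%:C%C by rewrite RRe_real// ger0_real// ltW.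
  set r := complex.Re d in dE; have r0 : 0 < r by rewrite dE ltcR in d0.
  exists (2 / r) => [|f]; first by rewrite divr_ge0// ltW.
  have [->|f0] := eqVneq f 0; first by rewrite lin0// hnorm0 mulr0.
  have fp : 0 < hnorm f.
    rewrite lt_neqAle hnorm_ge0 andbT eq_sym; apply: contra_neq f0; exact: hnorm_eq0.
  (* Scales [f] to norm r / 2, inside the ball of radius r that continuity at 0 maps into the unit
     ball; this is the origin of the constant 2 / r. *)
  pose s := r / (2 * hnorm f).
  have s0 : 0 < s by rewrite divr_gt0// mulr_gt0.
  have := hd (s%:C%C *: f); rewrite -ball_normE /= sub0r normrN hnormE dE ltcR.
  rewrite hnormZ cabs_real ger0_norm ?(ltW s0)// lin0// sub0r normrN linZ//.
  have sf : s * hnorm f = r / 2.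
    by rewrite /s; field; rewrite gt_eqF.
  rewrite sf hnormE hnormZ cabs_real ger0_norm ?(ltW s0)// => /(_ _).
  have -> : r / 2 < r by lra.
  rewrite (_ : 1 = 1%:C%C)// ltcR => /(_ erefl) h.
  rewrite -(ler_pM2l s0); apply: le_trans (ltW h) _.
  rewrite mulrCA sf (_ : 2 / r * (r / 2) = 1)//.
  by field; rewrite gt_eqF.
move=> f; apply/cvgrPdist_lt => e e0.
have eE : e = (complex.Re e)%:C%C by rewrite RRe_real// ger0_real// ltW.
set r := complex.Re e in eE; have r0 : 0 < r by rewrite eE ltcR in e0.
have C1 : 0 < C + 1 by lra.
have d0 : (0 : R[i]) < (r / (C + 1))%:C%C by rewrite ltcR divr_gt0.
apply/nbhs_ballP; exists (r / (C + 1))%:C%C => // g.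
rewrite -ball_normE /= hnormE ltcR => fg; rewrite -linB// hnormE eE ltcR.
apply: le_lt_trans (xC _) _; move: fg; rewrite ltr_pdivlMr//.
by have := hnorm_ge0 (f - g); lra.
Qed.

Lemma bounded_op_linear x : bounded_op x -> linear x. Proof. by case. Qed.

Lemma opnorm_ge0 x : 0 <= opnorm x.
Proof.
rewrite /opnorm; set A := (X in sup X).
(* [sup] is 0 by convention when there is no supremum. *)
have [hA|nA] := pselect (has_sup A); last by rewrite sup_out.
have [[r [f f1 fr]] _] := hA; apply: le_trans (hnorm_ge0 (x f)) _.
by apply: sup_upper_bound => //; exists f.
Qed.

Lemma opnorm_le x C : 0 <= C -> (forall f, hnorm (x f) <= C * hnorm f) ->
  opnorm x <= C.
Proof.
move=> C0 h; apply: ge_sup => [|_ [f /= f1 <-]].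
  by exists (hnorm (x 0)), 0; rewrite //= hnorm0.
by apply: le_trans (h f) _; rewrite ler_piMr.
Qed.

Lemma opnormP x f : bounded_op x -> hnorm (x f) <= opnorm x * hnorm f.
Proof.
move=> /bounded_opP[lx [C C0 h]].
have [->|f0] := eqVneq f 0; first by rewrite lin0// hnorm0 mulr0.
have fp : 0 < hnorm f.
  rewrite lt_neqAle hnorm_ge0 andbT eq_sym; apply: contra_neq f0; exact: hnorm_eq0.
rewrite -ler_pdivrMr//.
have -> : hnorm (x f) / hnorm f = hnorm (x ((hnorm f)^-1%:C%C *: f)).
  by rewrite linZ// hnormZ cabs_real ger0_norm ?invr_ge0 ?hnorm_ge0// mulrC.
apply: ub_le_sup.
  exists C => _ [g /= g1 <-]; apply: le_trans (h g) _; rewrite ler_piMr//.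
exists ((hnorm f)^-1%:C%C *: f) => //=.
by rewrite hnormZ cabs_real ger0_norm ?invr_ge0 ?hnorm_ge0// mulVf// gt_eqF.
Qed.

Lemma bounded_op_lin k x y : bounded_op x -> bounded_op y -> bounded_op (k *: x + y).
Proof.
move=> /bounded_opP[lx [C C0 xC]] /bounded_opP[ly [D D0 yD]]; apply/bounded_opP.
have E f : (k *: x + y) f = k *: x f + y f by [].
split=> [a f g|].
  rewrite !E lx ly !scalerDr !scalerA mulrC -!addrA; congr (_ + _).
  by rewrite addrCA.
exists (cabs k * C + D) => [|f]; first by rewrite addr_ge0// mulr_ge0// cabs_ge0.
rewrite E; apply: le_trans (hnorm_leD _ _) _; rewrite mulrDl lerD// hnormZ -mulrA.
by rewrite ler_wpM2l// cabs_ge0.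
Qed.

Lemma bounded_op_comp x y : bounded_op x -> bounded_op y -> bounded_op (x \o y).
Proof.
move=> /bounded_opP[lx [C C0 xC]] /bounded_opP[ly [D D0 yD]]; apply/bounded_opP.
split=> [a f g|]; first by rewrite /= ly lx.
exists (C * D) => [|f]; first by rewrite mulr_ge0.
by apply: (le_trans (xC (y f))); rewrite -mulrA ler_wpM2l.
Qed.

Lemma seminorm_opnorm (E : set (H -> H)) : (forall x, E x -> bounded_op x) ->
  linear_subspace E -> seminorm_on E opnorm.
Proof.
move=> bE lE; split=> [x Ex|k x Ex|x y Ex Ey]; first exact: opnorm_ge0.
- have h k' x' : E x' -> opnorm (k' *: x') <= cabs k' * opnorm x'.
    move=> Ex'; apply: opnorm_le; first by rewrite mulr_ge0 ?cabs_ge0 ?opnorm_ge0.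
    move=> f; rewrite -[(k' *: x') f]/(k' *: x' f) hnormZ -mulrA.
    by rewrite ler_wpM2l ?cabs_ge0// opnormP//; exact: bE.
  apply/eqP; rewrite eq_le h// -/(cabs k) andTb.
  have [->|k0] := eqVneq k 0; first by rewrite cabs0 mul0r opnorm_ge0.
  have := h k^-1 (k *: x) (linear_subspaceZ k lE Ex).
  rewrite scalerA mulVf// scale1r.
  have kp : 0 < cabs k.
    by rewrite lt_neqAle cabs_ge0 andbT eq_sym; apply: contra_neq k0; exact: cabs_eq0.
  have -> : cabs k^-1 = (cabs k)^-1.
    by apply: (mulfI (lt0r_neq0 kp)); rewrite -cabsM !mulfV ?cabs1// gt_eqF.
  by move=> /(ler_wpM2l (ltW kp)); rewrite mulrA mulfV ?mul1r// gt_eqF.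
- apply: opnorm_le; first by rewrite addr_ge0 ?opnorm_ge0.
  move=> f; rewrite -[(x + y) f]/(x f + y f); apply: le_trans (hnorm_leD _ _) _.
  by rewrite mulrDl lerD// opnormP//; exact: bE.
Qed.

Lemma opnorm_compl x y : bounded_op x -> bounded_op y -> opnorm x <= 1 ->
  opnorm (x \o y) <= opnorm y.
Proof.
move=> bx by_ x1; apply: opnorm_le => [|f]; first exact: opnorm_ge0.
apply: le_trans (opnormP _ bx) _; apply: le_trans (opnormP _ by_).
by rewrite ler_piMl ?hnorm_ge0.
Qed.

Lemma opnorm_compr x y : bounded_op x -> bounded_op y -> opnorm y <= 1 ->
  opnorm (x \o y) <= opnorm x.
Proof.
move=> bx by_ x1; apply: opnorm_le => [|f]; first exact: opnorm_ge0.
apply: le_trans (opnormP _ bx) _; apply: ler_wpM2l; first exact: opnorm_ge0.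
by apply: le_trans (opnormP _ by_) _; rewrite ler_piMl ?hnorm_ge0.
Qed.

Lemma dot_extr f g : (forall h, <|h, f|> = <|h, g|>) -> f = g.
Proof.
move=> h; apply/eqP; rewrite -subr_eq0; apply/eqP/dotff_eq0.
by rewrite dotBr h subrr.
Qed.

Lemma dot_extl f g : (forall h, <|f, h|> = <|g, h|>) -> f = g.
Proof. by move=> h; apply: dot_extr => a; rewrite dotC h -dotC. Qed.

Lemma Re_ext k k' : complex.Re k = complex.Re k' ->
  complex.Re ('i%C * k) = complex.Re ('i%C * k') -> k = k'.
Proof.
case: k k' => a b [c d] /= -> h; congr Complex; move: h.
by rewrite !mul0r !mul1r !sub0r => /oppr_inj.
Qed.

(* The representing vector minimizes |f|^2 - 2 Re l(f). *)
Lemma Riesz (l : H -> R[i]) C : 0 <= C ->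
  (forall k f g, l (k *: f + g) = k * l f + l g) ->
  (forall f, cabs (l f) <= C * hnorm f) -> exists u, forall f, l f = <|f, u|>.
Proof.
move=> C0 lin lC.
have l0 : l 0 = 0 by have := lin 1 0 0; rewrite scale1r addr0 mul1r -{1}[l 0]addr0 => /addrI.
have lZ k f : l (k *: f) = k * l f by rewrite -[k *: f]addr0 lin l0 addr0.
have lD f g : l (f + g) = l f + l g by rewrite -[f in LHS]scale1r lin mul1r.
pose J f := hnorm f ^+ 2 - 2 * complex.Re (l f).
have Jlb f : - C ^+ 2 <= J f.
  have := Re_le_cabs (l f); have := lC f; have := sqr_ge0 (hnorm f - C).
  rewrite /J sqrrB; lra.
pose m := inf (range J).
have Jinf : has_inf (range J).
  by split; [exists (J 0), 0|exists (- C ^+ 2) => _ [f _ <-]].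
have mJ f : m <= J f by apply: ge_inf; [case: Jinf|exists f].
(* A minimizing sequence with error 4^-n: by the parallelogram identity [par], consecutive terms
   differ in square norm by at most (5/2) 4^-n, which is below (2 * 2^-n)^2. *)
have /choice[u hu] n : exists f, J f < m + (2 ^- n) ^+ 2.
  have [|_ [f _ <-] hf] := @inf_adherent _ (range J) ((2 ^- n) ^+ 2) _ Jinf.
    by rewrite exprn_gt0.
  by exists f.
have par f g : hnorm (f - g) ^+ 2 = 2 * J f + 2 * J g - 4 * J (2^-1 *: (f + g)).
  rewrite /J lZ lD hnormZ exprMn hnorm_sqrB hnorm_sqrD.
  have -> : 2^-1 = (2^-1 : R)%:C%C :> R[i].
    by rewrite fmorphV rmorphMn.
  rewrite cReM cReD cabs_real ger0_norm//; lra.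
have step n : hnorm (u n.+1 - u n) <= 2 * 2 ^- n.
  rewrite -(@ler_pXn2r _ 2)// ?nnegrE ?hnorm_ge0 ?mulr_ge0//.
  rewrite par exprMn.
  have := hu n; have := hu n.+1; have := mJ (2^-1 *: (u n.+1 + u n)).
  have -> : (2 ^- n.+1) ^+ 2 = (2 ^- n) ^+ 2 / 4 :> R.
    have -> : 2 ^- n.+1 = 2 ^- n / 2 :> R by rewrite [2 ^+ n.+1]exprS invfM mulrC.
    by rewrite expr2; lra.
  have : 0 <= (2 ^- n) ^+ 2 :> R by rewrite sqr_ge0.
  lra.
have [v hv _] := hcomplete_fast step.
(* The right-hand side is J (v + t f) - J v. The inequality is obtained from the approximations
   [u n], for which J (u n + t f) >= m, and passes to the limit. *)
have key (t : R) f : 0 <= 2 * t * (complex.Re <|v, f|> - complex.Re (l f)) + t ^+ 2 * hnorm f ^+ 2.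
  apply/ler_addgt0Pr => e e0.
  have t1 : 0 < 2 * `|t| + 1 by have := normr_ge0 t; lra.
  have [|N hN] := hcvg_dotl f hv (e := e / 2 / (2 * `|t| + 1)).
    by rewrite !divr_gt0.
  have [N' hN'] : exists N', (2 ^- N') ^+ 2 < e / 2.
    have : (2 ^- n) ^+ 2 @[n --> \oo] --> (0 : R).
      under eq_fun do rewrite -exprVn exprAC.
      by apply: cvg_expr; rewrite ger0_norm//; lra.
    move=> /cvgrPdist_lt /(_ (e / 2)) [|N' _ /(_ N' (leqnn _))]; first lra.
    by rewrite sub0r normrN ger0_norm ?sqr_ge0//; exists N'.
  pose n := maxn N N'.
  have := hN n (leq_maxl _ _); rewrite ltr_pdivlMr// => d1.
  have d2 : (2 ^- n) ^+ 2 <= (2 ^- N') ^+ 2 :> R.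
    by rewrite ler_pXn2r ?nnegrE// lef_pV2 ?posrE ?exprn_gt0// ler_weXn2l ?leq_maxr//; lra.
  have := hu n; have := mJ (u n + t%:C%C *: f); rewrite {1 2}/J.
  rewrite hnorm_sqrD lD lZ cReD cReM hnormZ cabs_real exprMn real_normK ?num_real//.
  rewrite dotZr [Num.conj _]conjc_real cReM.
  set z := <|u n, f|> in d1 *; set w := <|v, f|> in d1 *.
  have zw : `|complex.Re z - complex.Re w| <= cabs (z - w).
    by rewrite -cReN -cReD -lecR -cabsE normc_ge_Re.
  have : `|t * (complex.Re z - complex.Re w)| <= `|t| * cabs (z - w).
    by rewrite normrM ler_wpM2l.
  rewrite ler_norml => /andP[]; have := cabs_ge0 (z - w); rewrite /J; lra.
have eqRe f : complex.Re (l f) = complex.Re <|v, f|>.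
  set F := hnorm f ^+ 2; pose d := complex.Re <|v, f|> - complex.Re (l f).
  suff : d = 0 by rewrite /d; lra.
  have F0 : 0 <= F by exact: sqr_ge0.
  have F1 : 0 < F + 1 by lra.
  (* This t makes the quadratic expression equal to - d^2 (F + 2) / (F + 1)^2; the summand 1 avoids
     dividing by F = 0. *)
  have := key (- d / (F + 1)) f; rewrite -/d -/F => h.
  have : 0 <= (F + 1) ^+ 2 * (2 * (- d / (F + 1)) * d + (- d / (F + 1)) ^+ 2 * F).
    by rewrite mulr_ge0// sqr_ge0.
  have -> : (F + 1) ^+ 2 * (2 * (- d / (F + 1)) * d + (- d / (F + 1)) ^+ 2 * F) =
    - (d ^+ 2 * (F + 2)) by field; rewrite gt_eqF.
  rewrite oppr_ge0 => h2; apply/eqP; rewrite -sqrf_eq0 eq_le sqr_ge0 andbT.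
  by rewrite -(pmulr_lle0 _ (_ : 0 < F + 2))//; lra.
exists v => f; apply: Re_ext; first by rewrite eqRe dotC cReC.
by rewrite -lZ eqRe dotC cReC dotZl.
Qed.

Lemma adjoint_exists x : bounded_op x -> exists2 y, bounded_op y & adjoint_of x y.
Proof.
move=> bx; have [lx [C C0 xC]] := (bounded_opP x).1 bx.
have /choice[y hy] g : exists u, forall f, <|x f, g|> = <|f, u|>.
  apply: (@Riesz (fun f => <|x f, g|>) (C * hnorm g)).
  - by rewrite mulr_ge0// hnorm_ge0.
  - by move=> k f f'; rewrite lx dotDl dotZl.
  - move=> f; apply: le_trans (Cauchy_Schwarz _ _) _.
    by rewrite mulrAC ler_wpM2r ?hnorm_ge0.
exists y => [|f g]; last exact: hy.
apply/bounded_opP; split.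
  move=> k f g; apply: dot_extr => h.
  by rewrite -hy !dotDr !dotZr !hy.
exists C => // g; have [->|g0] := eqVneq (y g) 0.
  by rewrite hnorm0 mulr_ge0// hnorm_ge0.
have fp : 0 < hnorm (y g).
  rewrite lt_neqAle hnorm_ge0 andbT eq_sym; apply: contra_neq g0; exact: hnorm_eq0.
rewrite -(ler_pM2l fp) -expr2 hnorm_sqr -hy.
apply: le_trans (Cauchy_Schwarz_Re _ _) _; rewrite mulrCA mulrA.
by rewrite ler_wpM2r ?hnorm_ge0.
Qed.

End BoundedOperators.

(** * Von Neumann algebras *)

Section VonNeumann.
Context {R : realType} {H : hilbertType R}.
Implicit Types (f g h : H) (x y : H -> H) (k c : R[i]) (C : R) (M : set (H -> H)).

(** The bicommutant identity read pointwise: the working test for membership in [M]. *)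
Lemma vonNeumannP M x : von_neumann M ->
  M x <-> (bounded_op x /\ forall y, commutant M y -> forall f, x (y f) = y (x f)).
Proof.
move=> [bM _ MM]; split=> [Mx|[bx h]].
  split=> [|y [_ /(_ _ Mx) yx] f]; first exact: bM.
  by have := congr1 (fun z => z f) yx => /= ->.
by rewrite -MM; split=> // y cy; apply/funext => f /=; rewrite h.
Qed.

Lemma vonNeumann_bounded M x : von_neumann M -> M x -> bounded_op x.
Proof. by move=> [bM _ _]; exact: bM. Qed.

Lemma commutantE M x y f : commutant M y -> M x -> y (x f) = x (y f).
Proof. by move=> [_ /[apply]] yx; have := congr1 (fun z => z f) yx. Qed.

Lemma vonNeumann_linear M : von_neumann M -> linear_subspace M.
Proof.
move=> vM; split=> [|k x y Mx My].
  apply/(vonNeumannP _ vM); split=> [|y [/bounded_op_linear ly _] f]; last first.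
    by rewrite -[RHS]/(y 0) lin0.
  apply/bounded_opP; split=> [k f g|]; first by rewrite -[RHS]/(k *: 0 + 0) scaler0 addr0.
  by exists 0 => // f; rewrite mul0r -[X in hnorm X]/(0 : H) hnorm0.
apply/(vonNeumannP _ vM); split.
  by apply: bounded_op_lin; apply: (vonNeumann_bounded vM).
move=> z cz f; have lz : linear z by have [[]] := cz.
rewrite -[RHS]/(z (k *: x f + y f)) lz -[LHS]/(k *: x (z f) + y (z f)).
by rewrite (commutantE _ cz Mx) (commutantE _ cz My).
Qed.

Lemma vonNeumann_comp M x y : von_neumann M -> M x -> M y -> M (x \o y).
Proof.
move=> vM Mx My; apply/(vonNeumannP _ vM); split.
  by apply: bounded_op_comp; apply: (vonNeumann_bounded vM).
by move=> z cz f /=; rewrite (commutantE _ cz Mx) (commutantE _ cz My).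
Qed.

(** Iterate f |-> c^-1 (g - y f). As 2 C < |c|, the contraction factor is at most 1/2, the rate that
    [hcomplete_fast] expects. *)
Lemma fixpoint_inverse y C c g : linear y -> 0 <= C ->
  (forall f, hnorm (y f) <= C * hnorm f) -> 2 * C < cabs c ->
  exists f, y f + c *: f = g.
Proof.
move=> ly C0 yC Cc.
have c0 : c != 0 by apply: contraTneq Cc => ->; rewrite cabs0 -leNgt; lra.
have cp : 0 < cabs c by lra.
have cV : cabs c^-1 = (cabs c)^-1.
  by apply: (mulfI (lt0r_neq0 cp)); rewrite -cabsM !mulfV ?cabs1// gt_eqF.
pose u n := iter n (fun f => c^-1 *: (g - y f)) 0.
have uS n : u n.+1 = c^-1 *: (g - y (u n)) by [].
have step n : hnorm (u n.+1 - u n) <= hnorm (c^-1 *: g) * 2 ^- n.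
  elim: n => [|n IH].
    by rewrite uS /u /= lin0// !subr0 expr0 invr1 mulr1.
  have -> : u n.+2 - u n.+1 = c^-1 *: - y (u n.+1 - u n).
    rewrite [u n.+2]uS -[X in _ - X]/(c^-1 *: (g - y (u n))) -scalerBr (linB _ _ ly).
    by rewrite !opprB addrC addrA subrK.
  have h1 : hnorm (y (u n.+1 - u n)) <= C * (hnorm (c^-1 *: g) * 2 ^- n).
    by apply: le_trans (yC _) _; exact: ler_wpM2l.
  rewrite hnormZ hnorm_opp cV [2 ^+ n.+1]exprS invfM mulrCA.
  have z0 : 0 <= hnorm (c^-1 *: g) * 2 ^- n by rewrite mulr_ge0 ?hnorm_ge0.
  rewrite ler_pdivrMl//; apply: le_trans h1 _.
  have := ler_wpM2r z0 (ltW Cc); move: (hnorm _ * _) z0 => z _; lra.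
have [f uf _] := hcomplete_fast step; exists f.
have yf := hcvg_linear ly yC uf.
apply/eqP; rewrite -subr_eq0; apply/eqP/hnorm_eq0/eqP.
rewrite eq_le hnorm_ge0 andbT; apply/ler_addgt0Pr => e e0; rewrite add0r.
have e2 : 0 < e / 2 by lra.
have [N hN] := yf _ e2; have [N' hN'] := uf (e / 2 / cabs c) (divr_gt0 e2 cp).
pose n := maxn N N'.
have := hN n (leq_maxl _ _); have := hN' n.+1 (leqW (leq_maxr _ _)).
rewrite ltr_pdivlMr// mulrC -hnormZ uS scalerBr scalerA mulfV// scale1r /=.
set a := g - y (u n) - c *: f; set b := y (u n) - y f => ha hb.
have -> : y f + c *: f - g = - (a + b).
  by rewrite /a /b [in RHS]addrAC [in RHS]addrA subrK !opprB addrCA addrA.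
by rewrite hnorm_opp; have := hnorm_leD a b; lra.
Qed.

Lemma shift_injective y C c f g : linear y ->
  (forall f, hnorm (y f) <= C * hnorm f) -> 2 * C < cabs c ->
  y f + c *: f = y g + c *: g -> f = g.
Proof.
move=> ly yC Cc h; apply/eqP; rewrite -subr_eq0; apply/eqP.
have e : c *: (f - g) = - y (f - g).
  rewrite scalerBr (linB _ _ ly) opprB; apply/eqP; rewrite subr_eq addrAC -h.
  by rewrite [X in _ == X]addrC addKr.
have := yC (f - g); rewrite -hnorm_opp -e hnormZ => h1.
apply: hnorm_eq0; apply/eqP; rewrite eq_le hnorm_ge0 andbT leNgt; apply/negP => h0.
have := ler_pM2r h0; move: h1 => /[swap] ->; have : 0 <= cabs c by exact: cabs_ge0.
lra.
Qed.

(* The unitary is the Cayley transform (y - it)(y + it)^-1 with t > 2 |y|. *)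
Lemma commute_selfadjoint M e y : von_neumann M -> linear e ->
  (forall u, commutant M u -> unitary_op u -> forall f, e (u f) = u (e f)) ->
  commutant M y -> adjoint_of y y -> forall f, e (y f) = y (e f).
Proof.
move=> vM le eu cy sy; have [by_ yM] := cy.
have [ly [C C0 yC]] := (bounded_opP y).1 by_.
pose t := 2 * C + 1; pose c := 'i%C * t%:C%C.
have cc : cabs c = t.
  rewrite cabsM cabs_real /cabs normc_def /= expr0n expr1n /= add0r sqrtr1 mul1r.
  by rewrite ger0_norm// /t; lra.
have cN : cabs (- c) = t by rewrite -mulN1r cabsM cc /cabs normrN normr1 mul1r.
have Cc : 2 * C < cabs c by rewrite cc /t; lra.
have CcN : 2 * C < cabs (- c) by rewrite cN /t; lra.
have c0 : c != 0 by apply: contraTneq Cc => ->; rewrite cabs0 -leNgt; lra.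
have /choice[s hs] g : exists f, y f + c *: f = g by exact: fixpoint_inverse ly C0 yC Cc.
have sK f : s (y f + c *: f) = f.
  by apply: shift_injective ly yC Cc _; rewrite hs.
have ls : linear s.
  move=> k f g; apply: (shift_injective ly yC Cc); rewrite hs ly -[in LHS](hs f).
  rewrite -[in LHS](hs g) !scalerDr !scalerA [c * k]mulrC -!addrA; congr (_ + _).
  by rewrite addrCA.
(* Since [s] inverts y + c, this is (y - c) (y + c)^-1, written so as to be affine in [s]. *)
pose u g := g - (2 * c) *: s g.
have ush f : u (y f + c *: f) = y f - c *: f.
  rewrite /u sK mulrDl mul1r scalerDl opprD addrA; congr (_ - _).
  by rewrite addrK.
have udot f g : <|u f, u g|> = <|f, g|>.
  rewrite -(hs f) -(hs g) !ush; move: (s f) (s g) => {}f {}g.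
  rewrite !dotBl !dotBr !dotDl !dotDr !dotZl !dotZr !sy.
  have -> : Num.conj c = - c.
    rewrite /c rmorphM /= -mulNr; congr (_ * _); last exact: conjc_real.
    by apply/eqP; rewrite eq_complex /= oppr0 !eqxx.
  ring.
have lu : linear u.
  move=> k f g; rewrite /u ls scalerDr scalerBr !scalerA opprD [2 * c * k]mulrC.
  by rewrite addrACA.
have bu : bounded_op u.
  apply/bounded_opP; split=> //; exists 1 => // f.
  rewrite mul1r -(@ler_pXn2r _ 2)// ?nnegrE ?hnorm_ge0//.
  by rewrite !hnorm_sqr udot.
have uu : unitary_op u.
  split=> //; apply/seteqP; split=> // g _.
  (* Surjectivity of [u]: y - c is onto as well, because -c has the same modulus as c. *)
  have [f hf] := fixpoint_inverse g ly C0 yC CcN.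
  by exists (y f + c *: f) => //; rewrite ush -hf scaleNr.
have cu : commutant M u.
  split=> // x Mx; apply/funext => f /=.
  have xl : linear x by have [] := vonNeumann_bounded vM Mx.
  suff sx : s (x f) = x (s f) by rewrite /u sx (linB _ _ xl) (linZ _ _ xl).
  rewrite -{1}(hs f) (linD _ _ xl) (linZ _ _ xl).
  by rewrite -(commutantE _ cy Mx) sK.
move=> f.
(* [u] is affine in [s] with slope -2c, which is nonzero, so commuting with [u] gives commuting with
   [s], hence with its inverse y + c, hence with y. *)
have es g : e (s g) = s (e g).
  have := eu u cu uu g; rewrite /u (linB _ _ le) (linZ _ _ le) => /addrI/oppr_inj.
  by move=> /scalerI; apply; rewrite mulf_neq0// pnatr_eq0.
have := hs (e (y f + c *: f)); rewrite -es sK (linD _ _ le) (linZ _ _ le).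
by move=> /addIr.
Qed.

Lemma commutant_adjoint M y z : von_neumann M -> commutant M y ->
  bounded_op z -> adjoint_of y z -> commutant M z.
Proof.
move=> vM cy bz yz; split=> // x Mx; apply/funext => g /=; apply: dot_extr => f.
have [_ adjM _] := vM; have [x' Mx' xx'] := adjM _ Mx.
have x'x h h' : <|x' h, h'|> = <|h, x h'|>.
  by rewrite dotC -xx' -dotC.
by rewrite -yz -!x'x -yz (commutantE _ cy Mx').
Qed.

(** Reduces the bicommutant test to unitaries, the only elements that affiliation speaks of: with z
    the adjoint of y, both y + z and i (y - z) are self-adjoint elements of the commutant, and y is
    recovered from them. *)
Lemma vonNeumann_unitary M e : von_neumann M -> bounded_op e ->
  (forall u, commutant M u -> unitary_op u -> forall f, e (u f) = u (e f)) ->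
  M e.
Proof.
move=> vM be eu; apply/(vonNeumannP _ vM); split=> // y cy f.
have le := bounded_op_linear be.
have [by_ yM] := cy; have [z bz yz] := adjoint_exists by_.
have cz := commutant_adjoint vM cy bz yz.
have zy g h : <|z g, h|> = <|g, y h|> by rewrite dotC -yz -dotC.
have commD k k' : commutant M (fun f => k *: y f + k' *: z f).
  have -> : (fun f => k *: y f + k' *: z f) = k *: y + (k' *: z + 0).
    by rewrite addr0.
  split=> [|x Mx].
    apply: bounded_op_lin => //; apply: bounded_op_lin => //.
    exact: vonNeumann_bounded vM (vonNeumann_linear vM).1.
  have lx := bounded_op_linear (vonNeumann_bounded vM Mx).
  apply/funext => h; rewrite /= addr0.
  rewrite -[LHS]/(k *: y (x h) + k' *: z (x h)) -[RHS]/(x (k *: y h + k' *: z h)).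
  by rewrite lx (linZ _ _ lx) (commutantE _ cy Mx) (commutantE _ cz Mx).
have h1 : e (1 *: y f + 1 *: z f) = 1 *: y (e f) + 1 *: z (e f).
  apply: (commute_selfadjoint vM le eu (commD 1 1)) => g h.
  by rewrite dotDl dotDr !dotZl !dotZr yz zy rmorph1 addrC.
have h2 : e ('i%C *: y f + (- 'i%C) *: z f) = 'i%C *: y (e f) + (- 'i%C) *: z (e f).
  apply: (commute_selfadjoint vM le eu (commD 'i%C (- 'i%C))) => g h.
  have iJ : Num.conj 'i%C = - 'i%C :> R[i] by rewrite conjCi.
  by rewrite dotDl dotDr !dotZl !dotZr yz zy rmorphN /= iJ opprK addrC.
move: h1 h2; rewrite !(linD _ _ le) !(linZ _ _ le) !scale1r => h1.
rewrite !scaleNr -!scalerBr => h2.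
have i0 : 'i%C != 0 :> R[i] by rewrite eq_complex /= oner_eq0 andbF.
have {}h2 := scalerI i0 h2.
have h3 : 2 *: e (y f) = 2 *: y (e f).
  have E a b : 2 *: a = (a + b) + (a - b) :> H.
    by rewrite addrACA subrr addr0 scaler_nat mulr2n.
  by rewrite (E _ (e (z f))) (E _ (z (e f))) h1 h2.
by apply: scalerI h3; rewrite pnatr_eq0.
Qed.

Lemma operator_limit (s : nat -> H -> H) C : (forall n, linear (s n)) ->
  (forall n f, hnorm (s n.+1 f - s n f) <= C * hnorm f * 2 ^- n) ->
  exists2 l, linear l & forall n f, hnorm (s n f - l f) <= 2 * (C * hnorm f) * 2 ^- n.
Proof.
move=> ls step.
have /choice[l hl] f : exists l, hcvg (s^~ f) l /\
    forall n, hnorm (s n f - l) <= 2 * (C * hnorm f) * 2 ^- n.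
  by have [l ? ?] := hcomplete_fast (u := s^~ f) (fun n => step n f); exists l.
exists l => [k f g|n f]; last exact: (hl f).2.
have := hl (k *: f + g) => -[h _]; apply: hcvg_unique h _ => e e0.
have k1 : 0 < cabs k + 1 by have := cabs_ge0 k; lra.
have e2 : 0 < e / 2 by lra.
have [N hN] := (hl f).1 _ (divr_gt0 e2 k1); have [N' hN'] := (hl g).1 _ e2.
exists (maxn N N') => n; rewrite geq_max => /andP[/hN + /hN'].
rewrite ltr_pdivlMr// ls opprD addrACA -scalerBr => hf hg.
apply: le_lt_trans (hnorm_leD _ _) _; rewrite hnormZ.
have := hnorm_ge0 (s n f - l f); lra.
Qed.

Lemma operator_limit_cvg (s : nat -> H -> H) l C f :
  (forall n, hnorm (s n f - l f) <= C * 2 ^- n) -> hcvg (s^~ f) (l f).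
Proof.
move=> h e e0.
have [N hN] := geometric_small C e0; exists N => n /hN.
exact: le_lt_trans.
Qed.

Lemma operator_limit_commute (s : nat -> H -> H) l C y : bounded_op y ->
  (forall n f, hnorm (s n f - l f) <= 2 * (C * hnorm f) * 2 ^- n) ->
  (forall n f, s n (y f) = y (s n f)) -> forall f, l (y f) = y (l f).
Proof.
move=> /bounded_opP[ly [D D0 yD]] h ys f.
apply: (@hcvg_unique _ _ (s^~ (y f))).
  exact: (operator_limit_cvg (fun n => h n _)).
have -> : s^~ (y f) = y \o s^~ f by apply/funext => n /=; rewrite ys.
exact: (hcvg_linear ly yD (operator_limit_cvg (fun n => h n _))).
Qed.

(** Commutation with a fixed bounded operator survives limits, so the limit passes the bicommutant
    test. *)
Lemma vonNeumann_limit M (s : nat -> H -> H) C : von_neumann M ->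
  (forall n, M (s n)) ->
  (forall n f, hnorm (s n.+1 f - s n f) <= C * hnorm f * 2 ^- n) ->
  exists2 l, M l & forall n f, hnorm (s n f - l f) <= 2 * (C * hnorm f) * 2 ^- n.
Proof.
move=> vM Ms step.
have ls n := bounded_op_linear (vonNeumann_bounded vM (Ms n)).
have [l ll hl] := operator_limit ls step; exists l => //.
apply/(vonNeumannP _ vM); split.
  have [_ [D D0 sD]] := (bounded_opP _).1 (vonNeumann_bounded vM (Ms 0%N)).
  apply/bounded_opP; split=> //; exists (D + 2 * `|C|) => [|f].
    by rewrite addr_ge0// mulr_ge0.
  have := hl 0%N f; rewrite expr0 invr1 mulr1 hnormBC => h.
  have := hnorm_leD (l f - s 0%N f) (s 0%N f); rewrite subrK.
  have := sD f; have := ler_wpM2r (hnorm_ge0 f) (ler_norm C); lra.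
move=> y cy; have [by_ _] := cy.
apply: operator_limit_commute by_ hl _ => n f.
by rewrite (commutantE _ cy (Ms n)).
Qed.

(** Completeness of the corner p M r. Two projections are allowed so as to serve the reduced
    algebras (p = r) and the off-diagonal corner; only the compressions of [x n] are controlled, so
    they form the sequence that converges. *)
Lemma vonNeumann_complete M p r (x : nat -> H -> H) : von_neumann M ->
  M p -> M r -> p \o p = p -> r \o r = r -> (forall n, M (x n)) ->
  (forall n, opnorm (p \o (x n.+1 - x n) \o r) <= 2 ^- n) ->
  exists l, [/\ M l, p \o l \o r = l & forall e : R, 0 < e -> exists N : nat,
    forall n, (N <= n)%N -> opnorm (p \o (x n - l) \o r) < e].
Proof.
move=> vM Mp Mr pp rr Mx step.
have bp := vonNeumann_bounded vM Mp; have lp := bounded_op_linear bp.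
have br := vonNeumann_bounded vM Mr.
pose s n := p \o x n \o r.
have Ms n : M (s n) by do 2 apply: vonNeumann_comp => //.
have [||l Ml hl] := @vonNeumann_limit M s 1 vM => //.
  move=> n f; rewrite mul1r mulrC.
  have -> : s n.+1 f - s n f = (p \o (x n.+1 - x n) \o r) f.
    by rewrite /= -(linB _ _ lp).
  apply: le_trans (opnormP _ _) _; last by rewrite ler_wpM2r ?hnorm_ge0.
  apply: (vonNeumann_bounded vM); do 2 apply: vonNeumann_comp => //.
  by apply: linear_subspaceB => //; exact: vonNeumann_linear.
have [_ [D D0 pD]] := (bounded_opP _).1 bp.
have plr : p \o l \o r = l.
  apply/funext => f /=; apply: (@hcvg_unique _ _ (s^~ f)); last first.
    exact: (operator_limit_cvg (fun n => hl n _)).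
  have -> : s^~ f = p \o s^~ (r f).
    apply/funext => n; rewrite /s /=.
    by rewrite -[p (p _)]/((p \o p) _) pp -[r (r f)]/((r \o r) f) rr.
  exact: (hcvg_linear lp pD (operator_limit_cvg (fun n => hl n _))).
exists l; split=> // e e0.
have [N hN] := geometric_small 2 e0; exists N => n /hN; apply: le_lt_trans.
apply: opnorm_le => [|f]; first by rewrite mulr_ge0.
have -> : (p \o (x n - l) \o r) f = s n f - l f.
  rewrite -{2}plr /= -(linB _ _ lp) //.
by apply: le_trans (hl n f) _; rewrite mul1r mulrAC.
Qed.

End VonNeumann.

(** * Projection-valued measures and spectral integrals *)

Section EqMeasurableIntegral.
Context {R : realType}.
Import HBNNSimple.

(** [diag_measure] is a bare set function, with arbitrary values off the measurable sets. The
    integral is built from simple functions, whose level sets are measurable, so a true measure may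
    be substituted. *)
Lemma eq_measurable_integral (m1 m2 : set R -> \bar R) (phi : R -> \bar R) :
  (forall A, measurable A -> m1 A = m2 A) ->
  (\int[m1]_t phi t = \int[m2]_t phi t)%E.
Proof.
move=> m12.
have E (h : {nnsfun R >-> R}) : sintegral m1 h = sintegral m2 h.
  by rewrite /sintegral; apply: eq_fsbigr => r _; rewrite m12.
rewrite /integral; congr (_ - _)%E; congr ereal_sup;
  by apply/seteqP; split=> _ [k kg <-]; exists k.
Qed.

End EqMeasurableIntegral.

Section Projections.
Context {R : realType} {H : hilbertType R}.
Implicit Types (f g h : H) (e : H -> H).

Lemma proj_idem e f : projection e -> e (e f) = e f.
Proof. by move=> [_ + _] => /(congr1 (fun z => z f)). Qed.

Lemma proj_dot e f g : projection e -> <|e f, g|> = <|f, e g|>.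
Proof. by move=> [_ _]; apply. Qed.

Lemma proj_dotff e f : projection e -> <|e f, f|> = (hnorm (e f) ^+ 2)%:C%C.
Proof. by move=> pe; rewrite -[in LHS](proj_idem f pe) (proj_dot _ _ pe) dotff. Qed.

Lemma proj_pythagoras e f : projection e ->
  hnorm f ^+ 2 = hnorm (e f) ^+ 2 + hnorm (f - e f) ^+ 2.
Proof.
by move=> pe; rewrite hnorm_sqrB [<|f, _|>]dotC proj_dotff// cReC /=; lra.
Qed.

Lemma hnorm_proj e f : projection e -> hnorm (e f) <= hnorm f.
Proof.
move=> pe; rewrite -(@ler_pXn2r _ 2)// ?nnegrE ?hnorm_ge0//.
by rewrite (proj_pythagoras f pe) lerDl sqr_ge0.
Qed.

Lemma bounded_proj e : projection e -> bounded_op e.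
Proof.
move=> pe; apply/bounded_opP; split; first by case: pe.
by exists 1 => // f; rewrite mul1r hnorm_proj.
Qed.

Lemma proj_eq e e' : projection e -> projection e' ->
  (forall f, e f = f -> e' f = f) -> (forall f, e' f = f -> e f = f) -> e = e'.
Proof.
move=> pe pe' h h'; apply/funext => f; apply: dot_extr => g.
rewrite -(proj_dot _ _ pe) -(h (e g)) ?proj_idem// (proj_dot _ _ pe').
by rewrite (proj_dot _ _ pe) (h' (e' f)) ?proj_idem.
Qed.

End Projections.

Section ProjectionValuedMeasures.
Context {R : realType} {H : hilbertType R}.
Implicit Types (f g h : H) (A B : set R).

Variables (p : H -> H) (Q : set R -> H -> H).
Hypothesis pQ : projection_valued_measure p Q.

Let projQ A : measurable A -> projection (Q A).
Proof. by have [h _ _] := pQ; exact: h. Qed.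

Let linQ A : measurable A -> linear (Q A).
Proof. by move=> /projQ[]. Qed.

Lemma pvmT : Q setT = p. Proof. by case: pQ. Qed.

Lemma pvm_cvg (F : nat -> set R) f : (forall n, measurable (F n)) ->
  trivIset setT F -> hcvg (fun n => \sum_(k < n) Q (F k) f) (Q (\bigcup_n F n) f).
Proof. by move=> mF tF; have [_ _ h] := pQ; apply/hcvgP; exact: h. Qed.

(** The constant family of empty sets is disjoint, so the sums of n copies of [Q set0 f] converge,
    and consecutive sums differ by that vector. *)
Lemma pvm0 f : Q set0 f = 0.
Proof.
have tF : trivIset setT (fun _ : nat => @set0 R).
  by apply/trivIsetP => i j _ _ _; rewrite setI0.
have h := pvm_cvg f (fun _ => measurable0) tF.
apply: hnorm_eq0; apply/eqP; rewrite eq_le hnorm_ge0 andbT.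
apply/ler_addgt0Pr => e e0; rewrite add0r.
have [|N hN] := h (e / 2); first lra.
have := hN N (leqnn N); have := hN N.+1 (leqnSn N).
rewrite big_ord_recr /=; set s := \sum_(i < N) _; set l := Q (\bigcup_ _ _) f.
move=> h1 h2; have := hnorm_triangle (s + Q set0 f) l s.
by rewrite (hnormBC l) [s + _]addrC addrK [_ + s]addrC; lra.
Qed.

Lemma pvmU A B f : measurable A -> measurable B -> A `&` B = set0 ->
  Q (A `|` B) f = Q A f + Q B f.
Proof.
move=> mA mB AB; rewrite -bigcup2E.
have mF n : measurable (bigcup2 A B n) by case: n => [|[|n]] /=.
apply: (hcvg_unique (pvm_cvg f mF _)); first by rewrite -trivIset_bigcup2.
move=> e e0; exists 2%N => n n2; rewrite -(subnKC n2) big_split_ord /=.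
rewrite 2!big_ord_recl big_ord0 /= addr0 big1 ?addr0 ?subrr ?hnorm0// => i _.
by rewrite pvm0.
Qed.

(** Orthogonality follows from additivity: for g = Q B f, the projection Q (A [|] B) gives |Q A g|^2
    + |g|^2 <= |g|^2. *)
Lemma pvm_disjoint A B f : measurable A -> measurable B -> A `&` B = set0 ->
  Q A (Q B f) = 0.
Proof.
move=> mA mB AB; apply: hnorm_eq0; apply/eqP; rewrite -sqrf_eq0; apply/eqP.
have mU : measurable (A `|` B) by exact: measurableU.
have := hnorm_proj (Q B f) (projQ mU).
rewrite -(@ler_pXn2r _ 2)// ?nnegrE ?hnorm_ge0//.
have := proj_dotff (Q B f) (projQ mU) => /(congr1 (@complex.Re R)) /= <-.
rewrite pvmU// (proj_idem _ (projQ mB)) dotDl cReD (proj_dotff (Q B f) (projQ mA)) dotff /=.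
rewrite gerDr => h; apply/eqP; rewrite eq_le h sqr_ge0//.
Qed.

Lemma pvmI A B f : measurable A -> measurable B -> Q A (Q B f) = Q (A `&` B) f.
Proof.
move=> mA mB; have mAB := measurableI _ _ mA mB; have mAB' := measurableD mA mB.
have mBA := measurableD mB mA.
have EA g : Q A g = Q (A `&` B) g + Q (A `\` B) g.
  rewrite -pvmU//; last by apply/seteqP; split=> x // [[_ ?] []].
  by congr Q; apply/seteqP; split=> x; have [] := pselect (B x) => /= *; tauto.
have EB g : Q B g = Q (A `&` B) g + Q (B `\` A) g.
  rewrite -pvmU//; last by apply/seteqP; split=> x // [[? _] []].
  by congr Q; apply/seteqP; split=> x; have [] := pselect (A x) => /= *; tauto.
rewrite EA EB !(linD _ _ (linQ _))// proj_idem// ?pvm_disjoint ?addr0//;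
  by [exact: projQ|apply/seteqP; split=> x //= [] *; tauto].
Qed.

Lemma pvm_p A f : measurable A -> Q A (p f) = Q A f.
Proof. by move=> mA; rewrite -pvmT pvmI// setIT. Qed.

Lemma p_pvm A f : measurable A -> p (Q A f) = Q A f.
Proof. by move=> mA; rewrite -pvmT pvmI// setTI. Qed.

Lemma pvmC A f : measurable A -> Q (~` A) f = p f - Q A f.
Proof.
move=> mA; rewrite -pvmT -(setUv A) pvmU ?setICr//; last exact: measurableC.
by rewrite addrAC subrr add0r.
Qed.

Lemma diag_measureE f A : measurable A -> diag_measure Q f A = (hnorm (Q A f) ^+ 2)%:E.
Proof. by move=> mA; rewrite /diag_measure proj_dotff//; exact: projQ. Qed.

Lemma pvm_orthogonal_sum (F : nat -> set R) f n : (forall n, measurable (F n)) ->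
  trivIset setT F ->
  hnorm (\sum_(k < n) Q (F k) f) ^+ 2 = \sum_(k < n) hnorm (Q (F k) f) ^+ 2.
Proof.
move=> mF tF; elim: n => [|n IH]; first by rewrite !big_ord0 hnorm0 expr0n.
rewrite !big_ord_recr /= hnorm_sqrD IH; suff -> : <|\sum_(i < n) Q (F i) f, Q (F n) f|> = 0.
  by rewrite mulr0 addr0.
rewrite -proj_idem; last exact: projQ.
rewrite -proj_dot; last exact: projQ.
suff -> : Q (F n) (\sum_(i < n) Q (F i) f) = 0 by rewrite dot0l.
elim/big_ind: _ => [|x y hx hy|i _]; first exact/lin0/linQ.
  by rewrite linD ?hx ?hy ?addr0//; exact: linQ.
rewrite pvm_disjoint//; move/trivIsetP: tF; apply => //.
by rewrite neq_ltn ltn_ord orbT.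
Qed.

(** By orthogonality the partial sums of the |Q (F k) f|^2 are the squared norms of partial sums
    that converge strongly; this is countable additivity. *)
Lemma diag_measure_exists f : exists mu : {measure set R -> \bar R},
  forall A, measurable A -> diag_measure Q f A = mu A.
Proof.
pose m A := if `[< measurable A >] then (hnorm (Q A f) ^+ 2)%:E else 0%E.
have mE A : measurable A -> m A = (hnorm (Q A f) ^+ 2)%:E.
  by move=> mA; rewrite /m asboolT.
have m0 : m set0 = 0%E by rewrite mE// pvm0 hnorm0 expr0n.
have mge0 A : (0 <= m A)%E.
  by rewrite /m; case: ifPn => // _; rewrite lee_fin sqr_ge0.
have msigma : semi_sigma_additive m.
  move=> F mF tF mUF.
  have -> : (fun n => \sum_(0 <= i < n) m (F i))%E =
      EFin \o (fun n => hnorm (\sum_(k < n) Q (F k) f) ^+ 2).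
    apply/funext => n /=; rewrite pvm_orthogonal_sum// -sumEFin big_mkord.
    by apply: eq_bigr => i _; rewrite mE.
  rewrite mE//; apply: cvg_EFin; first by apply: nearW.
  have h := pvm_cvg f mF tF.
  set u := (fun n => \sum_(k < n) _) in h *; set l := Q _ _ in h *.
  rewrite /= (_ : _ \o _ = fun n => hnorm (u n) ^+ 2)//.
  rewrite expr2; under eq_fun do rewrite expr2.
  suff c : hnorm (u n) @[n --> \oo] --> hnorm l by exact: cvgM.
  apply/cvgrPdist_lt => e /h [N hN]; exists N => // n /= /hN.
  apply: le_lt_trans; rewrite ler_norml; apply/andP; split.
    by have := hnorm_leD (u n - l) l; rewrite subrK; lra.
  by have := hnorm_leD (l - u n) (u n); rewrite subrK (hnormBC l); lra.
pose mM := isMeasure.Build _ _ _ m m0 mge0 msigma.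
pose mu : {measure set R -> \bar R} := HB.pack m mM.
by exists mu => A mA; rewrite diag_measureE//= -mE.
Qed.

End ProjectionValuedMeasures.

(** * Operators given by the quadratic form of a spectral integral *)

Section SpectralIntegrals.
Context {R : realType} {H : hilbertType R}.
Implicit Types (f g h : H) (A B : set R) (phi psi : R -> R).

Definition nonneg_measurable phi : Prop :=
  measurable_fun setT phi /\ forall t, 0 <= phi t.

Lemma nonneg_measurableD phi psi : nonneg_measurable phi ->
  nonneg_measurable psi -> nonneg_measurable (fun t => phi t + psi t).
Proof.
by move=> [m1 p1] [m2 p2]; split=> [|t]; [exact: measurable_funD|exact: addr_ge0].
Qed.

Lemma nonneg_measurableM phi psi : nonneg_measurable phi ->
  nonneg_measurable psi -> nonneg_measurable (fun t => phi t * psi t).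
Proof.
by move=> [m1 p1] [m2 p2]; split=> [|t]; [exact: measurable_funM|exact: mulr_ge0].
Qed.

Lemma nonneg_measurable_sqr phi : nonneg_measurable phi ->
  nonneg_measurable (fun t => phi t ^+ 2).
Proof. by move=> n; exact: nonneg_measurableM. Qed.

Lemma nonneg_measurable_cst (r : R) : 0 <= r -> nonneg_measurable (fun=> r).
Proof. by move=> r0; split. Qed.

Lemma nonneg_measurable_indic A : measurable A -> nonneg_measurable \1_A.
Proof. by move=> mA; split=> // t; rewrite indicE. Qed.

Definition qint (Q : set R -> H -> H) f phi : \bar R :=
  (\int[diag_measure Q f]_t (phi t)%:E)%E.

Section OnePVM.
Variables (p : H -> H) (Q : set R -> H -> H).
Hypothesis pQ : projection_valued_measure p Q.

Let projQ A : measurable A -> projection (Q A).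
Proof. by have [h _ _] := pQ; exact: h. Qed.

Let linQ A : measurable A -> linear (Q A).
Proof. by move=> /projQ[]. Qed.

Let nmE phi : nonneg_measurable phi ->
  measurable_fun setT (EFin \o phi) /\ forall t, setT t -> (0 <= (phi t)%:E)%E.
Proof. by move=> [m0 p0]; split=> [|t _]; [exact/measurable_EFinP|rewrite lee_fin]. Qed.

Lemma qint_ge0 f phi : (forall t, 0 <= phi t) -> (0 <= qint Q f phi)%E.
Proof.
move=> p0; have [mu muE] := diag_measure_exists pQ f.
rewrite /qint (eq_measurable_integral _ muE); apply: integral_ge0 => t _.
by rewrite lee_fin.
Qed.

Lemma qintD f phi psi : nonneg_measurable phi -> nonneg_measurable psi ->
  qint Q f (fun t => phi t + psi t) = (qint Q f phi + qint Q f psi)%E.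
Proof.
move=> /nmE[m1 p1] /nmE[m2 p2]; have [mu muE] := diag_measure_exists pQ f.
by rewrite /qint !(eq_measurable_integral _ muE) -ge0_integralD.
Qed.

Lemma qintZ f (r : R) phi : 0 <= r -> nonneg_measurable phi ->
  qint Q f (fun t => r * phi t) = (r%:E * qint Q f phi)%E.
Proof.
move=> r0 /nmE[m1 p1]; have [mu muE] := diag_measure_exists pQ f.
by rewrite /qint !(eq_measurable_integral _ muE) -ge0_integralZl_EFin.
Qed.

Lemma qint_le f phi psi : nonneg_measurable phi -> nonneg_measurable psi ->
  (forall t, phi t <= psi t) -> (qint Q f phi <= qint Q f psi)%E.
Proof.
move=> /nmE[m1 p1] /nmE[m2 p2] le; have [mu muE] := diag_measure_exists pQ f.
rewrite /qint !(eq_measurable_integral _ muE); apply: ge0_le_integral => //.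
by move=> t _; rewrite lee_fin.
Qed.

Lemma qint_indic f A : measurable A ->
  qint Q f \1_A = (hnorm (Q A f) ^+ 2)%:E.
Proof.
move=> mA; have [mu muE] := diag_measure_exists pQ f.
by rewrite /qint !(eq_measurable_integral _ muE) integral_indic// setIT -muE// (diag_measureE pQ).
Qed.

Lemma qint_cst f (r : R) : 0 <= r -> qint Q f (fun=> r) = (r * hnorm (p f) ^+ 2)%:E.
Proof.
move=> r0; have -> : (fun=> r) = (fun t : R => r * \1_setT t).
  by apply/funext => t; rewrite indicT mulr1.
have n1 := nonneg_measurable_indic (@measurableT _ R).
by rewrite qintZ// qint_indic// (pvmT pQ).
Qed.

Lemma qint_null f phi psi A : measurable A -> Q A f = 0 ->
  nonneg_measurable phi -> nonneg_measurable psi ->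
  (forall t, ~ A t -> phi t = psi t) -> qint Q f phi = qint Q f psi.
Proof.
move=> mA QA /nmE[m1 p1] /nmE[m2 p2] e; have [mu muE] := diag_measure_exists pQ f.
have muA : mu A = 0%E by rewrite -muE// (diag_measureE pQ)// QA hnorm0 expr0n.
rewrite /qint !(eq_measurable_integral _ muE).
rewrite (ge0_negligible_integral mA _ m1 p1 muA)//.
rewrite (ge0_negligible_integral mA _ m2 p2 muA)//.
apply: eq_integral => t; rewrite inE => -[_ At]. by rewrite /= (e _ At).
Qed.

(** The measure of [Q A f] is that of [f] restricted to [A]: the complement of [A] is null for it,
    and on subsets of [A] the two measures agree. *)
Lemma qint_proj f phi A : measurable A -> nonneg_measurable phi ->
  qint Q (Q A f) phi = qint Q f (fun t => \1_A t * phi t).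
Proof.
move=> mA np; have n1 := nonneg_measurableM (nonneg_measurable_indic mA) np.
rewrite (@qint_null _ phi (fun t => \1_A t * phi t) (~` A))//; last 3 first.
- exact: measurableC.
- by rewrite (pvm_disjoint pQ)//; [exact: measurableC|rewrite setICl].
- by move=> t /= /contrapT At; rewrite indicE mem_set// mul1r.
have [mu muE] := diag_measure_exists pQ f.
have [mu' muE'] := diag_measure_exists pQ (Q A f).
rewrite /qint !(eq_measurable_integral _ muE) !(eq_measurable_integral _ muE').
have e : (fun t => (\1_A t * phi t)%:E) = (EFin \o phi) \_ A.
  apply/funext => t; rewrite indicE patchE /=.
  by case: (t \in A); rewrite ?mul1r ?mul0r.
rewrite e -!integral_mkcond; apply: eq_measure_integral => B mB BA.
rewrite -muE// -muE'// !(diag_measureE pQ)// (pvmI pQ)//.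
by rewrite setIidl.
Qed.

Lemma qint_unit f (k : R[i]) phi : cabs k = 1 -> qint Q (k *: f) phi = qint Q f phi.
Proof.
move=> k1; apply: eq_measurable_integral => A mA.
rewrite !(diag_measureE pQ)// linZ; last exact: linQ.
by rewrite hnormZ k1 mul1r.
Qed.

(** The measure is finite and phi <= 1 + phi^2. *)
Lemma qint_finite f phi : nonneg_measurable phi ->
  (qint Q f (fun t => (phi t ^+ 2)%R) < +oo)%E -> (qint Q f phi < +oo)%E.
Proof.
move=> np h; have ns := nonneg_measurable_sqr np.
have n1 := @nonneg_measurable_cst 1 ler01.
apply: (@le_lt_trans _ _ (qint Q f (fun t => 1 + phi t ^+ 2))).
  apply: qint_le => //; first exact: nonneg_measurableD.
  by move=> t; have := sqr_ge0 (phi t - 1); have := sqr_ge0 (phi t); rewrite sqrrB; lra.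
by rewrite qintD// qint_cst// lte_add_pinfty// ltry.
Qed.

Lemma qint_fineK f phi : (forall t, 0 <= phi t) -> (qint Q f phi < +oo)%E ->
  ((fine (qint Q f phi))%:E = qint Q f phi)%E.
Proof.
move=> p0 h; rewrite fineK// ge0_fin_numE//; exact: qint_ge0.
Qed.

Section OneOperator.
Variables (phi : R -> R) (c : operator H).
Hypothesis np : nonneg_measurable phi.
Hypothesis cI : spectral_integral p Q phi c.

Let lc : linear_operator c. Proof. by case: cI. Qed.
Let ns := nonneg_measurable_sqr np.

Lemma si_domE f : dom c f <-> p f = f /\ (qint Q f (fun t => (phi t ^+ 2)%R) < +oo)%E.
Proof. by have [_ h _ _] := cI; exact: h. Qed.

Lemma si_dom_p f : dom c f -> p f = f. Proof. by move=> /si_domE[]. Qed.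

Lemma si_p f : dom c f -> p (c f) = c f. Proof. by have [_ _ h _] := cI; exact: h. Qed.

Lemma si_finite f : dom c f -> (qint Q f phi < +oo)%E.
Proof. by move=> /si_domE[_ h]; exact: qint_finite. Qed.

Lemma si_form f : dom c f -> <|c f, f|> = (fine (qint Q f phi))%:C%C.
Proof. by have [_ _ _ h] := cI; exact: h. Qed.

Lemma si_domD f g : dom c f -> dom c g -> dom c (f + g) /\ c (f + g) = c f + c g.
Proof.
by move=> df dg; have [_ /(_ 1 _ _ df dg)] := lc; rewrite !scale1r.
Qed.

Lemma si_domZ k f : dom c f -> dom c (k *: f) /\ c (k *: f) = k *: c f.
Proof.
move=> df; have [d0 h] := lc; have [d00 c00] := h 0 _ _ d0 d0.
have c0 : c 0 = 0.
  have [_] := h 1 _ _ d0 d0; rewrite !scale1r addr0 -{1}[c 0]addr0.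
  by move=> /addrI.
by have := h k _ _ df d0; rewrite c0 !addr0.
Qed.

Lemma si_dom_proj f A : measurable A -> dom c f -> dom c (Q A f).
Proof.
move=> mA /si_domE[pf h]; apply/si_domE; split; first exact: (p_pvm pQ).
rewrite qint_proj//; apply: le_lt_trans h; apply: qint_le => //.
  by apply: nonneg_measurableM => //; exact: nonneg_measurable_indic.
move=> t; rewrite ler_piMl ?sqr_ge0// indicE; by case: (t \in A).
Qed.

Lemma si_dom_bounded f A (K : R) : measurable A -> (forall t, A t -> phi t <= K) ->
  dom c (Q A f).
Proof.
move=> mA hK; apply/si_domE; split; first exact: (p_pvm pQ).
rewrite qint_proj//; apply: (@le_lt_trans _ _ (qint Q f (fun=> K ^+ 2))).
  apply: qint_le.
  - by apply: nonneg_measurableM => //; exact: nonneg_measurable_indic.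
  - by apply: nonneg_measurable_cst; exact: sqr_ge0.
  move=> t; rewrite indicE; case: (boolP (t \in A)) => [/set_mem At|_].
    by rewrite mul1r ler_pXn2r ?nnegrE ?np.2 ?hK// (le_trans (np.2 t))// hK.
  by rewrite mul0r sqr_ge0.
by rewrite qint_cst ?sqr_ge0// ltry.
Qed.

(** On the slice where n <= phi < n + 1 the function is bounded, so the projection of z = v - w to
    it lies in the domain and is orthogonal to z, hence is 0. The slices exhaust the line and their
    projections sum to z. *)
Lemma si_dense v w : p v = v -> p w = w ->
  (forall g, dom c g -> <|v, g|> = <|w, g|>) -> v = w.
Proof.
move=> pv pw h; apply/eqP; rewrite -subr_eq0; apply/eqP.
have lp : linear p by rewrite -(pvmT pQ); exact: linQ.
set z := v - w; have pz : p z = z by rewrite /z (linB _ _ lp) pv pw.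
have hz g : dom c g -> <|z, g|> = 0 by move=> dg; rewrite dotBl h// subrr.
pose F (n : nat) := phi @^-1` [set x | n%:R <= x < n.+1%:R].
have FE n : F n = setT `&` phi @^-1` `[n%:R, n.+1%:R[%classic.
  by rewrite setTI; apply/seteqP; split=> x; rewrite /F /= in_itv.
have mF n : measurable (F n).
  by rewrite FE; apply: np.1 => //; exact: measurable_itv.
have tF : trivIset setT F.
  apply/trivIsetP => i j _ _ ij; apply/seteqP; split=> x //= [/andP[a1 a2] /andP[b1 b2]].
  have := le_lt_trans a1 b2; have := le_lt_trans b1 a2; rewrite !ltr_nat !ltnS => h1 h2.
  by move: ij; rewrite eqn_leq h1 h2.
have UF : \bigcup_n F n = setT.
  apply/seteqP; split=> // x _; exists (Num.truncn (phi x)) => //.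
  exact: truncn_itv (np.2 x).
have QF n : Q (F n) z = 0.
  have pF := projQ (mF n); apply: dotff_eq0.
  rewrite -(proj_dot _ _ pF) (proj_idem _ pF) (proj_dot _ _ pF).
  apply: hz; apply: (@si_dom_bounded _ _ n.+1%:R) => // t /andP[_ /ltW//].
apply: (hcvg_unique (u := fun n => \sum_(k < n) Q (F k) z)).
  by have := pvm_cvg pQ z mF tF; rewrite UF (pvmT pQ) pz.
move=> e e0; exists 0%N => n _; rewrite big1// ?subrr ?hnorm0// => i _.
Qed.

(** For |k| = 1 the integral of phi for f + k g splits over [A] and its complement, so the cross
    terms of the quadratic form cancel; k = 1 and k = i separate them. *)
Lemma si_orthogonal f g A : measurable A -> dom c f -> dom c g ->
  Q A f = f -> Q A g = 0 -> <|c f, g|> = 0.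
Proof.
move=> mA df dg Af Ag; have mA' := measurableC mA.
have Q' k : Q (~` A) (f + k *: g) = k *: g.
  rewrite (linD _ _ (linQ mA')) (linZ _ _ (linQ mA')) !(pvmC pQ)// Ag Af.
  by rewrite !si_dom_p// subrr add0r subr0.
have QA k : Q A (f + k *: g) = f.
  by rewrite (linD _ _ (linQ mA)) (linZ _ _ (linQ mA)) Ag Af scaler0 addr0.
have e k : cabs k = 1 -> Num.conj k * <|c f, g|> + k * <|c g, f|> = 0.
  move=> k1; have [dk ck] := si_domZ k dg; have [dfk cfk] := si_domD df dk.
  have qE : qint Q (f + k *: g) phi = (qint Q f phi + qint Q g phi)%E.
    have q1 := qint_proj (f + k *: g) mA np; rewrite QA in q1.
    have q2 := qint_proj (f + k *: g) mA' np; rewrite Q' in q2.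
    rewrite -(qint_unit g phi k1) q1 q2 -qintD; first last.
    - by apply: nonneg_measurableM => //; exact: nonneg_measurable_indic.
    - by apply: nonneg_measurableM => //; exact: nonneg_measurable_indic.
    congr qint; apply/funext => t; rewrite -mulrDl !indicE in_setC.
    by case: (t \in A); rewrite /= ?addr0 ?add0r mul1r.
  have := si_form dfk; rewrite qE cfk ck !dotDl !dotDr !dotZl !dotZr.
  rewrite fineD ?ge0_fin_numE ?qint_ge0 ?si_finite//; try exact: np.2.
  rewrite rmorphD /= -!si_form// => h.
  have kk : k * Num.conj k = 1 by rewrite -cabs_sqr k1 expr1n.
  rewrite mulrA kk mul1r in h.
  have -> : Num.conj k * <|c f, g|> + k * <|c g, f|> =
    <|c f, f|> + Num.conj k * <|c f, g|> + (k * <|c g, f|> + <|c g, g|>) -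
    (<|c f, f|> + <|c g, g|>) by ring.
  by rewrite h subrr.
have h1 := e 1 cabs1; rewrite rmorph1 !mul1r in h1.
have i1 : cabs 'i%C = 1 :> R.
  by rewrite /cabs normc_def /= expr0n expr1n /= add0r sqrtr1.
have := e 'i%C i1; have -> : Num.conj 'i%C = - 'i%C :> R[i] by rewrite conjCi.
rewrite mulNr addrC -mulrBr => /eqP; rewrite mulf_eq0 eq_complex /= oner_eq0 andbF /=.
rewrite subr_eq0 => /eqP h2; move: h1; rewrite h2 -mulr2n => /eqP.
by rewrite mulrn_eq0 => /eqP.
Qed.

(** Tested against a vector g of the domain, both sides reduce to <c (Q A f), Q A g>, the mixed
    terms vanishing by [si_orthogonal]; [si_dense] concludes. *)
Lemma si_comm f A : measurable A -> dom c f -> c (Q A f) = Q A (c f).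
Proof.
move=> mA df; have dA g : dom c g -> dom c (Q A g) by exact: si_dom_proj.
have dB g : dom c g -> dom c (g - Q A g).
  by move=> dg; rewrite -scaleN1r; exact: (si_domD dg (si_domZ (-1) (dA _ dg)).1).1.
have AA g : Q A (Q A g) = Q A g by rewrite (proj_idem _ (projQ mA)).
have AB g : Q A (g - Q A g) = 0 by rewrite (linB _ _ (linQ mA)) AA subrr.
have A'A g : Q (~` A) (Q A g) = 0.
  by rewrite (pvmC pQ)// AA (p_pvm pQ)// subrr.
have A'B g : dom c g -> Q (~` A) (g - Q A g) = g - Q A g.
  by move=> dg; rewrite (pvmC pQ)// AB subr0 si_dom_p//; exact: dB.
have split g : g = Q A g + (g - Q A g) by rewrite addrC subrK.
apply: si_dense => [||g dg].
- by rewrite si_p//; exact: dA.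
- exact: (p_pvm pQ).
rewrite (proj_dot _ _ (projQ mA)).
rewrite {1}(split g) dotDr (si_orthogonal mA (dA _ df) (dB _ dg) (AA f) (AB g)) addr0.
have [_ h] := si_domD (dA _ df) (dB _ df).
rewrite -split in h; rewrite h dotDl.
rewrite (si_orthogonal (measurableC mA) (dB _ df) (dA _ dg) (A'B _ df) (A'A g)).
by rewrite addr0.
Qed.

Lemma si_proj_form f A : measurable A -> dom c f ->
  <|Q A (c f), f|> = (fine (qint Q f (fun t => \1_A t * phi t)))%:C%C.
Proof.
move=> mA df; rewrite -[in LHS](proj_idem (c f) (projQ mA)) proj_dot; last exact: projQ.
by rewrite -si_comm// si_form ?qint_proj//; exact: si_dom_proj.
Qed.

End OneOperator.

Lemma form_polarization (D : set H) (F G : H -> H) :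
  linear_subspace D ->
  (forall k f g, D f -> D g -> F (k *: f + g) = k *: F f + F g) ->
  (forall k f g, D f -> D g -> G (k *: f + g) = k *: G f + G g) ->
  (forall f, D f -> <|F f, f|> = <|G f, f|>) ->
  forall f g, D f -> D g -> <|F f, g|> = <|G f, g|>.
Proof.
move=> lD lF lG FG f g Df Dg.
have e k : Num.conj k * (<|F f, g|> - <|G f, g|>) + k * (<|F g, f|> - <|G g, f|>) = 0.
  have := FG (k *: g + f) (lD.2 _ _ _ Dg Df).
  rewrite lF// lG// !dotDl !dotDr !dotZl !dotZr (FG f)// (FG g)// => h.
  by move/eqP: h; rewrite -subr_eq0 => /eqP h; rewrite -[RHS]h; ring.
have h1 := e 1; rewrite rmorph1 !mul1r in h1.
have := e 'i%C; have -> : Num.conj 'i%C = - 'i%C :> R[i] by rewrite conjCi.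
rewrite mulNr addrC -mulrBr => /eqP; rewrite mulf_eq0 eq_complex /= oner_eq0 andbF /=.
rewrite subr_eq0 => /eqP h2; move: h1; rewrite h2 -mulr2n => /eqP.
by rewrite mulrn_eq0 /= subr_eq0 => /eqP.
Qed.

End OnePVM.
End SpectralIntegrals.

(** * Uniqueness of the spectral measure *)

Section Uniqueness.
Context {R : realType} {H : hilbertType R}.
Implicit Types (f g h : H) (A B S : set R) (phi psi : R -> R) (b c : operator H).

(** A spectral measure of b integrates the signed function [id]; the parts of [id] bring it under
    the results for nonnegative functions. *)
Definition posp (t : R) : R := Num.max t 0.
Definition negp (t : R) : R := Num.max (- t) 0.

Lemma nonneg_measurable_posp : nonneg_measurable posp.
Proof.
split=> [|t]; last by rewrite /posp le_max lexx orbT.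
exact: (measurable_maxr (f := id) (g := fun=> 0)).
Qed.

Lemma nonneg_measurable_negp : nonneg_measurable negp.
Proof.
split=> [|t]; last by rewrite /negp le_max lexx orbT.
apply: (measurable_maxr (f := fun t : R => - t) (g := fun=> 0)) => //.
exact: oppr_measurable.
Qed.

Lemma pvm_restr (p : H -> H) (Q : set R -> H -> H) S : measurable S ->
  projection_valued_measure p Q ->
  projection_valued_measure (Q S) (fun A => Q (S `&` A)).
Proof.
move=> mS [pQ QT Qs]; split=> [A mA||F mF tF f].
- by apply: pQ; exact: measurableI.
- by rewrite setIT.
- have -> : S `&` \bigcup_n F n = \bigcup_n (S `&` F n) by rewrite setI_bigcupr.
  apply: Qs => [n|]; first exact: measurableI.
  by apply/trivIsetP => i j _ _ ij; rewrite setIACA; move/trivIsetP: tF => ->; rewrite ?setI0.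
Qed.

Lemma pvm_push (p : H -> H) (Q : set R -> H -> H) phi :
  measurable_fun setT phi -> projection_valued_measure p Q ->
  projection_valued_measure p (fun A => Q (phi @^-1` A)).
Proof.
move=> mphi [pQ QT Qs].
have m A : measurable A -> measurable (phi @^-1` A).
  by move=> mA; rewrite -[_ @^-1` _]setTI; exact: mphi.
split=> [A mA||F mF tF f]; first by apply: pQ; exact: m.
  by rewrite preimage_setT.
rewrite preimage_bigcup; apply: Qs => [n|]; first exact: m.
apply/trivIsetP => i j _ _ ij; rewrite -preimage_setI.
by move/trivIsetP: tF => /(_ i j I I ij) ->; rewrite preimage_set0.
Qed.

Lemma qint_restr (p : H -> H) (Q : set R -> H -> H) S phi f : measurable S ->
  projection_valued_measure p Q -> Q S f = f ->
  qint (fun A => Q (S `&` A)) f phi = qint Q f phi.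
Proof.
move=> mS pQ Sf; apply: eq_measurable_integral => A mA.
by rewrite /diag_measure setIC -(pvmI pQ)// Sf.
Qed.

Lemma qint_push (p : H -> H) (Q : set R -> H -> H) psi phi f :
  measurable_fun setT psi -> projection_valued_measure p Q ->
  nonneg_measurable phi ->
  qint (fun A => Q (psi @^-1` A)) f phi = qint Q f (phi \o psi).
Proof.
move=> mpsi pQ [mphi phi0].
have m A : measurable A -> measurable (psi @^-1` A).
  by move=> mA; rewrite -[_ @^-1` _]setTI; exact: mpsi.
have [mu muE] := diag_measure_exists pQ f.
rewrite /qint (@eq_measurable_integral _ _ (pushforward mu psi)); last first.
  by move=> A mA; rewrite /pushforward -muE//; exact: m.
rewrite (eq_measurable_integral _ muE) ge0_integral_pushforward//.
  exact/measurable_EFinP.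
by move=> t _; rewrite lee_fin.
Qed.

Lemma qint_id (p : H -> H) (Q : set R -> H -> H) f :
  projection_valued_measure p Q ->
  qint Q f id = (qint Q f posp - qint Q f negp)%E.
Proof.
move=> pQ; have [mu muE] := diag_measure_exists pQ f.
rewrite /qint !(eq_measurable_integral _ muE) integralE.
congr (_ - _)%E; apply: eq_integral => t _.
  by rewrite funeposE /posp EFin_max.
by rewrite funenegE /negp EFin_max.
Qed.

Section Positivity.
Variables (p : H -> H) (Q : set R -> H -> H) (b : operator H).
Hypothesis sb : spectral_measure p b Q.
Hypothesis pb : positive_operator b.

Let pQ : projection_valued_measure p Q. Proof. by case: sb. Qed.
Let bI : spectral_integral p Q id b. Proof. by case: sb. Qed.
Let np := nonneg_measurable_posp.
Let nn := nonneg_measurable_negp.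

Lemma pvm_null_bigcup (F : nat -> set R) f : (forall n, measurable (F n)) ->
  (forall n, Q (F n) f = 0) -> Q (\bigcup_n F n) f = 0.
Proof.
move=> mF QF; have [mu muE] := diag_measure_exists pQ f.
have mU : measurable (\bigcup_n F n) by exact: bigcupT_measurable.
have : mu (\bigcup_n F n) = 0%E.
  apply: measure_negligible => //; apply: negligible_bigcup => n.
  have e : mu (F n) = 0%E by rewrite -muE// (diag_measureE pQ)// QF hnorm0 expr0n.
  exact/negligibleP.
rewrite -muE// (diag_measureE pQ)// => -[/eqP]; rewrite sqrf_eq0 => /eqP.
exact: hnorm_eq0.
Qed.

(** For g in the range, <b g, g> <= - e |g|^2, which contradicts positivity unless g = 0. The bound
    m puts g into the domain and keeps the integral of the negative part finite. *)
Lemma spectral_neg_itv f (m e : R) : 0 < e -> e <= m -> Q `[- m, - e] f = 0.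
Proof.
move=> e0 em; set A := `[- m, - e]%classic; have mA : measurable A by exact: measurable_itv.
set g := Q A f; have Ag : Q A g = g by rewrite (pvmI pQ)// setIid.
have ns : nonneg_measurable (fun t : R => id t ^+ 2).
  by split=> [|t]; [exact: measurable_funX|exact: sqr_ge0].
have qA psi : nonneg_measurable psi ->
    qint Q g psi = qint Q g (fun t => \1_A t * psi t).
  by move=> npsi; rewrite -{1}Ag (qint_proj pQ).
have nA psi : nonneg_measurable psi -> nonneg_measurable (fun t => \1_A t * psi t).
  by move=> npsi; apply: nonneg_measurableM => //; exact: nonneg_measurable_indic.
have AP t : A t -> - m <= t <= - e by rewrite /A /= in_itv.
have dg : dom b g.
  have [_ h _ _] := bI; apply/h; split; first by rewrite /g (p_pvm pQ).
  rewrite -/(qint Q g (fun t => id t ^+ 2)) qA//.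
  apply: (@le_lt_trans _ _ (qint Q g (fun=> m ^+ 2))).
    apply: (qint_le pQ); [exact: nA|by apply: nonneg_measurable_cst; exact: sqr_ge0|].
    move=> t; rewrite indicE; case: (boolP (t \in A)) => [/set_mem /AP/andP[t1 t2]|_].
      rewrite mul1r -[m ^+ 2]sqrrN; rewrite -sqrrN -[leRHS]sqrrN opprK ler_pXn2r ?nnegrE//; lra.
    by rewrite mul0r sqr_ge0.
  by rewrite (qint_cst pQ) ?sqr_ge0// ltry.
have q1 : qint Q g posp = 0%E.
  rewrite qA//; have -> : (fun t => \1_A t * posp t) = fun=> 0.
    apply/funext => t; rewrite indicE; case: (boolP (t \in A)) => [/set_mem /AP/andP[t1 t2]|_].
      by rewrite /posp max_r ?mulr0//; lra.
    by rewrite mul0r.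
  by rewrite (qint_cst pQ)// mul0r.
have q2 : (qint Q g negp <= (m * hnorm (p g) ^+ 2)%:E)%E.
  rewrite qA// -(qint_cst pQ); last lra.
  apply: (qint_le pQ); [exact: nA|by apply: nonneg_measurable_cst; lra|].
  move=> t; rewrite indicE; case: (boolP (t \in A)) => [/set_mem /AP/andP[t1 t2]|_].
    by rewrite mul1r /negp ge_max; apply/andP; split; lra.
  by rewrite mul0r; lra.
have q3 : ((e * hnorm g ^+ 2)%:E <= qint Q g negp)%E.
  have -> : (e * hnorm g ^+ 2)%:E = qint Q g (fun t => e * \1_A t).
    rewrite (qintZ pQ _ (ltW e0) (nonneg_measurable_indic mA)).
    by rewrite (qint_indic pQ)// Ag EFinM.
  rewrite [leRHS]qA//; apply: (qint_le pQ); last 1 first.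
  - move=> t; rewrite indicE; case: (boolP (t \in A)) => [/set_mem /AP/andP[t1 t2]|_].
      by rewrite mulr1 mul1r /negp le_max; apply/orP; left; lra.
    by rewrite mulr0 mul0r.
  - apply: nonneg_measurableM; [exact/nonneg_measurable_cst/ltW|].
    exact: nonneg_measurable_indic.
  - exact: nA.
have q2' : (qint Q g negp < +oo)%E by apply: le_lt_trans q2 _; rewrite ltry.
have [_ _ _ h] := bI; have := pb dg.
rewrite h// -/(qint Q g id) (qint_id g pQ) q1 add0e fineN ler0c oppr_ge0 => h1.
move: q3; rewrite -(qint_fineK pQ nn.2 q2') lee_fin => h2.
apply: hnorm_eq0; apply/eqP; rewrite -sqrf_eq0 eq_le sqr_ge0 andbT.
by rewrite -(pmulr_rle0 _ e0); lra.
Qed.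

Lemma spectral_neg f : Q `]-oo, 0[ f = 0.
Proof.
pose F (n : nat) := `[- (n.+1%:R : R), - (n.+1%:R^-1)]%classic.
have -> : `]-oo, 0[%classic = \bigcup_n F n.
  apply/seteqP; split=> t; rewrite /= in_itv /=.
    move=> t0; pose n := maxn (Num.truncn (- t)) (Num.truncn (- t)^-1).
    have nt : 0 < - t by lra.
    have nt' : 0 < (- t)^-1 by rewrite invr_gt0.
    have /andP[_ h1] := truncn_itv (ltW nt); have /andP[_ h2] := truncn_itv (ltW nt').
    exists n => //; rewrite /F /= in_itv /=; apply/andP; split.
      rewrite lerNl; apply: le_trans (ltW h1) _; rewrite ler_nat ltnS; exact: leq_maxl.
    rewrite lerNr -[leRHS]invrK lef_pV2 ?posrE ?ltr0Sn//.
    by apply: le_trans (ltW h2) _; rewrite ler_nat ltnS; exact: leq_maxr.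
  move=> [n _]; rewrite /F /= in_itv /= => /andP[_ h]; apply: le_lt_trans h _.
  by rewrite oppr_lt0 invr_gt0 ltr0Sn.
apply: pvm_null_bigcup => n; first exact: measurable_itv.
apply: spectral_neg_itv; first by rewrite invr_gt0 ltr0Sn.
by rewrite (@le_trans _ _ 1)// ?invf_le1 ?ltr0Sn// ler1n.
Qed.

(** The negative half-line is null, so b is the integral of a nonnegative function and the theory
    above applies to it. *)
Lemma spectral_integral_posp : spectral_integral p Q posp b.
Proof.
have [lb db bp bf] := bI.
have mN : measurable (`]-oo, 0[%classic : set R) by exact: measurable_itv.
have off (t : R) : ~ `]-oo, 0[%classic t -> 0 <= t.
  by rewrite /= in_itv /= => /negP; rewrite -leNgt.
have ns : nonneg_measurable (fun t : R => id t ^+ 2).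
  by split=> [|t]; [exact: measurable_funX|exact: sqr_ge0].
split=> // f.
  have e : qint Q f (fun t => id t ^+ 2) = qint Q f (fun t => posp t ^+ 2).
    apply: (qint_null pQ mN (spectral_neg f)) => //; first exact: nonneg_measurable_sqr.
    by move=> t /off t0; rewrite /posp max_l.
  rewrite db; split=> -[pf h]; split=> //.
    exact: (eq_ind _ (fun x => (x < +oo)%E) h _ e).
  exact: (eq_ind _ (fun x => (x < +oo)%E) h _ (esym e)).
move=> df; rewrite bf// -/(qint Q f id) (qint_id f pQ).
rewrite -/(qint Q f posp) (_ : qint Q f negp = 0%E) ?sube0//.
rewrite (qint_null pQ mN (spectral_neg f) nn (nonneg_measurable_cst (lexx 0))).
  by rewrite (qint_cst pQ)// mul0r.
by move=> t /off t0; rewrite /negp max_r// oppr_le0.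
Qed.

End Positivity.
End Uniqueness.

Section SpectralUniqueness.
Context {R : realType} {H : hilbertType R}.
Implicit Types (f g h : H) (A B S : set R) (phi psi : R -> R) (b c : operator H).

Section Bounds.
Variables (p : H -> H) (Q : set R -> H -> H) (phi : R -> R) (c : operator H).
Hypothesis pQ : projection_valued_measure p Q.
Hypothesis np : nonneg_measurable phi.
Hypothesis cI : spectral_integral p Q phi c.

Lemma si_sym f g : dom c f -> dom c g -> <|c f, g|> = <|f, c g|>.
Proof.
move=> df dg; rewrite [RHS]dotC.
have aux (k x y : R[i]) (r1 r2 r3 s : R) :
    r1%:C%C + Num.conj k * x + (k * y + s%:C%C * r2%:C%C) = r3%:C%C ->
    complex.Im (Num.conj k * x + k * y) = 0.
  move=> /(congr1 (@complex.Im R)); case: x y k => [a1 a2] [b1 b2] [k1 k2] /=.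
  by rewrite !(mul0r, addr0, add0r, mulr0); lra.
have e k : complex.Im (Num.conj k * <|c f, g|> + k * <|c g, f|>) = 0.
  have [dk ck] := si_domZ cI k dg; have [dfk cfk] := si_domD cI df dk.
  have := si_form cI dfk; rewrite cfk ck !dotDl !dotDr !dotZl !dotZr.
  rewrite (si_form cI df) (si_form cI dg) mulrA -cabs_sqr.
  exact: aux.
have := e 1; have := e 'i%C; case: (<|c f, g|>) (<|c g, f|>) => [a1 a2] [b1 b2] /=.
by move=> h1 h2; congr Complex; move: h1 h2; rewrite ?(mul0r, mul1r, oppr0, mulN1r); lra.
Qed.

Lemma si_form_le f A (l : R) : measurable A -> dom c f -> Q A f = f -> 0 <= l ->
  (forall t, A t -> phi t <= l) -> complex.Re <|c f, f|> <= l * hnorm f ^+ 2.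
Proof.
move=> mA df Af l0 hl; rewrite (si_form cI df) /= -lee_fin.
rewrite (qint_fineK pQ np.2 (si_finite pQ np cI df)).
have nA : nonneg_measurable (fun t => \1_A t * phi t).
  by apply: nonneg_measurableM => //; exact: nonneg_measurable_indic.
rewrite -{1}Af (qint_proj pQ)// -{2}(si_dom_p cI df) -(qint_cst pQ)//.
apply: (qint_le pQ _ nA (nonneg_measurable_cst l0)).
move=> t; rewrite indicE; case: (boolP (t \in A)) => [/set_mem /hl|_].
  by rewrite mul1r.
by rewrite mul0r.
Qed.

Lemma si_form_ge f A (l : R) : measurable A -> dom c f -> Q A f = f -> 0 <= l ->
  (forall t, A t -> l <= phi t) -> l * hnorm f ^+ 2 <= complex.Re <|c f, f|>.
Proof.
move=> mA df Af l0 hl; rewrite (si_form cI df) /= -lee_fin.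
rewrite (qint_fineK pQ np.2 (si_finite pQ np cI df)).
have nA := nonneg_measurable_indic mA.
rewrite -{1}Af EFinM -(qint_indic pQ)// -(qintZ pQ)//.
apply: (qint_le pQ _ (nonneg_measurableM (nonneg_measurable_cst l0) nA)) => //.
move=> t; rewrite indicE; case: (boolP (t \in A)) => [/set_mem /hl|_].
  by rewrite mulr1.
by rewrite mulr0 np.2.
Qed.

Lemma si_form_ge0 f : dom c f -> 0 <= complex.Re <|c f, f|>.
Proof.
by move=> df; rewrite (si_form cI df) /= fine_ge0// (qint_ge0 pQ)//; exact: np.2.
Qed.

(** The norm bound is drawn from bounds on the form alone. With g = c f, positivity at f - g / l
    together with <c g, g> <= l |g|^2 gives |g|^2 <= l <g, f>, and Cauchy-Schwarz finishes. *)
Lemma si_norm_le f A (l : R) : measurable A -> p f = f -> Q A f = f -> 0 < l ->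
  (forall t, A t -> phi t <= l) -> dom c f /\ hnorm (c f) <= l * hnorm f.
Proof.
move=> mA pf Af l0 hl.
have dA g : Q A g = g -> dom c g.
  by move=> <-; exact: (si_dom_bounded pQ np cI g mA hl).
have df := dA _ Af; split=> //.
have Acf : Q A (c f) = c f by rewrite -(si_comm pQ np cI mA df) Af.
have dcf := dA _ Acf.
set g := c f in Acf dcf *.
have h1 := si_form_le mA df Af (ltW l0) hl.
have h2 := si_form_le mA dcf Acf (ltW l0) hl.
pose k : R[i] := (- l^-1)%:C%C.
have [dk ck] := si_domZ cI k dcf; have [dfk cfk] := si_domD cI df dk.
have := si_form_ge0 dfk; rewrite cfk ck !dotDl !dotDr !dotZl !dotZr -/g.
have kJ : Num.conj k = k by exact: conjc_real.
rewrite kJ (si_sym dcf df) -/g dotff !cReD !cReM /= => h3.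
have {}h3 : hnorm g ^+ 2 <= l * complex.Re <|g, f|>.
  have : 0 <= l ^+ 2 * (complex.Re <|g, f|> + - l^-1 * hnorm g ^+ 2 +
     (- l^-1 * hnorm g ^+ 2 + - l^-1 * (- l^-1 * complex.Re <|c g, g|>))).
    by rewrite mulr_ge0 ?sqr_ge0.
  have -> : l ^+ 2 * (complex.Re <|g, f|> + - l^-1 * hnorm g ^+ 2 +
     (- l^-1 * hnorm g ^+ 2 + - l^-1 * (- l^-1 * complex.Re <|c g, g|>))) =
     l ^+ 2 * complex.Re <|g, f|> - 2 * l * hnorm g ^+ 2 + complex.Re <|c g, g|>.
    by field; rewrite gt_eqF.
  move=> h4; rewrite -(ler_pM2l l0); lra.
have l0' := ltW l0.
rewrite -(@ler_pXn2r _ 2)// ?nnegrE ?hnorm_ge0 ?mulr_ge0 ?hnorm_ge0//.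
apply: le_trans h3 _; rewrite exprMn expr2 -mulrA; apply: ler_wpM2l => //.
Qed.

Lemma si_norm_ge f A (l : R) : measurable A -> dom c f -> Q A f = f -> 0 <= l ->
  (forall t, A t -> l <= phi t) -> l * hnorm f <= hnorm (c f).
Proof.
move=> mA df Af l0 hl.
have h := le_trans (si_form_ge mA df Af l0 hl) (Cauchy_Schwarz_Re _ _).
have [f0|f0] := eqVneq (hnorm f) 0; first by rewrite f0 mulr0 hnorm_ge0.
have fp : 0 < hnorm f by rewrite lt_neqAle eq_sym f0 hnorm_ge0.
by move: h; rewrite expr2 mulrA ler_pM2r.
Qed.

End Bounds.

(** The sequence [s] records that every b^n f is defined. No spectral measure is mentioned, which is
    what makes uniqueness possible; asking for every m > l, and not m = l, covers l = 0, where
    [si_norm_le] needs a positive bound. *)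
Definition orbit_growth b (l : R) f : Prop :=
  exists s : nat -> H, [/\ s 0%N = f, forall n, dom b (s n) /\ s n.+1 = b (s n) &
    forall m, l < m -> exists C : R, forall n, hnorm (s n) <= C * m ^+ n].

Lemma spectral_subspaceP (p : H -> H) (Q : set R -> H -> H) b (l : R) f :
  spectral_measure p b Q -> positive_operator b -> 0 <= l ->
  Q `]-oo, l]%classic f = f <-> p f = f /\ orbit_growth b l f.
Proof.
move=> sb pb l0; have [pQ _] := sb; have bI := spectral_integral_posp sb pb.
have np := @nonneg_measurable_posp R.
have mA (x : R) : measurable `]-oo, x]%classic by exact: measurable_itv.
have mA' (x : R) : measurable `]x, +oo[%classic by exact: measurable_itv.
split=> [Af|[pf [s [s0 hs gs]]]].
  have hl (m : R) : l < m -> 0 < m /\ forall t, `]-oo, l]%classic t -> posp t <= m.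
    move=> lm; split=> [|t]; first lra.
    by rewrite /= in_itv /= => tl; rewrite /posp ge_max; apply/andP; split; lra.
  have [l1 hl1] : 0 < l + 1 /\ forall t, `]-oo, l]%classic t -> posp t <= l + 1.
    by apply: hl; lra.
  have pAE g : Q `]-oo, l]%classic g = g -> p g = g by move=> <-; exact: (p_pvm pQ).
  pose s n := iter n b f.
  have sE n : Q `]-oo, l]%classic (s n) = s n.
    elim: n => [//|n IH]; have [d _] := si_norm_le pQ np bI (mA l) (pAE _ IH) IH l1 hl1.
    by rewrite /s /= -/(s n) -(si_comm pQ np bI (mA l) d) IH.
  split; first exact: pAE.
  exists s; split=> // [n|m lm].
    by have [d _] := si_norm_le pQ np bI (mA l) (pAE _ (sE n)) (sE n) l1 hl1.
  have [m0 hm] := hl m lm; exists (hnorm f) => n.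
  elim: n => [|n IH]; first by rewrite expr0 mulr1.
  have [_ h] := si_norm_le pQ np bI (mA l) (pAE _ (sE n)) (sE n) m0 hm.
  apply: le_trans h _; rewrite exprS mulrCA; apply: ler_wpM2l => //; exact: ltW.
have null (m : R) : l < m -> Q `]m, +oo[%classic f = 0.
  (* The part of [f] beyond m is stretched by at least m at each step, while the orbit grows at most
     like m'^n; the ratio (m' / m)^n tends to 0. *)
  move=> lm; pose m' := (l + m) / 2.
  have lm' : l < m' by rewrite /m'; lra.
  have m'0 : 0 < m' by lra.
  have m'm : m' < m by rewrite /m'; lra.
  have [C hC] := gs _ lm'.
  pose e n := Q `]m, +oo[%classic (s n).
  have de n : dom b (e n).
    by apply: (si_dom_proj pQ np bI); [exact: mA'|exact: (hs n).1].
  have Ee n : Q `]m, +oo[%classic (e n) = e n by rewrite (pvmI pQ)// setIid.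
  have eS n : e n.+1 = b (e n).
    by rewrite /e (hs n).2 (si_comm pQ np bI (mA' m) (hs n).1).
  have ge n : m ^+ n * hnorm (e 0%N) <= hnorm (e n).
    elim: n => [|n IH]; first by rewrite expr0 mul1r.
    rewrite eS; apply: (@le_trans _ _ (m * hnorm (e n))).
      rewrite exprS -mulrA; apply: ler_wpM2l => //; lra.
    apply: (si_norm_ge pQ np bI (mA' m) (de n) (Ee n)); first lra.
    by move=> t; rewrite /= in_itv /= andbT => mt; rewrite /posp le_max ltW.
  have m0 : 0 < m by lra.
  have le n : hnorm (e 0%N) <= C * (m' / m) ^+ n.
    rewrite expr_div_n mulrA ler_pdivlMr ?exprn_gt0// mulrC.
    apply: le_trans (ge n) _; apply: le_trans (hC n).
    by apply: hnorm_proj; have [h _ _] := pQ; exact: h.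
  rewrite -s0 -/(e 0%N); apply: hnorm_eq0; apply/eqP; rewrite eq_le hnorm_ge0 andbT.
  apply/ler_addgt0Pr => r r0; rewrite add0r.
  have : C * (m' / m) ^+ n @[n --> \oo] --> (0 : R).
    rewrite -[X in _ --> X](mulr0 C); apply: cvgMr; apply: cvg_expr.
    have h0 : 0 <= m' / m by rewrite divr_ge0//; lra.
    by rewrite ger0_norm// ltr_pdivrMr// mul1r.
  move=> /cvgrPdist_lt /(_ _ r0) [N _ /(_ N (leqnn _))].
  rewrite sub0r normrN => /ltW h; apply: le_trans (le N) _.
  exact: le_trans (ler_norm _) h.
have nl : Q `]l, +oo[%classic f = 0.
  have -> : `]l, +oo[%classic = \bigcup_n `]l + n.+1%:R^-1, +oo[%classic.
    apply/seteqP; split=> t /=; rewrite in_itv /= andbT.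
      move=> lt; exists (Num.truncn (t - l)^-1) => //; rewrite /= in_itv /= andbT.
      have tl : 0 < (t - l)^-1 by rewrite invr_gt0; lra.
      have /andP[_ h] := truncn_itv (ltW tl).
      rewrite -ltrBrDl -[ltRHS]invrK ltf_pV2 ?posrE ?ltr0Sn//.
    by move=> [n _]; rewrite /= in_itv /= andbT; apply: le_lt_trans; rewrite lerDl.
  apply: (pvm_null_bigcup sb) => n; first exact: mA'.
  by apply: null; rewrite ltrDl invr_gt0 ltr0Sn.
have -> : `]-oo, l]%classic = ~` `]l, +oo[%classic.
  by apply/seteqP; split=> t /=; rewrite !in_itv /= andbT leNgt => /negP.
by rewrite (pvmC pQ)// nl subr0.
Qed.

(** On half-lines with a nonnegative end the ranges agree by the orbit criterion; negative
    half-lines are null for both. The diagonal measures then agree on a generating class stable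
    under intersection, and polarization returns to the projections. *)
Lemma spectral_measure_unique (p : H -> H) (Q Q' : set R -> H -> H) b :
  spectral_measure p b Q -> spectral_measure p b Q' -> positive_operator b ->
  forall A, measurable A -> Q A = Q' A.
Proof.
move=> sb sb' pb; have [pQ bI] := sb; have [pQ' _] := sb'.
have mA (x : R) : measurable `]-oo, x]%classic by exact: measurable_itv.
have projQ A : measurable A -> projection (Q A) by have [h _ _] := pQ; exact: h.
have projQ' A : measurable A -> projection (Q' A) by have [h _ _] := pQ'; exact: h.
have eqle (x : R) : Q `]-oo, x]%classic = Q' `]-oo, x]%classic.
  have [x0|x0] := leP 0 x.
    apply: proj_eq => [||f|f]; [exact: projQ|exact: projQ'| |].
      by rewrite (spectral_subspaceP f sb pb x0) (spectral_subspaceP f sb' pb x0).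
    by rewrite (spectral_subspaceP f sb pb x0) (spectral_subspaceP f sb' pb x0).
  have sub : `]-oo, x]%classic = `]-oo, x] `&` `]-oo, (0 : R)[%classic.
    by rewrite setIidl// => t /=; rewrite !in_itv /=; lra.
  apply/funext => f; rewrite sub -(pvmI pQ)// -(pvmI pQ')//.
  rewrite (spectral_neg sb pb) (spectral_neg sb' pb).
  by rewrite !lin0//; [have [] := projQ' _ (mA x)|have [] := projQ _ (mA x)].
have eqgt (x : R) f : Q `]x, +oo[%classic f = Q' `]x, +oo[%classic f.
  have -> : `]x, +oo[%classic = ~` `]-oo, x]%classic.
    by apply/seteqP; split=> t /=; rewrite !in_itv /= andbT ltNge => /negP.
  by rewrite (pvmC pQ)// (pvmC pQ')// eqle.
move=> A mAA; apply/funext => f.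
have dE g : <|Q A g, g|> = <|Q' A g, g|>.
  have [mu muE] := diag_measure_exists pQ g.
  have [mu' muE'] := diag_measure_exists pQ' g.
  suff h : mu A = mu' A.
    rewrite !proj_dotff; [|exact: projQ'|exact: projQ].
    by move: h; rewrite -muE// -muE'// (diag_measureE pQ)// (diag_measureE pQ')// => -[->].
  apply: (@measure_unique _ _ _ (@RGenOInfty.G R) (fun n => `](- n%:R), +oo[%classic)) => //.
  - exact: RGenOInfty.measurableE.
  - move=> _ _ [x ->] [y ->]; exists (Num.max x y).
    by apply/seteqP; split=> t /=; rewrite !in_itv /= !andbT gt_max => /andP.
  - by move=> n; exists (- n%:R).
  - apply/seteqP; split=> // t _; exists (Num.truncn `|t|).+1 => //=.
    rewrite in_itv /= andbT ltrNl; apply: le_lt_trans (_ : `|t| < _).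
      by rewrite -normrN ler_norm.
    by have /andP[] := truncn_itv (normr_ge0 t).
  - move=> _ [x ->]; rewrite -muE ?measurable_itv// -muE' ?measurable_itv//.
    by rewrite (diag_measureE pQ) ?measurable_itv// (diag_measureE pQ') ?measurable_itv// eqgt.
  - move=> n; rewrite -muE ?measurable_itv// (diag_measureE pQ) ?measurable_itv//.
    by rewrite ltry.
have lT : linear_subspace (@setT H) by split.
have [l1 _ _] := projQ A mAA; have [l2 _ _] := projQ' A mAA.
apply: dot_extl => g; apply: (form_polarization lT) => // [k u v _ _|k u v _ _].
  exact: l1.
exact: l2.
Qed.

End SpectralUniqueness.

(** * Bounded functions of an operator and its powers *)

Section Multipliers.
Context {R : realType} {H : hilbertType R}.
Implicit Types (f g h : H) (A B S : set R) (phi psi : R -> R) (b c : operator H).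

Lemma le0_geometric (x C : R) : (forall n : nat, x <= C * 2 ^- n) -> x <= 0.
Proof.
move=> h; apply/ler_addgt0Pr => e e0; rewrite add0r.
have [N /(_ N (leqnn N)) /ltW] := geometric_small C e0.
exact: le_trans (h N).
Qed.

Lemma half_powS n : 2 ^- n.+1 = 2 ^- n / 2 :> R.
Proof. by rewrite exprS invfM mulrC. Qed.

(* psi = sum of 2^-(k+1) 1_{digit psi k}: binary digits, chosen greedily. *)
Fixpoint binary_rest psi (n : nat) : R -> R :=
  if n is m.+1 then
    fun t => binary_rest psi m t - 2 ^- m.+1 * \1_[set t | 2 ^- m.+1 <= binary_rest psi m t] t
  else psi.

Definition binary_digit psi (n : nat) : set R := [set t | 2 ^- n.+1 <= binary_rest psi n t].

Section Digits.
Variable psi : R -> R.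
Hypothesis mpsi : measurable_fun setT psi.
Hypothesis psi01 : forall t, 0 <= psi t <= 1.

Lemma binary_rest_itv n t : 0 <= binary_rest psi n t <= 2 ^- n.
Proof.
elim: n => [|n /andP[h1 h2]]; first by rewrite expr0 invr1.
rewrite /= indicE; have := half_powS n; case: (boolP (t \in _)) => /= [/set_mem /=|].
  by rewrite mulr1; move: (2 ^- n.+1) h1 h2 => x h1 h2 h3 h4; apply/andP; split; lra.
rewrite notin_setE /= => /negP; rewrite -ltNge mulr0 subr0 h1 => h3 _.
exact: ltW.
Qed.

Lemma measurable_binary n :
  measurable_fun setT (binary_rest psi n) /\ measurable (binary_digit psi n).
Proof.
have dig m : measurable_fun setT (binary_rest psi m) -> measurable (binary_digit psi m).
  move=> mr; rewrite -[binary_digit _ _]setTI.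
  rewrite (_ : binary_digit psi m = binary_rest psi m @^-1` `[2 ^- m.+1, +oo[%classic).
    by apply: mr => //; exact: measurable_itv.
  by apply/seteqP; split=> t; rewrite /binary_digit /= in_itv /= andbT.
suff mr : measurable_fun setT (binary_rest psi n) by split; [|exact: dig].
elim: n => [//|n IH] /=; apply: measurable_funB => //.
by apply: measurable_funM => //; exact: (nonneg_measurable_indic (dig _ IH)).1.
Qed.

End Digits.

Variables (p : H -> H) (Q : set R -> H -> H).
Hypothesis pQ : projection_valued_measure p Q.

Let projQ A : measurable A -> projection (Q A).
Proof. by have [h _ _] := pQ; exact: h. Qed.

Let linQ A : measurable A -> linear (Q A).
Proof. by move=> /projQ[]. Qed.

(** T stands for psi(b). The last clause speaks of T after an integral c, and not of T alone,
    because the comparison of two powers is what is wanted; phi = 1 gives back the form of T. *)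
Definition multiplier_of psi (T : H -> H) : Prop :=
  [/\ bounded_op T /\ opnorm T <= 1,
      adjoint_of T T,
      (forall f, p (T f) = T f) /\ (forall f, T (p f) = T f),
      forall y, bounded_op y ->
        (forall A f, measurable A -> y (Q A f) = Q A (y f)) ->
        forall f, y (T f) = T (y f) &
      forall phi c, nonneg_measurable phi -> spectral_integral p Q phi c ->
        forall f, dom c f ->
          <|T (c f), f|> = (fine (qint Q f (fun t => psi t * phi t)))%:C%C].

Lemma multiplier_exists psi : measurable_fun setT psi ->
  (forall t, 0 <= psi t <= 1) -> exists T, multiplier_of psi T.
Proof.
move=> mpsi psi01.
have mA n : measurable (binary_digit psi n) by exact: (measurable_binary mpsi n).2.
have mr n : nonneg_measurable (binary_rest psi n).
  split; first exact: (measurable_binary mpsi n).1.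
  by move=> t; have /andP[] := binary_rest_itv psi01 n t.
pose s n f := \sum_(k < n) (2 ^- k.+1)%:C%C *: Q (binary_digit psi k) f.
have sS n f : s n.+1 f = s n f + (2 ^- n.+1)%:C%C *: Q (binary_digit psi n) f.
  by rewrite /s big_ord_recr.
have s0 f : s 0%N f = 0 by rewrite /s big_ord0.
have ls n : linear (s n).
  elim: n => [|n IH] k f g; first by rewrite !s0 scaler0 addr0.
  rewrite !sS IH (linQ (mA n)) !scalerDr !scalerA addrACA.
  by rewrite [_%:C%C * k]mulrC.
have nQ n f : hnorm ((2 ^- n.+1)%:C%C *: Q (binary_digit psi n) f) <= 2 ^- n.+1 * hnorm f.
  rewrite hnormZ cabs_real ger0_norm//; apply: ler_wpM2l => //.
  exact: hnorm_proj (projQ (mA n)).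
have step n f : hnorm (s n.+1 f - s n f) <= 1 * hnorm f * 2 ^- n.
  rewrite sS addrC addKr mul1r mulrC; apply: le_trans (nQ n f) _.
  apply: ler_wpM2r; first exact: hnorm_ge0.
  by rewrite half_powS; have : 0 <= 2 ^- n :> R by []; lra.
(* The weights 1/2, ..., 2^-n sum to 1 - 2^-n; in the limit T is a contraction. *)
have sn n f : hnorm (s n f) <= (1 - 2 ^- n) * hnorm f.
  elim: n => [|n IH]; first by rewrite s0 hnorm0 expr0 invr1 subrr mul0r.
  rewrite sS; apply: le_trans (hnorm_leD _ _) _; have := nQ n f.
  by rewrite half_powS; lra.
have [T lT hT] := operator_limit ls step; exists T.
have T1 f : hnorm (T f) <= 1 * hnorm f.
  rewrite mul1r -subr_le0; apply: (@le0_geometric _ (2 * (1 * hnorm f))) => n.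
  have := hT n f; have := sn n f; rewrite hnormBC.
  have := hnorm_leD (T f - s n f) (s n f); rewrite subrK.
  have : 0 <= 2 ^- n * hnorm f by rewrite mulr_ge0 ?hnorm_ge0.
  lra.
have bT : bounded_op T by apply/bounded_opP; split=> //; exists 1.
have sT n f g : <|s n f, g|> = <|f, s n g|>.
  elim: n => [|n IH]; first by rewrite !s0 dot0l dot0r.
  rewrite !sS dotDl dotDr IH dotZl dotZr [Num.conj _]conjc_real.
  by rewrite (proj_dot _ _ (projQ (mA n))).
have scvg f : hcvg (s^~ f) (T f) := operator_limit_cvg (fun n => hT n f).
have sp n f : s n (p f) = s n f.
  by apply: eq_bigr => k _; rewrite (pvm_p pQ).
have bp : bounded_op p by rewrite -(pvmT pQ); exact/bounded_proj/projQ.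
have commT y : bounded_op y ->
    (forall A f, measurable A -> y (Q A f) = Q A (y f)) ->
    forall f, y (T f) = T (y f).
  move=> by_ yQ f; have ly := bounded_op_linear by_.
  have ys n g : s n (y g) = y (s n g).
    elim: n => [|n IH]; first by rewrite !s0 lin0.
    by rewrite !sS (linD _ _ ly) (linZ _ _ ly) yQ// IH.
  by rewrite (operator_limit_commute by_ hT ys).
have Tp f : T (p f) = T f.
  apply: hcvg_unique (scvg (p f)) _.
  by have -> : s^~ (p f) = s^~ f by apply/funext => n; rewrite sp.
split=> //.
- by split=> //; apply: opnorm_le.
- move=> f g; apply/eqP; rewrite -subr_eq0; apply/eqP/cabs_eq0/eqP.
  rewrite eq_le cabs_ge0 andbT.
  apply: (@le0_geometric _ (4 * (hnorm f * hnorm g))) => n.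
  have -> : <|T f, g|> - <|f, T g|> = <|T f - s n f, g|> - <|f, T g - s n g|>.
    by rewrite dotBl dotBr sT; ring.
  have tri (x y : R[i]) : cabs (x - y) <= cabs x + cabs y.
    by rewrite -lecR rmorphD /= -!cabsE ler_normB.
  apply: le_trans (tri _ _) _.
  have h1 := Cauchy_Schwarz (T f - s n f) g.
  have h2 := Cauchy_Schwarz f (T g - s n g).
  have h3 := ler_wpM2r (hnorm_ge0 g) (hT n f).
  have h4 := ler_wpM2l (hnorm_ge0 f) (hT n g).
  rewrite (hnormBC (T f)) in h1; rewrite (hnormBC (T g)) in h2.
  lra.
- split=> // f; rewrite commT ?Tp// => A g mAA.
  by rewrite (p_pvm pQ)// (pvm_p pQ).
move=> phi c np cI f df.
pose a n := fine (qint Q f (fun t => binary_rest psi n t * phi t)).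
have fin_phi := si_finite pQ np cI df.
have bound n t : binary_rest psi n t * phi t <= 2 ^- n * phi t.
  by apply: ler_wpM2r; [exact: np.2|have /andP[] := binary_rest_itv psi01 n t].
have nr n : nonneg_measurable (fun t => binary_rest psi n t * phi t).
  exact: nonneg_measurableM.
have n2 n : nonneg_measurable (fun t => 2 ^- n * phi t).
  by apply: nonneg_measurableM => //; exact: nonneg_measurable_cst.
have nA n : nonneg_measurable (fun t => \1_(binary_digit psi n) t * phi t).
  by apply: nonneg_measurableM => //; exact: nonneg_measurable_indic.
have fin2 n : (qint Q f (fun t => (2 ^- n * phi t)%R) < +oo)%E.
  by rewrite (qintZ pQ)// -(qint_fineK pQ np.2 fin_phi) -EFinM ltry.
have finr n : (qint Q f (fun t => (binary_rest psi n t * phi t)%R) < +oo)%E.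
  by apply: le_lt_trans (fin2 n); exact: (qint_le pQ).
have finA n : (qint Q f (fun t => (\1_(binary_digit psi n) t * phi t)%R) < +oo)%E.
  apply: le_lt_trans fin_phi; apply: (qint_le pQ) => // t.
  by rewrite ler_piMl ?np.2// indicE; case: (t \in _).
have aS n : a n = a n.+1 + 2 ^- n.+1 * fine (qint Q f (fun t => \1_(binary_digit psi n) t * phi t)).
  apply: EFin_inj; rewrite EFinD EFinM /a.
  rewrite (qint_fineK pQ (nr n).2 (finr n)) (qint_fineK pQ (nr n.+1).2 (finr n.+1)).
  rewrite (qint_fineK pQ (nA n).2 (finA n)) -(qintZ pQ)// -(qintD pQ)//; last first.
    by apply: nonneg_measurableM => //; exact: nonneg_measurable_cst.
  by congr qint; apply/funext => t; rewrite /= mulrBl mulrA subrK.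
have a_le n : 0 <= a n <= 2 ^- n * fine (qint Q f phi).
  rewrite -2!lee_fin EFinM (qint_fineK pQ (nr n).2 (finr n)).
  rewrite (qint_fineK pQ np.2 fin_phi) -(qintZ pQ)//.
  by rewrite (qint_ge0 pQ _ (nr n).2) (qint_le pQ).
(* Each digit moves its share from the remainder integral [a n] to the partial sum. As the remainder
   is at most 2^-n, [a n] tends to 0 and the limit is [a 0]. *)
have inv n : <|s n (c f), f|> = (a 0%N - a n)%:C%C.
  elim: n => [|n IH]; first by rewrite s0 dot0l subrr.
  rewrite sS dotDl IH dotZl (si_proj_form pQ np cI (mA n) df) -rmorphM -rmorphD /=.
  by congr (_ %:C%C); rewrite (aS n); ring.
apply/eqP; rewrite -subr_eq0; apply/eqP/cabs_eq0/eqP.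
rewrite eq_le cabs_ge0 andbT -/(a 0%N).
apply: (@le0_geometric _ (2 * hnorm (c f) * hnorm f + fine (qint Q f phi))) => n.
have -> : <|T (c f), f|> - (a 0%N)%:C%C = <|T (c f) - s n (c f), f|> - (a n)%:C%C.
  by rewrite dotBl inv rmorphB /=; ring.
have tri (x y : R[i]) : cabs (x - y) <= cabs x + cabs y.
  by rewrite -lecR rmorphD /= -!cabsE ler_normB.
apply: le_trans (tri _ _) _; rewrite cabs_real.
have h1 := Cauchy_Schwarz (T (c f) - s n (c f)) f.
have h3 := ler_wpM2r (hnorm_ge0 f) (hT n (c f)).
rewrite (hnormBC (T (c f))) in h1.
have /andP[a0 a1] := a_le n; rewrite ger0_norm//; lra.
Qed.

Lemma multiplier_spectral_integral psi T : measurable_fun setT psi ->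
  (forall t, 0 <= psi t <= 1) -> multiplier_of psi T ->
  spectral_integral p Q psi (Operator [set f | p f = f] T).
Proof.
move=> mpsi psi01 [[bT _] _ [pT Tp] _ formT].
have npsi : nonneg_measurable psi by split=> // t; have /andP[] := psi01 t.
have n1 := @nonneg_measurable_cst R 1 ler01.
have lp : linear p by rewrite -(pvmT pQ); exact: linQ.
have lin_dom (x : H -> H) : linear x -> linear_operator (Operator [set f | p f = f] x).
  move=> lx; split=> [|k f g /= pf pg]; first exact: lin0.
  by split; [rewrite lp pf pg|exact: lx].
have fin f psi' : nonneg_measurable psi' -> (forall t, psi' t <= 1) ->
    (qint Q f psi' < +oo)%E.
  move=> npsi' h; apply: (le_lt_trans (qint_le pQ f npsi' n1 h)).
  by rewrite (qint_cst pQ)// ltry.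
have oneI : spectral_integral p Q (fun=> 1) (Operator [set f | p f = f] id).
  split=> // [|f|f /= pf].
  - exact: lin_dom.
  - split=> [/= pf|[]//]; split=> //.
    by apply: (fin f (fun=> 1 ^+ 2)) => [|t]; rewrite ?expr1n.
  - rewrite -/(qint Q f (fun=> 1)) (qint_cst pQ)//= pf mul1r dotff//.
split=> //.
- exact/lin_dom/bounded_op_linear.
- move=> f /=; split=> [pf|[]//]; split=> //.
  apply: (fin f (fun t => psi t ^+ 2)); first exact: nonneg_measurable_sqr.
  by move=> t; have /andP[h1 h2] := psi01 t; rewrite expr_le1.
- move=> f /= pf; rewrite (formT _ _ n1 oneI f pf).
  by congr ((fine (qint _ _ _))%:C%C); apply/funext => t; rewrite mulr1.
Qed.

(** [d] and [T \o c] have the same quadratic form on the domain of [c]; polarization and [si_dense]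
    turn this into equality of vectors. *)
Lemma multiplier_comp psi T phi c d : measurable_fun setT psi ->
  (forall t, 0 <= psi t <= 1) -> multiplier_of psi T -> nonneg_measurable phi ->
  spectral_integral p Q phi c -> spectral_integral p Q (fun t => psi t * phi t) d ->
  forall f, dom c f -> dom d f /\ d f = T (c f).
Proof.
move=> mpsi psi01 [[bT _] _ [pT Tp] _ formT] np cI dI.
have npsi : nonneg_measurable psi by split=> // t; have /andP[] := psi01 t.
have nd := nonneg_measurableM npsi np.
have cd f : dom c f -> dom d f.
  move=> /(si_domE cI)[pf h]; apply/(si_domE dI); split=> //.
  apply: le_lt_trans h; apply: (qint_le pQ); try exact: nonneg_measurable_sqr.
  move=> t; rewrite exprMn ler_piMl ?sqr_ge0//.
  by have /andP[h1 h2] := psi01 t; rewrite expr_le1.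
have lT := bounded_op_linear bT.
have [c0 lc] : linear_operator c by case: cI.
have [_ ld] : linear_operator d by case: dI.
have lD : linear_subspace (dom c).
  by split=> // k u v du dv; have [] := lc k u v du dv.
move=> f df; split; first exact: cd.
apply: (si_dense pQ np cI); [by apply: (si_p dI); exact: cd|exact: pT|].
move=> g dg; apply: (form_polarization lD (F := d) (G := T \o c)) => //.
- by move=> k u v du dv; have [_] := ld k u v (cd _ du) (cd _ dv).
- by move=> k u v du dv; have [_ /= ->] := lc k u v du dv; rewrite lT.
- by move=> u du; rewrite (formT _ _ np cI _ du) (si_form dI (cd _ du)).
Qed.

End Multipliers.

(** * Powers through [get], and cut-off powers *)

Section Powers.
Context {R : realType} {H : hilbertType R}.
Implicit Types (f g h : H) (A B S : set R) (phi psi : R -> R) (b c : operator H).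

Lemma eq_spectral_integral (p : H -> H) (Q Q' : set R -> H -> H) phi phi' c :
  (forall f, p f = f -> qint Q f phi = qint Q' f phi') ->
  (forall f, p f = f ->
    qint Q f (fun t => phi t ^+ 2) = qint Q' f (fun t => phi' t ^+ 2)) ->
  spectral_integral p Q phi c -> spectral_integral p Q' phi' c.
Proof.
move=> e1 e2 [lc dc pc fc].
have dE f : dom c f <-> p f = f /\ (qint Q f (fun t => (phi t ^+ 2)%R) < +oo)%E.
  exact: dc.
split=> // f.
  rewrite dE; split=> -[pf h]; split=> //.
    exact: (eq_ind _ (fun x => (x < +oo)%E) h _ (e2 f pf)).
  exact: (eq_ind _ (fun x => (x < +oo)%E) h _ (esym (e2 f pf))).
move=> /[dup] df /dE[pf _]; rewrite fc//; congr ((fine _)%:C%C); exact: e1.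
Qed.

Lemma spectral_integral_pvm (p : H -> H) (Q Q' : set R -> H -> H) phi c :
  (forall A, measurable A -> Q A = Q' A) ->
  spectral_integral p Q phi c -> spectral_integral p Q' phi c.
Proof.
move=> QQ; apply: eq_spectral_integral => f _; apply: eq_measurable_integral => A mA;
  by rewrite /diag_measure QQ.
Qed.

Lemma spectral_integral_push (p : H -> H) (Q : set R -> H -> H) psi phi c :
  projection_valued_measure p Q -> measurable_fun setT psi ->
  nonneg_measurable phi ->
  spectral_integral p (fun A => Q (psi @^-1` A)) phi c <->
  spectral_integral p Q (phi \o psi) c.
Proof.
move=> pQ mpsi nphi.
have e1 f := qint_push f mpsi pQ nphi.
have e2 f := qint_push f mpsi pQ (nonneg_measurable_sqr nphi).
by split; apply: eq_spectral_integral => f _; rewrite ?e1 ?e2.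
Qed.

Lemma qint_push_id (p : H -> H) (Q : set R -> H -> H) psi f :
  projection_valued_measure p Q -> measurable_fun setT psi ->
  qint (fun A => Q (psi @^-1` A)) f id =
  (qint Q f (posp \o psi) - qint Q f (negp \o psi))%E.
Proof.
move=> pQ mpsi; rewrite (qint_id f (pvm_push mpsi pQ)) !(qint_push _ mpsi pQ)//.
  exact: nonneg_measurable_negp.
exact: nonneg_measurable_posp.
Qed.

(** The spectral measure of psi(b) is the image of that of b; with it a power of a power is computed
    from [Q] itself. *)
Lemma spectral_measure_push (p : H -> H) (Q : set R -> H -> H) psi c :
  projection_valued_measure p Q -> nonneg_measurable psi ->
  spectral_integral p Q psi c ->
  spectral_measure p c (fun A => Q (psi @^-1` A)).
Proof.
move=> pQ [mpsi psi0] cI; split; first exact: pvm_push.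
have nsq : nonneg_measurable (fun t : R => id t ^+ 2).
  by split=> [|t]; [exact: measurable_funX|exact: sqr_ge0].
apply: eq_spectral_integral cI => f _; last by rewrite (qint_push _ mpsi pQ nsq).
rewrite (qint_push_id f pQ mpsi).
have -> : posp \o psi = psi by apply/funext => t; rewrite /posp /= max_l.
have -> : negp \o psi = fun=> 0.
  by apply/funext => t; rewrite /negp /= max_r// oppr_le0.
by rewrite (qint_cst pQ)// mul0r sube0.
Qed.

Lemma nonneg_measurable_powR (alpha : R) : nonneg_measurable (fun t => t `^ alpha).
Proof. by split=> [|t]; [exact: measurable_powR|exact: powR_ge0]. Qed.

Lemma spectral_integral_positive (p : H -> H) (Q : set R -> H -> H) phi c :
  projection_valued_measure p Q -> nonneg_measurable phi ->
  spectral_integral p Q phi c -> positive_operator c.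
Proof.
move=> pQ np cI f df; rewrite (si_form cI df) ler0c fine_ge0//.
by apply: (qint_ge0 pQ); exact: np.2.
Qed.

Section OpowBasics.
Variables (p : H -> H) (Q : set R -> H -> H) (b : operator H).
Hypothesis sb : spectral_measure p b Q.
Hypothesis pb : positive_operator b.

(** [get] may pick an operator attached to another spectral measure of b; uniqueness brings it back
    to [Q]. The operator [c] serves as witness that there is something to pick. *)
Lemma opow_spec (alpha : R) c : spectral_integral p Q (fun t => t `^ alpha) c ->
  spectral_integral p Q (fun t => t `^ alpha) (opow p b alpha).
Proof.
move=> cI; have : exists c', [set c' | exists2 Q, spectral_measure p b Q &
    spectral_integral p Q (fun t => t `^ alpha) c'] c' by exists c, Q.
move=> /getPex [Q' sQ' h]; apply: spectral_integral_pvm h => A mA.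
exact: spectral_measure_unique sQ' sb pb A mA.
Qed.

(* Existence of the power can be read off from any point of its domain, since
   [get] on an empty predicate returns the operator with empty domain. *)
Lemma opow_dom (alpha : R) f : dom (opow p b alpha) f ->
  spectral_integral p Q (fun t => t `^ alpha) (opow p b alpha).
Proof.
have [[c [Q' sQ' h]]|no] := pselect (exists c', [set c' | exists2 Q, spectral_measure p b Q &
    spectral_integral p Q (fun t => t `^ alpha) c'] c').
  move=> _; apply: (opow_spec (c := c)); apply: spectral_integral_pvm h => A mA.
  exact: spectral_measure_unique sQ' sb pb A mA.
by rewrite /opow getPN// => c hc; apply: no; exists c.
Qed.

End OpowBasics.

(** [Linf_form] takes the square root of b^alpha, again through [get]. The core vector [f]
    guarantees that b^alpha and b^(alpha/2) exist, and the latter witnesses the square root. *)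
Lemma opow_half (p : H -> H) (Q : set R -> H -> H) b (alpha : R) f :
  spectral_measure p b Q -> positive_operator b -> core p b f -> 0 < alpha ->
  spectral_integral p Q (fun t => t `^ (alpha / 2)) (opow p (opow p b alpha) 2^-1).
Proof.
move=> sb pb cf a0; have [pQ _] := sb.
have na := nonneg_measurable_powR alpha; have nh := nonneg_measurable_powR 2^-1.
have cI := opow_dom sb pb (cf alpha a0).
have a2 : 0 < alpha / 2 by lra.
have dI := opow_dom sb pb (cf _ a2).
have sc := spectral_measure_push pQ na cI.
have pc := spectral_integral_positive pQ na cI.
have compE : (fun t : R => t `^ 2^-1) \o (fun t => t `^ alpha) = fun t => t `^ (alpha / 2).
  by apply/funext => t /=; rewrite powRrM.
rewrite -compE; apply/(spectral_integral_push _ pQ na.1 nh).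
apply: (opow_spec sc pc (c := opow p b (alpha / 2))).
by apply/(spectral_integral_push _ pQ na.1 nh); rewrite compE.
Qed.

(* t^alpha cut off to S; powR is 1 at negative reals, so this is also
   (t 1_S(t))^alpha when alpha <> 0. *)
Definition cut_power S (alpha t : R) : R := \1_S t * t `^ alpha.

Lemma nonneg_measurable_cut_power S (alpha : R) : measurable S ->
  nonneg_measurable (cut_power S alpha).
Proof.
move=> mS; apply: nonneg_measurableM; first exact: nonneg_measurable_indic.
exact: nonneg_measurable_powR.
Qed.

Lemma cut_power_comp S (alpha : R) : alpha != 0 ->
  (fun t => t `^ alpha) \o (fun t => \1_S t * t) = cut_power S alpha.
Proof.
move=> a0; apply/funext => t; rewrite /cut_power /= indicE.
by case: (t \in S); rewrite ?mul1r// !mul0r powR0.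
Qed.

Lemma cut_powerD S (alpha beta : R) : beta != 0 ->
  (fun t => cut_power S (beta - alpha) t * cut_power S alpha t) = cut_power S beta.
Proof.
move=> b0; apply/funext => t; rewrite /cut_power mulrACA -powRD ?subrK; last first.
  by rewrite (negPf b0).
by rewrite indicE; case: (t \in S); rewrite ?mulr1// !mul0r.
Qed.

Lemma cut_power_itv01 (alpha t : R) : 0 <= alpha ->
  0 <= cut_power `[0, 1]%classic alpha t <= 1.
Proof.
move=> a0; rewrite /cut_power indicE; case: (boolP (t \in _)) => [/set_mem|_]; last first.
  by rewrite mul0r lexx ler01.
rewrite /= in_itv /= mul1r powR_ge0 => /andP[t0 t1] /=.
have [->|a1] := eqVneq alpha 0; first by rewrite powRr0.
have e1 : 1 `^ alpha = 1 by rewrite powR1.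
by rewrite -e1; apply: ge0_ler_powR; rewrite ?nnegrE.
Qed.

Lemma cut_power_itv01C (alpha t : R) : alpha <= 0 ->
  0 <= cut_power (~` `[0, 1]%classic) alpha t <= 1.
Proof.
move=> a0; rewrite /cut_power indicE; case: (boolP (t \in _)) => [/set_mem|_]; last first.
  by rewrite mul0r lexx ler01.
rewrite /= in_itv /= => /negP; rewrite negb_and -!ltNge mul1r powR_ge0 /=.
(* The complement of [0,1] contains the negative reals, where [ln] is 0 and the power is 1. *)
rewrite /powR => /orP[t0|t1].
  by rewrite (lt_eqF t0) ln0 ?mulr0 ?expR0// ltW.
rewrite gt_eqF; last lra.
rewrite -[leRHS]expR0 ler_expR; apply: mulr_le0_ge0 => //; apply: ln_ge0; exact: ltW.
Qed.

Lemma spectral_integral_cut (p : H -> H) (Q : set R -> H -> H) S (alpha : R) c :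
  measurable S -> projection_valued_measure p Q -> (forall f, Q (~` S) f = 0) ->
  spectral_integral p Q (fun t => t `^ alpha) c ->
  spectral_integral p Q (cut_power S alpha) c.
Proof.
move=> mS pQ QS; have mS' := measurableC mS.
have n1 := nonneg_measurable_powR alpha; have n2 := nonneg_measurable_cut_power alpha mS.
have e t : ~ (~` S) t -> t `^ alpha = cut_power S alpha t.
  by move=> /contrapT St; rewrite /cut_power indicE mem_set// mul1r.
apply: eq_spectral_integral => f _; apply: (qint_null pQ mS' (QS f)) => //.
- exact: nonneg_measurable_sqr.
- exact: nonneg_measurable_sqr.
- by move=> t /e ->.
Qed.

End Powers.

(** * Spectral projections of [a] in [M], and the two parts of [a] *)

Section Reductions.
Context {R : realType} {H : hilbertType R}.
Variables (M : set (H -> H)) (a : operator H) (P : set R -> H -> H).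
Hypothesis vM : von_neumann M.
Hypothesis pa : positive_operator a.
Hypothesis aM : affiliated M a.
Hypothesis sP : spectral_measure id a P.
Implicit Types (A B S : set R) (f g h : H).

Let pP : projection_valued_measure id P. Proof. by case: sP. Qed.
Let aI : spectral_integral id P id a. Proof. by case: sP. Qed.
Let aI' := spectral_integral_posp sP pa.
Let npos := @nonneg_measurable_posp R.
Let projP A : measurable A -> projection (P A).
Proof. by have [h _ _] := pP; exact: h. Qed.
Let linP A : measurable A -> linear (P A).
Proof. by move=> /projP[]. Qed.

(** Affiliation makes [a] invariant under conjugation by u, so u^-1 P u is again a spectral measure
    of [a]; by uniqueness it is P. *)
Lemma pvm_unitary (u : H -> H) A f : commutant M u -> unitary_op u -> measurable A ->
  P A (u f) = u (P A f).
Proof.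
move=> cu uu mA; have [bu ur udot] := uu; have lu := bounded_op_linear bu.
have /choice[v uv] g : exists f, u f = g.
  have [h _ <-] : range u g by rewrite ur.
  by exists h.
have uinj h h' : u h = u h' -> h = h'.
  by move=> e; apply: dot_extr => k; rewrite -udot e udot.
have vu h : v (u h) = h by apply: uinj; rewrite uv.
have vdot h h' : <|v h, v h'|> = <|h, h'|> by rewrite -udot !uv.
have lv : linear v by move=> k h h'; apply: uinj; rewrite lu !uv.
have v1 h : hnorm (v h) <= 1 * hnorm h.
  rewrite mul1r -(@ler_pXn2r _ 2)// ?nnegrE ?hnorm_ge0//.
  by rewrite !hnorm_sqr vdot.
have bv : bounded_op v by apply/bounded_opP; split=> //; exists 1.
have uv_unitary : unitary_op v.
  by split=> //; apply/seteqP; split=> // h _; exists (u h).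
(* Affiliation only says that a unitary maps the domain of [a] into itself; the converse inclusion
   is affiliation for the inverse [v]. *)
have cv : commutant M v.
  split=> // x Mx; apply/funext => h /=; apply: uinj.
  by rewrite uv (commutantE _ cu Mx) uv.
pose P' B := v \o P B \o u.
have sP' : spectral_measure id a P'.
  split; first split.
  - move=> B mB; have pB := projP mB; split.
    + by move=> k h h'; rewrite /P' /= lu (linP mB) lv.
    + by apply/funext => h; rewrite /P' /= uv (proj_idem _ pB).
    + by move=> h h'; rewrite /P' /= -udot uv (proj_dot _ _ pB) -[RHS]udot uv.
  - by apply/funext => h; rewrite /P' (pvmT pP) /= vu.
  - move=> F mF tF h; apply/hcvgP.
    have := hcvg_linear lv v1 (pvm_cvg pP (u h) mF tF).
    congr hcvg; apply/funext => n /=.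
    elim: n => [|n IH]; first by rewrite !big_ord0 lin0.
    by rewrite !big_ord_recr /= (linD _ _ lv) IH.
  have [la da _ fa] := aI.
  have dE h : diag_measure P' h = diag_measure P (u h).
    by apply/funext => B; rewrite /diag_measure /P' /= -udot uv.
  split=> // h; rewrite dE.
    split=> [dh|[_ h1]].
      by have [/da[_ h1] _] := aM cu uu dh.
    have /da dh : id (u h) = u h /\ (\int[diag_measure P (u h)]_t (id t ^+ 2)%:E < +oo)%E by [].
    by have [+ _] := aM cv uv_unitary dh; rewrite vu.
  move=> dh; have [duh auh] := aM cu uu dh.
  by rewrite -udot -auh fa.
have e : P' A f = P A f by rewrite (spectral_measure_unique sP' sP pa mA).
by rewrite -e /P' /= uv.
Qed.

Lemma pvm_vonNeumann A : measurable A -> M (P A).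
Proof.
move=> mA; apply: vonNeumann_unitary => //; first exact/bounded_proj/projP.
by move=> u cu uu f; exact: pvm_unitary.
Qed.

Lemma p_inftyE : p_infty P = P (~` `[0, 1]%classic).
Proof.
apply/funext => f; rewrite /p_infty /p_zero (pvmC pP)//; exact: measurable_itv.
Qed.

Lemma a_proj_comm S f : measurable S -> dom a (P S f) -> P S (a (P S f)) = a (P S f).
Proof.
move=> mS df; have := si_comm pP npos aI' mS df; rewrite (proj_idem _ (projP mS)).
exact: esym.
Qed.

Lemma positive_comp S : measurable S -> positive_operator (op_comp a (P S)).
Proof.
move=> mS f /= df; rewrite -a_proj_comm// (proj_dot _ _ (projP mS)).
exact: pa.
Qed.

Lemma linear_comp S : measurable S -> linear_operator (op_comp a (P S)).
Proof.
move=> mS; have [[d0 la] _ _ _] := aI; split=> [|k f g /= df dg].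
  by rewrite /= lin0//; exact: linP.
have := la k _ _ df dg; rewrite -(linP mS) => -[? e]; split=> //.
Qed.

Lemma spectral_measure_op_restr S : measurable S ->
  spectral_measure (P S) (op_restr (op_comp a (P S)) (P S)) (fun A => P (S `&` A)).
Proof.
move=> mS; split; first exact: (pvm_restr mS pP).
have [_ da _ fa] := aI; have [l0 lS] := linear_comp mS.
have qE f phi : P S f = f -> qint (fun A => P (S `&` A)) f phi = qint P f phi.
  by move=> pf; exact: (qint_restr phi mS pP pf).
split.
- split=> [|k f g [/= df pf] [dg pg]].
    by split; [exact: l0|exact: (lin0 (linP mS))].
  by have [h1 h2] := lS k f g df dg; split=> //; split=> //=; rewrite (linP mS) pf pg.
- move=> f; rewrite -/(qint (fun A => P (S `&` A)) f (fun t => id t ^+ 2)).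
  split=> [[/= df pf]|[pf h]].
    split=> //; rewrite pf in df; move/da: df => -[_ h].
    exact: (eq_ind _ (fun x => (x < +oo)%E) h _ (esym (qE f (fun t => id t ^+ 2) pf))).
  split=> //=; rewrite pf; apply/da; split=> //.
  exact: (eq_ind _ (fun x => (x < +oo)%E) h _ (qE f (fun t => id t ^+ 2) pf)).
- by move=> f [/= df pf]; exact: a_proj_comm.
- move=> f [/= df pf]; rewrite pf in df *; rewrite (fa _ df).
  congr ((fine _)%:C%C); exact: (esym (qE f id pf)).
Qed.

Lemma positive_op_restr S : measurable S ->
  positive_operator (op_restr (op_comp a (P S)) (P S)).
Proof. by move=> mS f [/= df _]; exact: (positive_comp mS df). Qed.

Lemma measurable_cut S : measurable S -> measurable_fun setT (fun t : R => \1_S t * t).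
Proof.
by move=> mS; apply: measurable_funM => //; exact: (nonneg_measurable_indic mS).1.
Qed.

(** On the whole of [H] the operator a P(S) vanishes on the complement of the range of P(S); the map
    t |-> 1_S(t) t accordingly sends all mass off [S] to 0. *)
Lemma spectral_measure_op_comp S : measurable S ->
  spectral_measure id (op_comp a (P S)) (fun A => P ((fun t => \1_S t * t) @^-1` A)).
Proof.
move=> mS; have mh := measurable_cut mS; split; first exact: (pvm_push mh pP).
have [_ da _ fa] := aI; have [l0 lS] := linear_comp mS.
have nsq : nonneg_measurable (fun t : R => id t ^+ 2).
  by split=> [|t]; [exact: measurable_funX|exact: sqr_ge0].
have q2 f : qint (fun A => P ((fun t => \1_S t * t) @^-1` A)) f (fun t => id t ^+ 2) =
    qint P (P S f) (fun t => id t ^+ 2).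
  rewrite (qint_push _ mh pP nsq) (qint_proj pP)//; congr qint.
  by apply/funext => t; rewrite /= exprMn indicE; case: (t \in S); rewrite ?expr1n ?expr0n.
have q1 f : qint (fun A => P ((fun t => \1_S t * t) @^-1` A)) f id =
    qint P (P S f) id.
  have nneg := @nonneg_measurable_negp R.
  rewrite (qint_push_id _ pP mh) (qint_id _ pP) !(qint_proj pP)//.
  congr (_ - _)%E; congr qint; apply/funext => t; rewrite /posp /negp /= indicE;
    by case: (t \in S); rewrite ?mul1r// !mul0r ?oppr0 maxxx.
split=> //.
- move=> f; split=> [/= df|[_ h] /=].
    split=> //; move/da: df => -[_ h].
    exact: (eq_ind _ (fun x => (x < +oo)%E) h _ (esym (q2 f))).
  apply/da; split=> //.
  exact: (eq_ind _ (fun x => (x < +oo)%E) h _ (q2 f)).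
- move=> f /= df; rewrite -a_proj_comm// (proj_dot _ _ (projP mS)) (fa _ df).
  by congr ((fine _)%:C%C); exact: (esym (q1 f)).
Qed.

End Reductions.

(** * The spaces of forms *)

Section BanachFamilies.
Context {R : realType} {V : lmodType R[i]}.
Implicit Types (E : set V) (p : V -> R).

Definition banach E p : Prop :=
  [/\ linear_subspace E, seminorm_on E p, forall u, E u -> p u = 0 -> u = 0 &
      complete_seminorm E p].

Definition dominated E p E' p' : Prop :=
  E `<=` E' /\ forall u, E u -> p' u <= p u.

Lemma frechet_normed E p : banach E p -> frechet (normed_space E p).
Proof.
move=> [lE sp p0 cp]; have := @frechet_bigcap _ _ (fun=> E) (fun=> p).
have -> : \bigcap_(k in setT) (fun _ : nat => E) k = E.
  by apply/seteqP; split=> [u /(_ 0%N I)|u Eu k].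
have -> : range (fun _ : nat => p) = [set p].
  by apply/seteqP; split=> [_ [_ _ <-]|_ ->] //; exists 0%N.
by apply => // k; exact.
Qed.

Lemma dominated_continuous_seminorm E p E' p' X :
  linear_subspace E' -> seminorm_on E' p' -> lc_space X ->
  pts X `<=` E -> continuous_seminorm X p -> dominated E p E' p' ->
  continuous_seminorm X p'.
Proof.
move=> lE' sp' lX XE [sp cp] [EE' pp']; have [lXp [S sS oX]] := lX.
apply/(continuous_seminormE _ lXp sS oX); split.
  by apply: sub_seminorm_on sp' => u /XE/EE'.
move=> e e0; have : continuous_seminorm X p by [].
move=> /(continuous_seminormE _ lXp sS oX) [_ /(_ e e0)] [F [d [fF FS d0 h]]].
exists F, d; split=> // v Xv hv; apply: le_lt_trans (h v Xv hv).
by apply: pp'; exact: XE.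
Qed.

Lemma lc_normed E p : banach E p -> lc_space (normed_space E p).
Proof. by move=> /frechet_normed/frechet_lc. Qed.

Lemma normed_continuous_inclusion E p E' p' : banach E p -> banach E' p' ->
  dominated E p E' p' -> continuous_inclusion (normed_space E p) (normed_space E' p').
Proof.
move=> bE bE' /[dup] dom [EE' _]; have lX := lc_normed bE.
have [lE' sp' _ _] := bE'; have [lE sp _ _] := bE.
apply: seminorm_continuous_inclusion => // _ ->.
apply: (dominated_continuous_seminorm (E := E) (p := p) lE' sp') => //.
by apply: seminorm_continuous => //; move=> _ ->.
Qed.

Lemma seminorm_topology_cofinal E (S S' : set (V -> R)) : linear_subspace E ->
  (forall p, S p -> seminorm_on E p) -> S' `<=` S ->
  (forall p, S p -> exists2 p', S' p' & forall u, E u -> p u <= p' u) ->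
  seminorm_topology E S = seminorm_topology E S'.
Proof.
move=> lE sS SS cof; apply/seteqP; split; last exact: sub_seminorm_topology.
apply: seminorm_topology_min => //; first exact: topology_seminorm.
move=> p u e Sp Eu e0; split=> [v []//|v [Ev /= pv]].
have [p' Sp' pp'] := cof _ Sp.
exists [set p'], (e - p (v - u)); split=> //.
- by move=> _ ->.
- by rewrite subr_gt0.
- move=> w Ew /(_ p' erefl) h; split=> //=.
  have := seminorm_triangle lE (sS p Sp) Ew Ev Eu.
  have := pp' _ (linear_subspaceB lE Ew Ev); lra.
Qed.

Lemma frechet_family (d : R) (E : R -> set V) (p : R -> V -> R) :
  (forall x, d < x -> banach (E x) (p x)) ->
  (forall x y, d < x -> x <= y -> dominated (E y) (p y) (E x) (p x)) ->
  let F := \bigcap_(x in [set x | d < x]) E x in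
  frechet (LSpace F (seminorm_topology F [set p x | x in [set x | d < x]])).
Proof.
(* The range of exponents is open at [d], so the cofinal sequence starts at d + 1. *)
move=> bE dE F; pose r (k : nat) : R := d + k.+1%:R.
have dr k : d < r k by rewrite ltrDl ltr0Sn.
have rS k : r k <= r k.+1 by rewrite lerD2l ler_nat.
have cof x : exists k, x <= r k.
  exists (Num.truncn `|x - d|); have /andP[_ h] := truncn_itv (normr_ge0 (x - d)).
  by have := ler_norm (x - d); rewrite /r; lra.
have FE : F = \bigcap_k E (r k).
  apply/seteqP; split=> [u Fu k _|u Fu x dx]; first exact: (Fu (r k) (dr k)).
  have [k xk] := cof x; exact: (dE _ _ dx xk).1 (Fu k I).
have lF : linear_subspace F.
  split=> [x dx|a u v Fu Fv x dx]; have [lE _ _ _] := bE _ dx; first exact: lE.1.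
  by apply: lE.2; [exact: Fu|exact: Fv].
have -> : seminorm_topology F [set p x | x in [set x | d < x]] =
    seminorm_topology F (range (p \o r)).
  apply: seminorm_topology_cofinal => //.
  - move=> _ [x dx <-]; have [_ sp _ _] := bE _ dx.
    by apply: sub_seminorm_on sp => u; exact.
  - by move=> _ [k _ <-]; exists (r k) => //; exact: dr.
  - move=> _ [x dx <-]; have [k xk] := cof x; exists (p (r k)); first by exists k.
    by move=> u Fu; apply: (dE _ _ dx xk).2; exact: (Fu (r k) (dr k)).
rewrite FE; apply: frechet_bigcap => k.
- by have [] := bE _ (dr k).
- by have [] := bE _ (dr k).
- by have [] := bE _ (dr k).
- by have [] := bE _ (dr k).
- exact: (dE _ _ (dr k) (rS k)).1.
- exact: (dE _ _ (dr k) (rS k)).2.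
Qed.

End BanachFamilies.

Section FormSpaces.
Context {R : realType} {X : lmodType R[i]} {I J : Type}.
Local Notation V := (I -> J -> R[i]^o).
Variables (N : set X) (q : X -> R).
Hypothesis lN : linear_subspace N.
Hypothesis sq : seminorm_on N q.
Hypothesis cN : forall x : nat -> X, (forall n, N (x n)) ->
  (forall n, q (x n.+1 - x n) <= 2 ^- n) ->
  exists2 l, N l & forall e : R, 0 < e -> exists K : nat, forall n,
    (K <= n)%N -> q (x n - l) < e.

(** The bound by [K] makes each evaluation of the form at (i, j) continuous for [q], so the kernel
    of [F] is closed and the quotient norm is definite. *)
Lemma banach_quotient (F : X -> V) (K : I -> J -> R) :
  (forall (k : R[i]) x y, F (k *: x + y) = k *: F x + F y) ->
  (forall x i j, N x -> cabs (F x i j : R[i]) <= q x * K i j) ->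
  banach (F @` N) (quotient_norm N q F).
Proof.
move=> FP FK; split.
- exact: linear_subspace_quotient.
- exact: seminorm_quotient.
- move=> u Eu u0; apply/funext => i; apply/funext => j.
  apply: cabs_eq0; apply/eqP; rewrite eq_le cabs_ge0 andbT.
  apply: (@le0_geometric _ _ `|K i j|) => n.
  have [|x [Nx <- xn]] := quotient_norm_lt (q := q) (e := 2 ^- n) Eu.
    by rewrite u0.
  apply: le_trans (FK x i j Nx) _; have [q0 _ _] := sq; have := q0 _ Nx => qx.
  apply: (@le_trans _ _ (q x * `|K i j|)); first by rewrite ler_wpM2l// ler_norm.
  by rewrite mulrC ler_wpM2l// ltW.
- exact: complete_quotient.
Qed.

Lemma dominated_quotient (F G : X -> V) :
  (forall x, N x -> exists y, [/\ N y, F x = G y & q y <= q x]) ->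
  dominated (F @` N) (quotient_norm N q F) (G @` N) (quotient_norm N q G).
Proof.
move=> h; split=> [_ [x /h[y [Ny -> _]] <-]|_ [x Nx <-]]; first by exists y.
apply: lb_le_inf; first by exists (q x), x.
move=> _ [z [Nz <-] <-]; have [y [Ny -> yz]] := h z Nz.
by apply: le_trans yz; exact: quotient_norm_le.
Qed.

End FormSpaces.

(** * The entries of the matrix and the lower limit *)

Section LimitSpaces.
Context {R : realType} {H : hilbertType R}.
Variables (M : set (H -> H)) (a : operator H) (P : set R -> H -> H).
Hypothesis vM : von_neumann M.
Hypothesis pa : positive_operator a.
Hypothesis aM : affiliated M a.
Hypothesis sP : spectral_measure id a P.
Implicit Types (A B S : set R) (f g h : H) (alpha beta : R).

Let pP : projection_valued_measure id P. Proof. by case: sP. Qed.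
Let projP A : measurable A -> projection (P A).
Proof. by have [h _ _] := pP; exact: h. Qed.
Let linP A : measurable A -> linear (P A).
Proof. by move=> /projP[]. Qed.
Let MP A : measurable A -> M (P A). Proof. exact: (pvm_vonNeumann vM pa aM sP). Qed.
Let bM x : M x -> bounded_op x. Proof. exact: vonNeumann_bounded. Qed.
Let lM := vonNeumann_linear vM.
Let PP A : measurable A -> P A \o P A = P A.
Proof. by move=> /projP[]. Qed.

Lemma multiplier_vonNeumann (p : H -> H) (Q : set R -> H -> H) psi T :
  (forall A, measurable A -> M (Q A)) -> multiplier_of p Q psi T -> M T.
Proof.
move=> MQ [[bT _] _ _ comm _]; apply/(vonNeumannP _ vM); split=> // y cy f.
apply/esym; apply: comm; first by case: cy.
by move=> A g mA; rewrite (commutantE _ cy (MQ A mA)).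
Qed.

Section Diagonal.
Variable S : set R.
Hypothesis mS : measurable S.

Let p := P S.
Let b := op_restr (op_comp a p) p.
Let N := reduced M p.
Let D := core p b.
Let Q A := P (S `&` A).
Let pp : p \o p = p := PP mS.
Let lp : linear p := linP mS.

Let sb : spectral_measure p b Q. Proof. exact: spectral_measure_op_restr. Qed.
Let pb : positive_operator b. Proof. exact: positive_op_restr. Qed.
Let pQ : projection_valued_measure p Q. Proof. by case: sb. Qed.

Lemma reducedP x : N x <-> M x /\ p \o x \o p = x.
Proof.
split=> [[y My <-]|[Mx <-]]; last by exists x.
split; first exact: (vonNeumann_comp vM (vonNeumann_comp vM (MP mS) My) (MP mS)).
by apply/funext => f /=; rewrite -[p (p _)]/((p \o p) _) pp -[p (p f)]/((p \o p) f) pp.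
Qed.

Lemma linear_reduced : linear_subspace N.
Proof.
split; first by apply/reducedP; split; [exact: lM.1|apply/funext => f /=; rewrite lin0].
move=> k x y /reducedP[Mx px] /reducedP[My py]; apply/reducedP; split; first exact: lM.2.
apply/funext => f; rewrite -{2}px -{2}py /=.
by rewrite -[LHS]/(p (k *: x (p f) + y (p f))) lp.
Qed.

Lemma seminorm_reduced : seminorm_on N opnorm.
Proof.
apply: seminorm_opnorm linear_reduced => x /reducedP[Mx _]; exact: bM.
Qed.

Lemma complete_reduced (x : nat -> H -> H) : (forall n, N (x n)) ->
  (forall n, opnorm (x n.+1 - x n) <= 2 ^- n) ->
  exists2 l, N l & forall e : R, 0 < e -> exists K : nat, forall n,
    (K <= n)%N -> opnorm (x n - l) < e.
Proof.
move=> Nx step; have Mx n : M (x n) by have /reducedP[] := Nx n.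
have pNp y : N y -> p \o y \o p = y by move=> /reducedP[].
have [|l [Ml pl hl]] := vonNeumann_complete vM (MP mS) (MP mS) pp pp Mx.
  move=> n; rewrite -/p pNp//; by apply: (@linear_subspaceB _ _ N _ _ linear_reduced); exact: Nx.
have Nl : N l by apply/reducedP.
exists l => // e /hl[K hK]; exists K => n /hK; rewrite -/p pNp//.
by apply: (@linear_subspaceB _ _ N _ _ linear_reduced).
Qed.

Lemma Linf_banach c : banach (@Linf R H p N D c) (@Linf_norm R H p N D c).
Proof.
have := banach_quotient linear_reduced seminorm_reduced complete_reduced
  (F := @Linf_form R H p D c)
  (K := fun f g : D => hnorm (opow p c 2^-1 (\val f)) * hnorm (opow p c 2^-1 (\val g))).
apply.
- move=> k x y; apply/funext => f; apply/funext => g.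
  by rewrite /Linf_form -[LHS]/(<|k *: x _ + y _, _|>) dotDl dotZl.
- move=> x f g /reducedP[Mx _]; apply: le_trans (Cauchy_Schwarz _ _) _.
  rewrite mulrA; apply: ler_wpM2r; first exact: hnorm_ge0.
  exact/opnormP/bM.
Qed.

(** On the core b^(beta/2) = T b^(alpha/2) with a contraction T in [M], so the form of x for beta is
    the form of T x T for alpha. Which exponent is larger depends on [S] and is hidden in the
    condition on [cut_power]; thus both diagonal entries are covered. *)
Lemma Linf_dominated alpha beta : 0 < alpha -> 0 < beta ->
  (forall t, 0 <= cut_power S (beta / 2 - alpha / 2) t <= 1) ->
  dominated (@Linf R H p N D (opow p b beta)) (@Linf_norm R H p N D (opow p b beta))
    (@Linf R H p N D (opow p b alpha)) (@Linf_norm R H p N D (opow p b alpha)).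
Proof.
move=> a0 b0 psi01; have npsi := nonneg_measurable_cut_power (beta / 2 - alpha / 2) mS.
have [T mT] := multiplier_exists pQ npsi.1 psi01.
have MT : M T.
  by apply: multiplier_vonNeumann mT => A mA; apply: MP; exact: measurableI.
have [[bT T1] TT [pT Tp] _ _] := mT.
(* [Q] lives on [S], so powers may be exchanged for their cut-offs, the only ones whose quotients
   are bounded by 1. *)
have QS f : Q (~` S) f = 0 by rewrite /Q setICr (pvm0 pP).
have YT (f : D) : opow p (opow p b beta) 2^-1 (\val f) =
    T (opow p (opow p b alpha) 2^-1 (\val f)).
  have cf : core p b (\val f) by have := valP f; rewrite inE.
  have I1 := opow_half sb pb cf a0; have I2 := opow_half sb pb cf b0.
  have nc := nonneg_measurable_cut_power (alpha / 2) mS.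
  have J1 := spectral_integral_cut mS pQ QS I1.
  have J2 := spectral_integral_cut mS pQ QS I2.
  rewrite -(@cut_powerD _ S (alpha / 2) (beta / 2)) in J2; last first.
    by rewrite gt_eqF// divr_gt0.
  have df : dom (opow p (opow p b alpha) 2^-1) (\val f).
    have a2 : 0 < alpha / 2 by rewrite divr_gt0.
    have K1 := opow_dom sb pb (cf _ a2).
    by apply/(si_domE I1)/(si_domE K1); exact: cf.
  by have [_ e] := multiplier_comp pQ npsi.1 psi01 mT nc J1 J2 df; exact: e.
apply: (dominated_quotient seminorm_reduced) => x /reducedP[Mx px]; exists (T \o x \o T); split.
- apply/reducedP; split; first exact: (vonNeumann_comp vM (vonNeumann_comp vM MT Mx) MT).
  by apply/funext => f /=; rewrite Tp pT.
- apply/funext => f; apply/funext => g.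
  exact: (etrans (congr2 (fun u v : H => <|x u, v|>) (YT f) (YT g)) (esym (TT _ _))).
- apply: le_trans (opnorm_compr _ bT T1) _; first by apply: bounded_op_comp => //; exact: bM.
  by apply: opnorm_compl => //; exact: bM.
Qed.

End Diagonal.
Section OffDiagonal.

Let S0 : set R := `[0, 1]%classic.
Let S1 := ~` S0.
Let m0 : measurable S0. Proof. exact: measurable_itv. Qed.
Let m1 : measurable S1. Proof. exact: measurableC. Qed.
Let p0 := p_zero P.
Let p1 := p_infty P.
Let p1E : p1 = P S1. Proof. exact: (p_inftyE sP). Qed.
Let b0 := a_zero a P.
Let b1 := a_infty a P.
Let b1E : b1 = op_comp a (P S1). Proof. by rewrite -p1E. Qed.
Let Mp1 : M p1. Proof. by rewrite p1E; exact: MP. Qed.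
Let bp0 : bounded_op p0. Proof. exact/bM/MP. Qed.
Let sb0 := spectral_measure_op_comp pa sP m0.
Let pb0 : positive_operator b0. Proof. exact: (positive_comp pa sP m0). Qed.
Let sb1 : spectral_measure id b1 (fun A => P ((fun t => \1_S1 t * t) @^-1` A)).
Proof. by rewrite b1E; exact: spectral_measure_op_comp. Qed.
Let pb1 : positive_operator b1. Proof. by rewrite b1E; exact: positive_comp. Qed.

(** On [0,1] the power is bounded by 1, so it exists as a multiplier and is defined everywhere. *)
Lemma opow_zero alpha : 0 < alpha ->
  spectral_integral id P (cut_power S0 alpha) (opow id b0 alpha) /\
  forall f, dom (opow id b0 alpha) f.
Proof.
move=> a0; have npsi := nonneg_measurable_cut_power alpha m0.
have psi01 t := cut_power_itv01 t (ltW a0).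
have [T mT] := multiplier_exists pP npsi.1 psi01.
have TI := multiplier_spectral_integral pP npsi.1 psi01 mT.
have na := nonneg_measurable_powR alpha.
have e := cut_power_comp S0 (lt0r_neq0 a0).
have mh := measurable_cut m0.
have I : spectral_integral id P (cut_power S0 alpha) (opow id b0 alpha).
  rewrite -e; apply/(spectral_integral_push _ pP mh na).
  apply: (opow_spec sb0 pb0 (c := Operator [set f | id f = f] T)).
  by apply/(spectral_integral_push _ pP mh na); rewrite e.
by split=> // f; apply/(si_domE I)/(si_domE TI).
Qed.

(** This power may be unbounded; its existence is read off the core vector [f]. *)
Lemma opow_infty beta f : 0 < beta -> core id b1 f ->
  spectral_integral id P (cut_power S1 beta) (opow id b1 beta).
Proof.
move=> be0 cf; have na := nonneg_measurable_powR beta.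
rewrite -(cut_power_comp S1 (lt0r_neq0 be0)).
apply/(spectral_integral_push _ pP (measurable_cut m1) na).
exact: (opow_dom sb1 pb1 (cf _ be0)).
Qed.

(** [P S \o c] and [c] have the same quadratic form when phi vanishes off [S]. This lets [p0] and
    [p1] be inserted into the off-diagonal forms. *)
Lemma si_supported S phi c f : measurable S -> nonneg_measurable phi ->
  spectral_integral id P phi c -> (forall t, \1_S t * phi t = phi t) ->
  dom c f -> P S (c f) = c f.
Proof.
move=> mS np cI h df.
have [c0 lc] : linear_operator c by case: cI.
have lD : linear_subspace (dom c).
  by split=> // k u v du dv; have [] := lc k u v du dv.
apply: (si_dense pP np cI) => // g dg.
apply: (form_polarization lD (F := P S \o c) (G := c)) => //.
- by move=> k u v du dv; have [_ /= ->] := lc k u v du dv; rewrite linP.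
- by move=> k u v du dv; have [_] := lc k u v du dv.
- move=> u du /=; rewrite (si_proj_form pP np cI mS du) (si_form cI du).
  by congr ((fine (qint _ _ _))%:C%C); apply/funext.
Qed.

Lemma cut_supported S (x t : R) : \1_S t * cut_power S x t = cut_power S x t.
Proof.
by rewrite /cut_power indicE; case: (t \in S); rewrite ?mul1r// !mul0r.
Qed.

Lemma p_zero_opow alpha g : 0 < alpha -> p0 (opow id b0 alpha g) = opow id b0 alpha g.
Proof.
move=> a0; have [I dI] := opow_zero a0.
have npsi := nonneg_measurable_cut_power alpha m0.
exact: (si_supported m0 npsi I (cut_supported S0 alpha) (dI g)).
Qed.

Lemma p_infty_opow beta f : 0 < beta -> core id b1 f ->
  p1 (opow id b1 beta f) = opow id b1 beta f.
Proof.
move=> be0 cf; have I := opow_infty be0 cf.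
have npsi := nonneg_measurable_cut_power beta m1.
by rewrite p1E; exact: (si_supported m1 npsi I (cut_supported S1 beta) (cf _ be0)).
Qed.

Let q (x : H -> H) := opnorm (p0 \o x \o p1).

Let Mcomp x : M x -> M (p0 \o x \o p1).
Proof. by move=> Mx; exact: vonNeumann_comp vM (vonNeumann_comp vM (MP m0) Mx) Mp1. Qed.

Lemma seminorm_off : seminorm_on M q.
Proof.
have lp0 := bounded_op_linear bp0.
have [n0 nZ nD] := seminorm_opnorm bM lM.
split=> [x Mx|k x Mx|x y Mx My]; first exact: opnorm_ge0.
- rewrite /q -nZ; last exact: Mcomp.
  by congr opnorm; apply/funext => f; exact: linZ.
- rewrite /q; apply: le_trans (nD _ _ (Mcomp Mx) (Mcomp My)).
  rewrite le_eqVlt; apply/orP; left; apply/eqP; congr opnorm.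
  by apply/funext => f; exact: (linD (x (p1 f)) (y (p1 f)) lp0).
Qed.

Lemma complete_off (x : nat -> H -> H) : (forall n, M (x n)) ->
  (forall n, q (x n.+1 - x n) <= 2 ^- n) ->
  exists2 l, M l & forall e : R, 0 < e -> exists K : nat, forall n,
    (K <= n)%N -> q (x n - l) < e.
Proof.
move=> Mx step.
have pp1 : p1 \o p1 = p1 by rewrite p1E; exact: PP.
have [l [Ml _ hl]] := vonNeumann_complete vM (MP m0) Mp1 (PP m0) pp1 Mx step.
by exists l.
Qed.

Lemma off_banach alpha beta : 0 < alpha -> 0 < beta ->
  banach (@off_set R H M a P alpha beta) (@off_norm R H M a P alpha beta).
Proof.
move=> a0 be0.
have := banach_quotient lM seminorm_off complete_off
  (F := @off_form R H a P alpha beta)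
  (K := fun (f : core id b1) (g : H) =>
    hnorm (opow id b1 beta (\val f)) * hnorm (opow id b0 alpha g)).
apply.
- move=> k x y; apply/funext => f; apply/funext => g.
  by rewrite /off_form -[LHS]/(<|k *: x _ + y _, _|>) dotDl dotZl.
- move=> x f g Mx; rewrite /off_form -/b0 -/b1.
  have cf : core id b1 (\val f) by have := valP f; rewrite inE.
  (* The bound has to be by [q x], the norm of the corner, which may be smaller than the norm of x;
     the form sees only that corner. *)
  have -> : <|x (opow id b1 beta (\val f)), opow id b0 alpha g|> =
      <|(p0 \o x \o p1) (opow id b1 beta (\val f)), opow id b0 alpha g|>.
    by rewrite /= (p_infty_opow be0 cf) (proj_dot _ _ (projP m0)) [P _ _]p_zero_opow.
  apply: le_trans (Cauchy_Schwarz _ _) _.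
  rewrite mulrA; apply: ler_wpM2r; first exact: hnorm_ge0.
  exact/opnormP/bM/Mcomp.
Qed.

(** The larger power of [b0] is T times the smaller, so the form of x becomes that of T x. As T
    commutes with [p0], the norm of the corner does not grow. *)
Lemma off_dominatedl alpha alpha' beta : 0 < alpha -> alpha <= alpha' -> 0 < beta ->
  dominated (@off_set R H M a P alpha' beta) (@off_norm R H M a P alpha' beta)
    (@off_set R H M a P alpha beta) (@off_norm R H M a P alpha beta).
Proof.
move=> a0 aa be0; have a0' : 0 < alpha' by lra.
have psi01 t : 0 <= cut_power S0 (alpha' - alpha) t <= 1.
  by apply: cut_power_itv01; lra.
have npsi := nonneg_measurable_cut_power (alpha' - alpha) m0.
have nc := nonneg_measurable_cut_power alpha m0.
have [T mT] := multiplier_exists pP npsi.1 psi01.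
have MT : M T by apply: multiplier_vonNeumann mT => A mA; exact: MP.
have [[bT T1] TT _ comm _] := mT.
have [I dI] := opow_zero a0; have [I' _] := opow_zero a0'.
rewrite -(@cut_powerD _ S0 alpha alpha') in I'; last exact: lt0r_neq0.
have AT g : opow id b0 alpha' g = T (opow id b0 alpha g).
  by have [_ e] := multiplier_comp pP npsi.1 psi01 mT nc I I' (dI g); exact: e.
have T0 f : p0 (T f) = T (p0 f).
  apply: comm => // A g mA; rewrite (erefl : p0 = P S0) !(pvmI pP)//.
  by rewrite setIC.
apply: (dominated_quotient seminorm_off) => x Mx; exists (T \o x); split.
- exact: vonNeumann_comp.
- apply/funext => f; apply/funext => g.
  exact: (etrans (congr1 (fun v : H => <|x _, v|>) (AT g)) (esym (TT _ _))).
- rewrite /q; have -> : p0 \o (T \o x) \o p1 = T \o (p0 \o x \o p1).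
    by apply/funext => f /=; rewrite T0.
  by apply: opnorm_compl => //; exact/bM/Mcomp.
Qed.

(** Off [0,1] negative exponents give contractions, so here the smaller power is T times the larger,
    and x becomes x T. *)
Lemma off_dominatedr alpha beta beta' : 0 < beta -> beta <= beta' ->
  dominated (@off_set R H M a P alpha beta) (@off_norm R H M a P alpha beta)
    (@off_set R H M a P alpha beta') (@off_norm R H M a P alpha beta').
Proof.
move=> be0 bb; have be0' : 0 < beta' by lra.
have psi01 t : 0 <= cut_power S1 (beta - beta') t <= 1.
  by apply: cut_power_itv01C; lra.
have npsi := nonneg_measurable_cut_power (beta - beta') m1.
have nc := nonneg_measurable_cut_power beta' m1.
have [T mT] := multiplier_exists pP npsi.1 psi01.
have MT : M T by apply: multiplier_vonNeumann mT => A mA; exact: MP.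
have [[bT T1] _ _ comm _] := mT.
have BT (f : core id b1) : opow id b1 beta (\val f) = T (opow id b1 beta' (\val f)).
  have cf : core id b1 (\val f) by have := valP f; rewrite inE.
  have I := opow_infty be0 cf; have I' := opow_infty be0' cf.
  rewrite -(@cut_powerD _ S1 beta' beta) in I; last exact: lt0r_neq0.
  by have [_ e] := multiplier_comp pP npsi.1 psi01 mT nc I' I (cf _ be0'); exact: e.
have T1' f : p1 (T f) = T (p1 f).
  apply: (comm _ (bM Mp1)) => A g mA; rewrite p1E !(pvmI pP)//.
  by rewrite setIC.
apply: (dominated_quotient seminorm_off) => x Mx; exists (x \o T); split.
- exact: vonNeumann_comp.
- apply/funext => f; apply/funext => g.
  exact: (congr1 (fun u : H => <|x u, opow id b0 alpha g|>) (BT f)).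
- rewrite /q; have -> : p0 \o (x \o T) \o p1 = (p0 \o x \o p1) \o T.
    by apply/funext => f /=; rewrite T1'.
  by apply: opnorm_compr => //; exact/bM/Mcomp.
Qed.

Let off_family beta :=
  LSpace (\bigcap_(alpha in [set alpha | 0 < alpha]) @off_set R H M a P alpha beta)
    (seminorm_topology (\bigcap_(alpha in [set alpha | 0 < alpha]) @off_set R H M a P alpha beta)
      [set @off_norm R H M a P alpha beta | alpha in [set alpha | 0 < alpha]]).

Lemma frakS_inftyE beta : 0 < beta -> frakS_infty M a P beta = off_family beta.
Proof.
move=> be0; rewrite /frakS_infty /off_family /off_space /normed_space.
have := @projective_opensE R _ R [set alpha | 0 < alpha]
  (fun alpha => @off_set R H M a P alpha beta)
  (fun alpha => [set @off_norm R H M a P alpha beta]).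
have -> : \bigcup_(alpha in [set alpha | 0 < alpha]) [set @off_norm R H M a P alpha beta] =
    [set @off_norm R H M a P alpha beta | alpha in [set alpha | 0 < alpha]].
  apply/seteqP; split=> [u [alpha a0 ->]|_ [alpha a0 <-]]; by exists alpha.
move=> <- //; first by move=> alpha a0; have [] := off_banach a0 be0.
by move=> alpha u a0 ->; have [] := off_banach a0 be0.
Qed.

Lemma frechet_frakS_infty beta : 0 < beta -> frechet (frakS_infty M a P beta).
Proof.
move=> be0; rewrite frakS_inftyE//; apply: frechet_family => [x x0|x y x0 xy].
  exact: off_banach.
exact: off_dominatedl.
Qed.

Lemma frakS_infty_inclusion beta beta' : 0 < beta -> beta <= beta' ->
  continuous_inclusion (frakS_infty M a P beta) (frakS_infty M a P beta').
Proof.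
move=> be0 bb; have be0' : 0 < beta' by lra.
have := frechet_lc (frechet_frakS_infty be0).
rewrite (frakS_inftyE be0) (frakS_inftyE be0') => lX.
apply: (seminorm_continuous_inclusion lX) => [u Eu alpha a0|_ [alpha a0 <-]].
  exact: (off_dominatedr alpha be0 bb).1 (Eu _ a0).
have [lE' sp' _ _] := off_banach a0 be0'.
apply: (dominated_continuous_seminorm lE' sp' lX _ _ (off_dominatedr alpha be0 bb)).
  by move=> u /=; exact.
have [lX' _] := lX; apply: (seminorm_continuous lX' _ erefl) => /=.
  move=> _ [x x0 <-]; have [_ sp _ _] := off_banach x0 be0.
  by apply: sub_seminorm_on sp => u; exact.
by exists alpha.
Qed.

Lemma frechet_frakL_zero : frechet (frakL_zero M a P).
Proof.
rewrite /frakL_zero; apply: frechet_family => [x x1|x y x1 xy].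
  exact: Linf_banach.
apply: Linf_dominated => //; [lra|lra|move=> t].
by apply: cut_power_itv01; lra.
Qed.

Lemma Linf_infty_banach alpha :
  banach (@Linf_infty R H M a P alpha) (@Linf_infty_norm R H M a P alpha).
Proof.
rewrite /Linf_infty /Linf_infty_norm /b_infty /a_infty -/p1 p1E.
exact: Linf_banach.
Qed.

Lemma Linf_infty_dominated alpha beta : 0 < alpha -> alpha <= beta ->
  dominated (@Linf_infty R H M a P alpha) (@Linf_infty_norm R H M a P alpha)
    (@Linf_infty R H M a P beta) (@Linf_infty_norm R H M a P beta).
Proof.
move=> a0 ab; rewrite /Linf_infty /Linf_infty_norm /b_infty /a_infty -/p1 p1E.
apply: Linf_dominated => //; [lra|move=> t].
by apply: cut_power_itv01C; lra.
Qed.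

End OffDiagonal.

Let rho (d : R) (n : nat) : R := d + n.+1%:R.

Let rho_gt d n : d < rho d n. Proof. by rewrite ltrDl ltr0Sn. Qed.
Let rho_leS d n : rho d n <= rho d n.+1. Proof. by rewrite lerD2l ler_nat. Qed.
Let rho_cofinal d x : exists n, x <= rho d n.
Proof.
exists (Num.truncn `|x - d|); have /andP[_ h] := truncn_itv (normr_ge0 (x - d)).
by have := ler_norm (x - d); rewrite /rho; lra.
Qed.

Lemma lower_offE : lower_off M a P =
  inductive_space setT (fun n => frakS_infty M a P (rho 0 n)).
Proof.
apply: inductive_reindex => [be be0|n|n|be be0].
- exact/frechet_lc/frechet_frakS_infty.
- exact: rho_gt.
- by apply: frakS_infty_inclusion; [exact: rho_gt|exact: rho_leS].
- by have [n h] := rho_cofinal 0 be; exists n; exact: frakS_infty_inclusion.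
Qed.

Lemma frakL_inftyE : frakL_infty M a P =
  inductive_space setT (fun n => normed_space (@Linf_infty R H M a P (rho 1 n))
    (@Linf_infty_norm R H M a P (rho 1 n))).
Proof.
apply: (@inductive_reindex _ _ _ _ (fun alpha => normed_space (@Linf_infty R H M a P alpha)
  (@Linf_infty_norm R H M a P alpha)) (rho 1)) => [al al1|n|n|al al1].
- exact/lc_normed/Linf_infty_banach.
- exact: rho_gt.
- apply: normed_continuous_inclusion; try exact: Linf_infty_banach.
  by apply: Linf_infty_dominated; [have := rho_gt 1 n; lra|exact: rho_leS].
- have [n h] := rho_cofinal 1 al; exists n.
  apply: normed_continuous_inclusion; try exact: Linf_infty_banach.
  by apply: Linf_infty_dominated => //; move: al1 => /=; lra.
Qed.

Lemma LF_lower_limit : LF_space (lower_limit M a P).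
Proof.
pose Sn n := frakS_infty M a P (rho 0 n).
pose Zn n := normed_space (@Linf_infty R H M a P (rho 1 n)) (@Linf_infty_norm R H M a P (rho 1 n)).
pose j := @form_adjoint R (core id (a_infty a P)) H.
pose j' := @form_adjoint R H (core id (a_infty a P)).
have jj' : cancel j j'.
  by move=> u; apply/funext => f; apply/funext => g; rewrite /j /j' /form_adjoint conjCK.
have jP k u v : j (k *: u + v) = Num.conj k *: j u + j v.
  apply/funext => f; apply/funext => g; rewrite /j /form_adjoint.
  by rewrite -[LHS]/(Num.conj (k * u g f + v g f)) rmorphD rmorphM.
have L0 := frechet_lc frechet_frakL_zero.
have fS n : frechet (Sn n) by apply: frechet_frakS_infty; exact: rho_gt.
have fZ n : frechet (Zn n) by apply: frechet_normed; exact: Linf_infty_banach.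
have iL : increasing_lc (fun _ : nat => frakL_zero M a P).
  by split=> // n; apply: lc_continuous_inclusion.
have iS : increasing_lc Sn.
  split=> n; first exact/frechet_lc.
  by apply: frakS_infty_inclusion; [exact: rho_gt|exact: rho_leS].
have iZ : increasing_lc Zn.
  split=> n; first exact/frechet_lc.
  apply: normed_continuous_inclusion; try exact: Linf_infty_banach.
  by apply: Linf_infty_dominated; [have := rho_gt 1 n; lra|exact: rho_leS].
have iJ := increasing_image jP jj' iS.
exists (fun n => prod_space (prod_space (frakL_zero M a P) (Sn n))
  (prod_space (image_space j (Sn n)) (Zn n))); split.
- move=> n; apply: frechet_prod; apply: frechet_prod => //.
    exact: frechet_frakL_zero.
  exact: (frechet_image jP jj').
- by have [_ h] := increasing_prod (increasing_prod iL iS) (increasing_prod iJ iZ).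
rewrite /lower_limit /matrix_space lower_offE frakL_inftyE.
rewrite (inductive_image jP jj' iS) (inductive_prod iJ iZ).
(* The Fréchet entry is read as the limit of a constant sequence, so that all four entries are
   limits over the same index and the products can be merged. *)
rewrite -[frakL_zero M a P in LHS](inductive_cst L0) (inductive_prod iL iS).
by rewrite (inductive_prod (increasing_prod iL iS) (increasing_prod iJ iZ)).
Qed.

End LimitSpaces.

Theorem theorem4 (R : realType) (H : hilbertType R) (M : set (H -> H))
    (a : operator H) (P : set R -> H -> H) :
  von_neumann M ->
  selfadjoint a -> positive_operator a -> injective_operator a ->
  affiliated M a ->
  spectral_measure id a P ->
  pts (lower_off M a P) = pts (upper_off M a P) ->
  opens (upper_off M a P) = opens (lower_off M a P) ->
  upper_limit M a P = lower_limit M a P /\ LF_space (upper_limit M a P).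
Proof.
move=> vM _ pa _ aM sP ptsE opensE.
have offE : upper_off M a P = lower_off M a P.
  case: (upper_off M a P) (lower_off M a P) ptsE opensE => [? ?] [? ?] /=.
  by move=> -> ->.
have limE : upper_limit M a P = lower_limit M a P.
  by rewrite /upper_limit /lower_limit offE.
by split=> //; rewrite limE; exact: LF_lower_limit.
Qed.
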